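(* For any $\alpha,\beta\in\{-1,1\}$, the following hold for the $(3,2)$-configuration $\mathcal{D}_{\alpha,\beta}$ and its dual arrangement $\mathcal{M}^{\alpha,\beta}$: (1) The combinatorics of $\mathcal{D}_{\alpha,\beta}$ is $$\begin{array}{l}\big\{\{V_1,S_1,S_4\},\{V_1,S_2,S_3\},\{V_1,S_5,S_7^\alpha\},\{V_1,S_6,S_{10}^\beta\},\{V_1,S_8^\alpha,S_9^\alpha\},\{V_1,S_{11}^\beta,S_{12}^\beta\},\\ \{V_2,S_1,S_2\},\{V_2,S_3,S_6\},\{V_2,S_4,S_{12}^\beta\},\{V_2,S_5,S_8^\alpha\},\{V_2,S_7^\alpha,S_9^\alpha\},\{V_2,S_{10}^\beta,S_{11}^\beta\},\\ \{V_3,S_1,S_3\},\{V_3,S_2,S_5\},\{V_3,S_4,S_9^\alpha\},\{V_3,S_6,S_{11}^\beta\},\{V_3,S_7^\alpha,S_8^\alpha\},\{V_3,S_{10}^\beta,S_{12}^\beta\}\big\}.\end{array}$$ (2) $\mathcal{D}_{\alpha,\beta}$ is stable. (3) If $\alpha',\beta'\in\{-1,1\}$ are such that $\alpha\beta\neq\alpha'\beta'$, then there is no homeomorphism between the pairs $(\mathbb{CP}^2,\mathcal{M}^{\alpha,\beta})$ and $(\mathbb{CP}^2,\mathcal{M}^{\alpha',\beta'})$.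
   Context: For $\alpha,\beta\in\{-1,1\}$, $\mathcal{D}_{\alpha,\beta}$ is the configuration of 15 points of $\mathbb{RP}^2$ with vertex set $\mathcal{V}=\{V_1,V_2,V_3\}$, where $V_1=(0:0:1)$, $V_2=(1:0:0)$, $V_3=(0:1:0)$, and set of surrounding-points $\mathcal{S}_{\alpha,\beta}=\{S_1,\dots,S_6,S_7^\alpha,S_8^\alpha,S_9^\alpha,S_{10}^\beta,S_{11}^\beta,S_{12}^\beta\}$, where $S_1=(1:1:1)$, $S_2=(4:1:1)$, $S_3=(4:1:4)$, $S_4=(2:2:1)$, $S_5=(4:-2:1)$, $S_6=(-1:1:4)$; $S_7^\alpha=(4:-2:\alpha\sqrt2)$, $S_8^\alpha=(2\alpha\sqrt2:-2:1)$, $S_9^\alpha=(2:-\alpha\sqrt2:1)$; $S_{10}^\beta=(-1:1:\beta\sqrt2)$, $S_{11}^\beta=(-1:2\beta\sqrt2:4)$, $S_{12}^\beta=(-\beta\sqrt2:4:2)$. (It is a $(3,2)$-configuration: each surrounding-point carries weight $1\in\mathbb{Z}/2\mathbb{Z}$, each vertex weight $0$, no surrounding-point lies on a line joining two vertices, and on each line joining a vertex and a surrounding-point the weights sum to $0$.) The combinatorics of such a configuration is the collection of all triples of collinear points of $\mathcal{V}\sqcup\mathcal{S}_{\alpha,\beta}$. The configuration is stable if every bijection of $\mathcal{V}\sqcup\mathcal{S}_{\alpha,\beta}$ preserving the combinatorics maps $\mathcal{V}$ onto $\mathcal{V}$. For a point $P=(a:b:c)$, $P^\bullet=\{ax+by+cz=0\}\subset\mathbb{CP}^2$.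 The dual arrangement $\mathcal{M}^{\alpha,\beta}$ is the set of the 15 lines $P^\bullet$, $P\in\mathcal{V}\sqcup\mathcal{S}_{\alpha,\beta}$. A homeomorphism of pairs is a homeomorphism of $\mathbb{CP}^2$ mapping the union of the lines of the first arrangement onto the union of the lines of the second. *)

(* Defs.v *)
From HB Require Import structures.
From mathcomp Require Import all_boot all_order all_algebra.
From mathcomp Require Import generic_quotient complex.
From mathcomp Require Import all_classical all_reals topology normedtype.

Set Implicit Arguments.
Unset Strict Implicit.
Unset Printing Implicit Defensive.

Import Order.TTheory GRing.Theory Num.Theory.
Import numFieldNormedType.Exports.
Local Open Scope classical_set_scope.
Local Open Scope quotient_scope.
Local Open Scope ring_scope.

Section ProjectivePlane.
Variable K : fieldType.

Definition nzvec : Type := set_type [set v : 'rV[K]_3 | v != 0].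

(* Two nonzero vectors are proportional iff they span the same line. *)
Definition proportional (v w : nzvec) : bool := (\val v == \val w)%MS.

Lemma proportional_equiv : equiv_class_of proportional.
Proof.
split=> [v|v w|v u w]; rewrite /proportional ?submx_refl //.
- exact: andbC.
- by move=> /eqmxP uv /eqmxP vw; apply/eqmxP; exact: eqmx_trans uv vw.
Qed.

Canonical proportional_equivRel := EquivRelPack proportional_equiv.

Definition proj_plane : Type := {eq_quot proportional_equivRel}.

HB.instance Definition _ := Choice.on proj_plane.
HB.instance Definition _ := Quotient.on proj_plane.

Lemma nzvec_default_proof :
  (const_mx 1 : 'rV[K]_3) \in [set v : 'rV[K]_3 | v != 0].
Proof.
by apply/mem_set/negP => /eqP/rowP/(_ 0); rewrite !mxE; exact/eqP/oner_neq0.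
Qed.

Definition nzvec_default : nzvec := Sub (const_mx 1) nzvec_default_proof.

Definition row3 (a b c : K) : 'rV[K]_3 := \row_j [:: a; b; c]`_j.

(* The point (a : b : c); an irrelevant point when a = b = c = 0. *)
Definition hpoint (a b c : K) : proj_plane :=
  \pi_proj_plane (insubd nzvec_default (row3 a b c)).

(* Homogeneous coordinates, well defined only up to a nonzero factor. *)
Definition hcoord (P : proj_plane) : 'rV[K]_3 := \val (repr P).

Definition incident (l v : 'rV[K]_3) : Prop := \sum_j l 0 j * v 0 j = 0.

Definition collinear (T : set proj_plane) : Prop :=
  exists2 l : 'rV[K]_3, l != 0 & forall P, T P -> incident l (hcoord P).

Lemma hcoord_hpoint (a b c : K) : row3 a b c != 0 ->
  exists2 k : K, k != 0 & hcoord (hpoint a b c) = k *: row3 a b c.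
Proof.
move=> v0; set v := row3 a b c in v0 *.
set w : nzvec := insubd nzvec_default v.
have vw : \val w = v by rewrite insubdK//; exact/mem_set.
have : proportional (repr (hpoint a b c)) w.
  by apply/eqmodP; rewrite reprK.
rewrite /proportional vw => /andP[/sub_rVP[k hk] _].
exists k => //; apply/eqP => k0; have := valP (repr (hpoint a b c)).
by rewrite inE /= hk k0 scale0r eqxx.
Qed.

End ProjectivePlane.

Section Configurations.
Variable K : fieldType.

Record configuration := Configuration {
  vertices : set (proj_plane K);
  surrounding_points : set (proj_plane K) }.

Definition points (D : configuration) : set (proj_plane K) :=
  vertices D `|` surrounding_points D.

Definition combinatorics (D : configuration) : set (set (proj_plane K)) :=
  [set T | [/\ T `<=` points D, (T #= `I_3)%card & collinear T]].

Definition stable (D : configuration) : Prop :=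
  forall f : proj_plane K -> proj_plane K,
    set_bij (points D) (points D) f ->
    [set f @` T | T in combinatorics D] = combinatorics D ->
    f @` vertices D = vertices D.

End Configurations.

Section Dual.
Variable R : realType.

Definition RP2 : Type := proj_plane R.

(* R[i]^o is R[i] with the topology defined by its modulus. *)
Definition CP2 : Type :=
  quotient_topology (proj_plane (R[i]^o : fieldType)).

HB.instance Definition _ := Topological.on CP2.

Definition dual_line (P : RP2) : set CP2 :=
  [set Q | incident (map_mx (real_complex R) (hcoord P) : 'rV[R[i]^o]_3)
                    (hcoord Q)].

Definition dual_arrangement (D : configuration R) : set (set CP2) :=
  [set dual_line P | P in points D].

End Dual.

Definition homeomorphism (X Y : topologicalType) (f : X -> Y) : Prop :=
  continuous f /\
  exists g : Y -> X, [/\ continuous g, cancel f g & cancel g f].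

Definition homeomorphic_pairs (R : realType) (M N : set (set (CP2 R))) : Prop :=
  exists2 f : CP2 R -> CP2 R, homeomorphism f &
    f @` (\bigcup_(L in M) L) = \bigcup_(L in N) L.

Section Points.
Variable R : realType.
Local Notation sqrt2 := (Num.sqrt 2 : R).

Definition V1 : RP2 R := hpoint 0 0 1.
Definition V2 : RP2 R := hpoint 1 0 0.
Definition V3 : RP2 R := hpoint 0 1 0.
Definition S1 : RP2 R := hpoint 1 1 1.
Definition S2 : RP2 R := hpoint 4 1 1.
Definition S3 : RP2 R := hpoint 4 1 4.
Definition S4 : RP2 R := hpoint 2 2 1.
Definition S5 : RP2 R := hpoint 4 (- 2) 1.
Definition S6 : RP2 R := hpoint (- 1) 1 4.
Definition S7 (alpha : R) : RP2 R := hpoint 4 (- 2) (alpha * sqrt2).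
Definition S8 (alpha : R) : RP2 R := hpoint (2 * alpha * sqrt2) (- 2) 1.
Definition S9 (alpha : R) : RP2 R := hpoint 2 (- alpha * sqrt2) 1.
Definition S10 (beta : R) : RP2 R := hpoint (- 1) 1 (beta * sqrt2).
Definition S11 (beta : R) : RP2 R := hpoint (- 1) (2 * beta * sqrt2) 4.
Definition S12 (beta : R) : RP2 R := hpoint (- beta * sqrt2) 4 2.

Definition configD (alpha beta : R) : configuration R := {|
  vertices := [set V1; V2; V3];
  surrounding_points :=
    [set S1; S2; S3; S4; S5; S6; S7 alpha; S8 alpha; S9 alpha;
         S10 beta; S11 beta; S12 beta] |}.

Definition arrangementM (alpha beta : R) : set (set (CP2 R)) :=
  dual_arrangement (configD alpha beta).

End Points.

Arguments V1 {R}.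
Arguments V2 {R}.
Arguments V3 {R}.
Arguments S1 {R}.
Arguments S2 {R}.
Arguments S3 {R}.
Arguments S4 {R}.
Arguments S5 {R}.
Arguments S6 {R}.

(* Main.v *)
(* Let h be the product of the twelve linear forms dual to the surrounding
   points, divided by the twelfth power of one of them. A homeomorphism f of
   pairs maps lines to lines, since a projective line is not a finite union of
   proper closed subsets meeting pairwise in finitely many points; it preserves
   concurrency, hence, as in the proof of stability, permutes the three lines
   dual to the vertices. Near a generic point of each of the other twelve lines
   neither h nor h o f has a continuous square root off the line, so their
   product has one. Hence on a triangle embedded in CP^2, meeting each of these
   lines in at most one point and with boundary on the vertex lines, the product
   of h and h o f has a continuous square root off finitely many punctures. On
   each vertex line the factors of h are proportional in pairs, which gives
   explicit square roots there; along the boundary of the triangle they match up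
   to the sign alpha * beta, which is thus determined by the pair. *)

Require Import Defs.
From mathcomp Require Import all_boot all_order all_algebra.
From mathcomp Require Import generic_quotient complex.
From mathcomp Require Import all_classical all_reals topology normedtype realfun sequences.
From mathcomp Require Import ring lra.

Set Implicit Arguments.
Unset Strict Implicit.
Unset Printing Implicit Defensive.

Import Order.TTheory GRing.Theory Num.Theory.
Import numFieldNormedType.Exports.
Local Open Scope classical_set_scope.
Local Open Scope ring_scope.

(** * Continuity on a subset *)

(** A homeomorphism need not respect orientation or any complex structure, so only data modulo 2 can
    be expected to survive. The datum used is the double cover w^2 = h, branched along all twelve
    lines. Existence of a continuous square root stands for the vanishing of a class in H^1 with
    coefficients Z/2, and multiplication of functions for addition of classes. Near a generic point
    of a line there is only one nonzero class; this is why h and h o f, neither of which has a root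
    there, have a product that does. How h and h o f compare globally is not known; the disc turns
    the local agreement at its punctures into agreement along its boundary. The boundary must run on
    the vertex lines: the forms of two surrounding-points collinear with a vertex are proportional
    on its dual line, so h is a square there up to a constant. Twelve being even, another choice of
    denominator changes h by a square only. The argument is asymmetric: a root on the vertex lines
    of the target, available when the sign there is 1, forces the sign 1 on the source. Exchanging
    the homeomorphism and its inverse gives the equality of signs. *)

Section ContinuousOn.
Variables (T U : topologicalType).

(** Continuity of the restriction, stated for total functions: quotients of forms and chosen roots
    take arbitrary values off [A]. *)
Definition cont_on (A : set T) (f : T -> U) :=
  forall x, A x -> f @ within A (nbhs x) --> f x.

Lemma cont_onP (A : set T) (f : T -> U) : cont_on A f <->
  (forall x, A x -> forall V, nbhs (f x) V -> \forall y \near x, A y -> V (f y)).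
Proof. by []. Qed.

Lemma cont_on_sub (A B : set T) (f : T -> U) :
  A `<=` B -> cont_on B f -> cont_on A f.
Proof.
move=> AB /cont_onP cf; apply/cont_onP => x Ax V /(cf x (AB _ Ax)).
by apply: filterS => y h /AB.
Qed.

Lemma cont_on_continuous (A : set T) (f : T -> U) : continuous f -> cont_on A f.
Proof. by move=> cf x _; apply: cvg_within_filter; exact: cf. Qed.

Lemma cont_on_cst (A : set T) (c : U) : cont_on A (fun=> c).
Proof. by move=> x _; exact: cvg_cst. Qed.

Lemma cont_on_eq (A : set T) (f g : T -> U) : (forall x, A x -> f x = g x) ->
  cont_on A f -> cont_on A g.
Proof.
move=> fg /cont_onP cf; apply/cont_onP => x Ax V; rewrite -(fg x Ax) => /(cf x Ax).
by apply: filterS => y h Ay; rewrite -fg//; exact: h.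
Qed.

Lemma cont_on_local (A : set T) (f : T -> U) :
  (forall x, A x -> exists2 O, nbhs x O & cont_on (A `&` O) f) -> cont_on A f.
Proof.
move=> loc; apply/cont_onP => x Ax V fV; have [O xO /cont_onP cf] := loc x Ax.
have h := cf x (conj Ax (nbhs_singleton xO)) _ fV.
by near=> y => Ay; apply: (near h y) => //; split => //; near: y.
Unshelve. all: by end_near. Qed.

Lemma cont_on_open (A : set T) (f : T -> U) : open A ->
  cont_on A f <-> (forall x, A x -> {for x, continuous f}).
Proof.
move=> oA; split => [/cont_onP|] cf; last first.
  by move=> x Ax; apply: cvg_within_filter; exact: cf.
move=> x Ax V /(cf x Ax) h.
have : nbhs x A by exact: open_nbhs_nbhs.
exact: filterS2 h => y h /h.
Qed.

Lemma cont_on_setT (f : T -> U) : cont_on setT f <-> continuous f.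
Proof.
by split=> [/(cont_on_open _ openT) cf x|/cont_on_continuous]; [exact: cf|].
Qed.

Lemma cont_on_image (A : set T) (f : T -> U) : cont_on A f ->
  connected A -> connected (f @` A).
Proof.
by move=> cf cA; apply: connected_continuous_connected => //; apply/subspace_continuousP.
Qed.

End ContinuousOn.

Lemma cont_on_id (T : topologicalType) (A : set T) : cont_on A id.
Proof. by move=> x _ V; exact: cvg_within. Qed.

Lemma cont_on_comp (T U W : topologicalType) (A : set T) (B : set U)
    (f : T -> U) (g : U -> W) :
  (forall x, A x -> B (f x)) -> cont_on A f -> cont_on B g ->
  cont_on A (fun x => g (f x)).
Proof.
move=> AB /cont_onP cf /cont_onP cg; apply/cont_onP => x Ax V /(cg _ (AB x Ax)) h.
by have := cf x Ax _ h; apply: filterS => y h' Ay; apply: h' => //; exact: AB.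
Qed.

Lemma cont_on_pair (T U W : topologicalType) (A : set T) (f : T -> U) (g : T -> W) :
  cont_on A f -> cont_on A g -> cont_on A (fun x => (f x, g x)).
Proof. by move=> cf cg x Ax; apply: cvg_pair; [exact: cf|exact: cg]. Qed.

Lemma cont_on_fst (U W : topologicalType) (A : set (U * W)) : cont_on A fst.
Proof. by apply: cont_on_continuous => x; exact: cvg_fst. Qed.

Lemma cont_on_snd (U W : topologicalType) (A : set (U * W)) : cont_on A snd.
Proof. by apply: cont_on_continuous => x; exact: cvg_snd. Qed.

Section Field.
Variables (K : numFieldType) (T : topologicalType) (A : set T).
Implicit Types f g : T -> K.

Lemma cont_onD f g : cont_on A f -> cont_on A g -> cont_on A (fun x => f x + g x).
Proof. by move=> cf cg x Ax; apply: (@cvgD K K); [exact: cf|exact: cg]. Qed.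

Lemma cont_onN f : cont_on A f -> cont_on A (fun x => - f x).
Proof. by move=> cf x Ax; apply: (@cvgN K K); exact: cf. Qed.

Lemma cont_onM f g : cont_on A f -> cont_on A g -> cont_on A (fun x => f x * g x).
Proof. by move=> cf cg x Ax; apply: (@cvgM K); [exact: cf|exact: cg]. Qed.

Lemma cont_onV f : (forall x, A x -> f x != 0) -> cont_on A f ->
  cont_on A (fun x => (f x)^-1).
Proof. by move=> f0 cf x Ax; apply: (@cvgV K); [exact: f0|exact: cf]. Qed.

Lemma cont_onX f n : cont_on A f -> cont_on A (fun x => f x ^+ n).
Proof.
move=> cf; elim: n => [|n IHn]; first exact: cont_on_cst.
by under eq_fun do rewrite exprS; exact: cont_onM.
Qed.

End Field.

(** * Topology of the complex numbers and the principal square root *)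

Definition Cplx (R : realType) : numFieldType := R[i].

Section ComplexTopology.
Variable R : realType.
Local Notation C := (Cplx R).
Local Notation Re := (@complex.Re R).
Local Notation Im := (@complex.Im R).
Local Notation i := ('i%C : C).

Lemma Re_continuous : continuous (fun z : C => Re z).
Proof.
move=> z V /nbhs_ballP[e /= e0 eV]; apply/nbhs_ballP.
exists (e%:C%C : C) => [|w]; first by rewrite /= ltcR.
move=> zw; apply: eV; rewrite -ball_normE /= -ltcR.
apply: le_lt_trans zw.
by apply: le_trans (normc_ge_Re ((z : R[i]) - w)); case: z w => [? ?] [? ?].
Qed.

Lemma Im_continuous : continuous (fun z : C => Im z).
Proof.
have -> : (fun z : C => Im z) = (fun z : C => Re (z * (- i))).
  by apply/funext => -[a b]; rewrite /= ; simpc; rewrite ?oppr0 //=; lra.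
apply/cont_on_setT; apply: (cont_on_comp (B := setT)) => //.
  by apply: (@cont_onM C _ _ id); [exact: cont_on_id|exact: cont_on_cst].
exact/cont_on_setT/Re_continuous.
Qed.

Lemma real_complex_continuous : continuous (fun x : R => x%:C%C : C).
Proof.
move=> x V /nbhs_ballP[[e e'] /= e0 eV]; apply/nbhs_ballP.
have [ee0 e'0] : 0 < e /\ e' = 0.
  by move: e0; rewrite ltcE /= => /andP[/eqP -> ->].
exists e => // y; rewrite -ball_normE /= => xy; apply: eV.
rewrite -ball_normE /= e'0.
have -> : (x%:C%C : C) - y%:C%C = ((x - y)%:C%C : C) by rewrite rmorphB.
by rewrite normc_def /= expr0n addr0 sqrtr_sqr ltcR.
Qed.

Lemma cont_on_Re (T : topologicalType) (A : set T) (f : T -> C) :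
  cont_on A f -> cont_on A (fun x => Re (f x)).
Proof.
by move=> cf; apply: (cont_on_comp (B := setT)) cf _ => //;
  apply: cont_on_continuous; exact: Re_continuous.
Qed.

Lemma cont_on_Im (T : topologicalType) (A : set T) (f : T -> C) :
  cont_on A f -> cont_on A (fun x => Im (f x)).
Proof.
by move=> cf; apply: (cont_on_comp (B := setT)) cf _ => //;
  apply: cont_on_continuous; exact: Im_continuous.
Qed.

Lemma cont_on_real (T : topologicalType) (A : set T) (f : T -> R) :
  cont_on A f -> cont_on A (fun x => (f x)%:C%C : C).
Proof.
by move=> cf; apply: (cont_on_comp (B := setT)) cf _ => //;
  apply: cont_on_continuous; exact: real_complex_continuous.
Qed.

Lemma cont_on_sqrt (T : topologicalType) (A : set T) (f : T -> R) :
  cont_on A f -> cont_on A (fun x => Num.sqrt (f x)).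
Proof.
by move=> cf; apply: (cont_on_comp (B := setT)) cf _ => //;
  apply: cont_on_continuous; exact: sqrt_continuous.
Qed.

Lemma cont_on_complex (T : topologicalType) (A : set T) (f g : T -> R) :
  cont_on A f -> cont_on A g -> cont_on A (fun x => f x +i* g x : C)%C.
Proof.
move=> cf cg; apply: (@cont_on_eq _ _ _ (fun x => ((f x)%:C%C : C) + i * ((g x)%:C%C : C))).
  by move=> x _; rewrite [RHS]complexE.
apply: cont_onD; first exact: cont_on_real.
by apply: cont_onM; [exact: cont_on_cst|exact: cont_on_real].
Qed.

(* The square root with positive real part, for z off the negative axis. *)
Definition csqrt (z : C) : C :=
  let p := Num.sqrt ((Re z + Num.sqrt (Re z ^+ 2 + Im z ^+ 2)) / 2) in
  (p +i* (Im z / (2 * p)))%C.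

Lemma csqrt_pos (z : C) : 0 < Re z -> 0 < Re (csqrt z).
Proof. by move=> z0; rewrite /= sqrtr_gt0 divr_gt0// ltr_wpDr// sqrtr_ge0. Qed.

Lemma sqr_csqrt (z : C) : 0 < Re z -> csqrt z ^+ 2 = z.
Proof.
move=> z0; have p0 := csqrt_pos z0; rewrite expr2.
case: z z0 p0 => a b /= a0; set r := Num.sqrt (_ + _).
set p := Num.sqrt _ => p0.
have r2 : r ^+ 2 = a ^+ 2 + b ^+ 2 by rewrite sqr_sqrtr// addr_ge0// sqr_ge0.
have p2 : p ^+ 2 = (a + r) / 2.
  by rewrite sqr_sqrtr// divr_ge0// addr_ge0 ?sqrtr_ge0// ltW.
rewrite /csqrt /= -/r -/p; simpc.
apply/eqP; rewrite eq_complex /=; apply/andP; split; apply/eqP.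
  have -> : b / (2 * p) * (b / (2 * p)) = b ^+ 2 / (4 * p ^+ 2).
    by field; exact: lt0r_neq0.
  have -> : b ^+ 2 = r ^+ 2 - a ^+ 2 by rewrite r2; ring.
  rewrite -expr2 p2; field.
  by apply: lt0r_neq0; rewrite ltr_pwDl// sqrtr_ge0.
by field; exact: lt0r_neq0.
Qed.

Lemma cont_on_csqrt (T : topologicalType) (A : set T) (f : T -> C) :
  (forall x, A x -> 0 < Re (f x)) -> cont_on A f ->
  cont_on A (fun x => csqrt (f x)).
Proof.
move=> f0 cf.
have cp : cont_on A (fun x =>
    Num.sqrt ((Re (f x) + Num.sqrt (Re (f x) ^+ 2 + Im (f x) ^+ 2)) / 2)).
  apply: cont_on_sqrt; apply: cont_onM; last exact: cont_on_cst.
  apply: cont_onD; first exact: cont_on_Re.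
  by apply: cont_on_sqrt; apply: cont_onD; apply: cont_onX;
    [exact: cont_on_Re|exact: cont_on_Im].
apply: cont_on_complex => //.
apply: cont_onM; first exact: cont_on_Im.
apply: cont_onV => [x Ax|]; first by rewrite mulf_neq0// lt0r_neq0// (csqrt_pos (f0 _ Ax)).
by apply: cont_onM => //; exact: cont_on_cst.
Qed.

(** If the root is p + iq, the real part of its square is p^2 - q^2, which is positive: the argument
    of the root is less than a quarter of pi in absolute value. *)
Lemma csqrt_cone (z : C) : 0 < Re z -> `|Im (csqrt z)| < Re (csqrt z).
Proof.
move=> z0; have p0 := csqrt_pos z0; have := sqr_csqrt z0.
move: (csqrt z) p0 => [p q] /= p0 /(congr1 Re); rewrite expr2; simpc => /= h.
by rewrite -(ger0_norm (ltW p0)) -ltr_sqr ?nnegrE// !real_normK ?num_real//; nra.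
Qed.

(** The two sides agree up to sign. By [csqrt_cone] the product of the two roots has positive real
    part, as has the left side, so the sign is 1. *)
Lemma csqrtM (a b : C) : 0 < Re a -> 0 < Re b -> 0 < Re (a * b) ->
  csqrt (a * b) = csqrt a * csqrt b.
Proof.
move=> a0 b0 ab0.
have /eqP := sqr_csqrt ab0.
rewrite -{2}(sqr_csqrt a0) -{2}(sqr_csqrt b0) -exprMn eqf_sqr => /orP[/eqP//|/eqP h].
have := csqrt_pos ab0; rewrite h.
have := csqrt_cone a0; have := csqrt_cone b0.
move: (csqrt a) (csqrt b) => [p q] [p' q'] /=; rewrite !ltr_norml => /andP[? ?] /andP[? ?] ?.
by exfalso; nra.
Qed.

End ComplexTopology.

(** * Continuous square roots *)

Section Sqrt.
Variable R : realType.
Local Notation C := (Cplx R).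
Local Notation Re := (@complex.Re R).
Local Notation Im := (@complex.Im R).

Local Notation I01 := [set t : R | 0 <= t <= 1].

(** For [k] without zeros on [A] this says that the double cover w^2 = k of [A] is trivial. *)
Definition has_sqrt (T : topologicalType) (A : set T) (k : T -> C) :=
  exists2 s : T -> C, cont_on A s & forall x, A x -> s x ^+ 2 = k x.

Lemma has_sqrt_sub (T : topologicalType) (A B : set T) (k : T -> C) :
  A `<=` B -> has_sqrt B k -> has_sqrt A k.
Proof.
move=> AB [s cs sk]; exists s; first exact: cont_on_sub cs.
by move=> x /AB; exact: sk.
Qed.

Lemma has_sqrt_eq (T : topologicalType) (A : set T) (k l : T -> C) :
  (forall x, A x -> k x = l x) -> has_sqrt A k -> has_sqrt A l.
Proof. by move=> kl [s cs sk]; exists s => // x Ax; rewrite sk// kl. Qed.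

Lemma has_sqrtM (T : topologicalType) (A : set T) (k l : T -> C) :
  has_sqrt A k -> has_sqrt A l -> has_sqrt A (fun x => k x * l x).
Proof.
move=> [s cs sk] [t ct tl]; exists (fun x => s x * t x); first exact: cont_onM.
by move=> x Ax; rewrite exprMn sk// tl.
Qed.

Lemma has_sqrt_sqr (T : topologicalType) (A : set T) (k : T -> C) :
  cont_on A k -> has_sqrt A (fun x => k x ^+ 2).
Proof. by exists k. Qed.

Lemma has_sqrt_cst (T : topologicalType) (A : set T) (c : C) :
  has_sqrt A (fun=> c).
Proof.
exists (fun=> sqrtc c : C); first exact: cont_on_cst.
by move=> x _; exact: sqr_sqrtc.
Qed.

Lemma has_sqrt_comp (T U : topologicalType) (A : set T) (B : set U) (f : T -> U)
    (k : U -> C) :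
  (forall x, A x -> B (f x)) -> cont_on A f -> has_sqrt B k ->
  has_sqrt A (fun x => k (f x)).
Proof.
move=> AB cf [s cs sk]; exists (fun x => s (f x)).
  exact: cont_on_comp cs.
by move=> x Ax; rewrite sk//; exact: AB.
Qed.

(** Quotients of values close to the same nonzero number are close to 1, hence in the half plane
    where [csqrt] is continuous. *)
Lemma Re_div_near (a : C) : a != 0 ->
  exists2 V, nbhs a V & forall b c, V b -> V c -> 0 < Re (b / c).
Proof.
move=> a0.
have cd : cont_on [set bc : C * C | bc.2 != 0] (fun bc : C * C => Re (bc.1 / bc.2)).
  apply: cont_on_Re; apply: cont_onM; first exact: cont_on_fst.
  by apply: cont_onV; [|exact: cont_on_snd].
have a1 : 0 < Re (a / a) by rewrite divff//= ltr01.
have := cd (a, a) a0 _ (lt_nbhsr a1).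
move=> [[V1 V2] /= [aV1 aV2] V12].
have n0 : nbhs a [set z : C | z != 0].
  by apply: (@cvgr_neq0 C C _ (nbhs a) _ id a).
exists (V1 `&` V2 `&` [set z : C | z != 0]).
  by do 2!(apply: filterI => //).
move=> b c [[Vb _] _] [[_ Vc] c0].
by have := V12 (b, c) (conj Vb Vc) c0.
Qed.

Lemma prod_double (F : nat -> C) n :
  \prod_(0 <= i < n.*2) F i = \prod_(0 <= i < n) (F i.*2 * F i.*2.+1).
Proof.
elim: n => [|n IHn]; first by rewrite !big_geq.
by rewrite doubleS !big_nat_recr//= IHn mulrA.
Qed.

Section Homotopy.
Variables (T : topologicalType) (A : set T) (k : T * R -> C).
Hypothesis ck : cont_on (A `*` I01) k.
Hypothesis k0 : forall x, (A `*` I01) x -> k x != 0.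

(** A mesh for which consecutive values along the path over [y] have a quotient with a principal
    root. *)
Let fine_at n y := forall s t, 0 <= s <= 1 -> 0 <= t <= 1 ->
  `|s - t| <= n.+1%:R^-1 -> 0 < Re (k (y, s) / k (y, t)).

(** Tube lemma: the estimate near each (x, t) becomes uniform in t by compactness of the interval,
    in its near-covering form with the pair (y, n) tending to (x, infinity) as parameter. *)
Let fine_near x : A x -> exists n, \forall y \near x, A y -> fine_at n y.
Proof.
move=> Ax.
pose P (i : T * nat) (t : R) := A i.1 -> 0 <= t <= 1 -> forall s, 0 <= s <= 1 ->
   `|s - t| <= i.2.+1%:R^-1 -> 0 < Re (k (i.1, s) / k (i.1, t)).
have := @segment_compact R 0 1; rewrite set_itvE => /compact_near_coveringP/(_ _ (filter_prod (nbhs x) \oo) P) cov.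

have : \forall i \near filter_prod (nbhs x) \oo, I01 `<=` P i.
  apply: cov => t; rewrite /= => t01.
  have xt : (A `*` I01) (x, t) by split => //=.
  have [V aV VV] := Re_div_near (k0 xt).
  have := ck xt aV; move=> [[U J] /= [xU tJ] UJ].
  have /nbhs_ballP[e /= e0 eJ] := tJ.
  have e20 : 0 < e / 2 by rewrite divr_gt0.
  exists (ball t (e / 2), [set i : T * nat | U i.1 /\ i.2.+1%:R^-1 < e / 2]) => /=.
    split; first by apply: nbhsx_ballx; rewrite divr_gt0.
    exists (U, [set n | n.+1%:R^-1 < e / 2]) => /=; last by move=> [y n] /= [].
    split => //; exact: near_infty_natSinv_lt (interval_inference.PosNum e20).
  move=> [t' [y n]] /= [tt' [Uy ne]] Ay t'01 s s01 st'; apply: VV.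
    apply: (UJ (y, s)); last by split => //=.
    split => //=; apply: eJ; rewrite -ball_normE /=.
    move: tt'; rewrite -ball_normE /= => tt'.
    rewrite (_ : t - s = (t - t') - (s - t')); last by rewrite opprB addrA subrK.
    rewrite (le_lt_trans (ler_normB _ _))// (splitr e) ltrD//.
    exact: le_lt_trans ne.
  apply: (UJ (y, t')); last by split => //=.
  split => //=; apply: eJ; rewrite -ball_normE /=.
  by move: tt'; rewrite -ball_normE /= => /lt_trans; apply; lra.
move=> [[U J] /= [xU [n _ nJ]] UJ]; exists n.
apply: filterS xU => y Uy Ay s t s01 t01 st.
by apply: (UJ (y, n)) => //=; split => //; apply: nJ => /=.
Qed.

(** Dyadic points: the subdivision of level n + 1 refines that of level n, so products over two
    levels can be compared one level at a time. *)
Let dy n j : R := j%:R / (2 ^ n)%:R.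

Let ratio n j y := k (y, dy n j.+1) / k (y, dy n j).

(* As soon as all ratios lie in the right half plane, this product of principal
   roots is unchanged by further subdivision. *)
Let sig n y := \prod_(0 <= j < 2 ^ n) csqrt (ratio n j y).

Let dy01 n j : (j <= 2 ^ n)%N -> 0 <= dy n j <= 1.
Proof.
move=> jn; rewrite /dy divr_ge0//= ler_pdivrMr ?mul1r ?ler_nat//.
by rewrite ltr0n expn_gt0.
Qed.

Let dy_double n j : dy n.+1 j.*2 = dy n j.
Proof.
rewrite /dy expnS -muln2 mulnC !natrM invfM mulrACA divff ?mul1r//.
by rewrite pnatr_eq0.
Qed.

Let dyS n j : dy n j.+1 - dy n j = (2 ^ n)%:R^-1.
Proof. by rewrite /dy -mulrBl -natrB// subSnn mul1r. Qed.

Let dy_le n : (2 ^ n)%:R^-1 <= n.+1%:R^-1 :> R.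
Proof. by rewrite lef_pV2 ?posrE ?ltr0n ?expn_gt0// ler_nat ltn_expl. Qed.

Let kd0 n j y : A y -> (j <= 2 ^ n)%N -> k (y, dy n j) != 0.
Proof. by move=> Ay jn; apply: k0; split => //=; exact: dy01. Qed.

Let ratio_pos n j y : fine_at n y -> (j < 2 ^ n)%N -> 0 < Re (ratio n j y).
Proof.
move=> fy jn; apply: fy; [exact: dy01|by apply: dy01; exact: ltnW|].
by rewrite dyS ger0_norm ?invr_ge0// dy_le.
Qed.

Let sig_sqr n y : A y -> fine_at n y -> sig n y ^+ 2 = k (y, 1) / k (y, 0).
Proof.
move=> Ay fy; rewrite /sig -prodrXl.
have -> : 1 = dy n (2 ^ n) by rewrite /dy divff// pnatr_eq0 expn_eq0.
have -> : 0 = dy n 0 by rewrite /dy mul0r.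
have := leqnn (2 ^ n); move: {1 3 4}(2 ^ n)%N => m.
elim: m => [_|m IHm mn]; first by rewrite big_geq// divff// kd0.
rewrite big_nat_recr//= IHm 1?ltnW// sqr_csqrt; last exact: ratio_pos.
by rewrite mulrC /ratio mulrA divfK// kd0// ltnW.
Qed.

Let fineS n m y : (n <= m)%N -> fine_at n y -> fine_at m y.
Proof.
move=> nm fy s t s01 t01 st; apply: fy => //; apply: le_trans st _.
by rewrite lef_pV2 ?posrE ?ltr0n// ler_nat ltnS.
Qed.

Let sigS n y : A y -> fine_at n y -> sig n.+1 y = sig n y.
Proof.
move=> Ay fy; rewrite /sig expnS mul2n prod_double.
apply: eq_big_nat => j /= jn.
have j1 : (j.*2.+1 < 2 ^ n.+1)%N by rewrite expnS mul2n ltn_Sdouble.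
have j2 : (j.*2 < 2 ^ n.+1)%N by exact: ltnW.
have fy' : fine_at n.+1 y by exact: fineS fy.
have e : ratio n j y = ratio n.+1 j.*2 y * ratio n.+1 j.*2.+1 y.
  rewrite /ratio -doubleS !dy_double [RHS]mulrC mulrA divfK//.
  exact: kd0.
rewrite e csqrtM//; try exact: ratio_pos.
by rewrite -e; exact: ratio_pos.
Qed.

Let sig_eq n m y : A y -> fine_at n y -> fine_at m y -> sig n y = sig m y.
Proof.
move=> Ay.
have main n' m' : (n' <= m')%N -> fine_at n' y -> sig n' y = sig m' y.
  move=> /subnKC <- fy; elim: (m' - n')%N => [|d ->]; first by rewrite addn0.
  by rewrite addnS sigS//; apply: fineS fy; exact: leq_addr.
by case/orP: (leq_total n m) => nm fn fm; [|symmetry]; exact: main.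
Qed.

(** Path lifting by hand: the quotient telescopes into ratios having principal roots. The product of
    these roots is continuous where one mesh is fine, and its value does not depend on the mesh, so
    the local roots glue. *)
Lemma has_sqrt_homotopy : has_sqrt A (fun x => k (x, 1) / k (x, 0)).
Proof.
(* The level [N] may jump from point to point; [sig_eq] makes the resulting value independent of
   it. *)
have /choice[N fN] : forall x, exists n, A x -> fine_at n x.
  move=> x; have [Ax|nAx] := pselect (A x); last by exists 0%N.
  have [n h] := fine_near Ax; exists n => _; exact: (nbhs_singleton h Ax).
exists (fun x => sig (N x) x); last by move=> x Ax; apply: sig_sqr => //; exact: fN.
apply: cont_on_local => x Ax; have [n h] := fine_near Ax.
eexists; first exact: h.
apply: (cont_on_eq (f := sig n)).
  by move=> y [Ay fy]; apply: sig_eq => //; [exact: fy|exact: fN].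
rewrite /sig; have := leqnn (2 ^ n)%N; move: {1 3}(2 ^ n)%N => m.
elim: m => [_|m IHm mn].
  by apply: (cont_on_eq (f := fun=> 1 : C)) => [y _|]; [rewrite big_geq|exact: cont_on_cst].
apply: (cont_on_eq (f := fun y =>
   (\prod_(0 <= j < m) csqrt (ratio n j y)) * csqrt (ratio n m y))).
  by move=> y _; rewrite big_nat_recr.
apply: cont_onM; first by apply: IHm; exact: ltnW.
have cd j : (j <= 2 ^ n)%N -> cont_on (A `&` [set y | A y -> fine_at n y])
    (fun y => k (y, dy n j)).
  move=> jn; apply: (cont_on_comp (B := A `*` I01)) ck.
    by move=> y [Ay _]; split => //=; exact: dy01.
  by apply: cont_on_pair; [exact: cont_on_id|exact: cont_on_cst].
apply: cont_on_csqrt => [y [Ay fy]|]; first exact: ratio_pos (fy Ay) mn.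
apply: cont_onM; first exact: cd.
apply: cont_onV => [y [Ay _]|]; [exact: kd0 (ltnW mn)|exact: cd (ltnW mn)].
Qed.

End Homotopy.

(** Along the contraction, [k \o c] is a homotopy from the constant [k b] to [k]; the root of the
    quotient is multiplied by a root of that constant. *)
Lemma has_sqrt_contractible (T : topologicalType) (A : set T) (c : T * R -> T)
    (b : T) (k : T -> C) :
  (forall x t, A x -> 0 <= t <= 1 -> A (c (x, t))) ->
  (forall x, A x -> c (x, 0) = b) -> (forall x, A x -> c (x, 1) = x) ->
  cont_on (A `*` I01) c ->
  cont_on A k -> (forall x, A x -> k x != 0) -> has_sqrt A k.
Proof.
move=> cA c0 c1 cc ck k0.
have AB x : (A `*` I01) x -> A (c x).
  by case: x => x t [/= Ax] t01; exact: cA.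
have := @has_sqrt_homotopy _ A (fun x => k (c x)) _ _.
case; [exact: cont_on_comp ck|by move=> x /AB; exact: k0|].
move=> s cs sk; apply: (has_sqrt_eq (k := fun x => k (c (x, 1)) / k (c (x, 0)) * k b)).
  move=> x Ax; rewrite c0// c1// divfK// -(c0 _ Ax); apply: k0; apply: cA => //.
  by rewrite lexx ler01.
by apply: has_sqrtM; [exists s|exact: has_sqrt_cst].
Qed.

(** The quotient of two roots takes only the values 1 and -1, hence is constant on a connected set.
    All comparisons of roots below rest on this. *)
Lemma sqrt_sign (T : topologicalType) (A : set T) (s t : T -> C) :
  connected A -> cont_on A s -> cont_on A t ->
  (forall x, A x -> s x ^+ 2 = t x ^+ 2) -> (forall x, A x -> t x != 0) ->
  exists2 e : C, e ^+ 2 = 1 & forall x, A x -> s x = e * t x.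
Proof.
move=> cA cs ct st t0.
have e12 x : A x -> s x / t x = 1 \/ s x / t x = -1.
  move=> Ax; have /eqP := st _ Ax; rewrite eqf_sqr => /orP[]/eqP ->.
    by left; rewrite divff// t0.
  by right; rewrite mulNr divff// t0.
have cR : cont_on A (fun x => Re (s x / t x)).
  by apply: cont_on_Re; apply: (cont_onM cs); exact: cont_onV.
have /connected_intervalP iR := cont_on_image cR cA.
have [[x Ax]|A0] := pselect (A !=set0); last first.
  by exists 1; rewrite ?expr1n// => x Ax; exfalso; apply: A0; exists x.
exists (s x / t x); first by case: (e12 x Ax) => ->; rewrite ?sqrrN expr1n.
suff h y : A y -> s y / t y = s x / t x.
  by move=> y Ay; rewrite -(h y Ay) divfK// t0.
move=> Ay; apply: contrapT => neq.
(* The real parts of the quotient form an interval; containing 1 and -1 it would contain 0. *)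
have mid u v : A u -> A v -> s u / t u = 1 -> s v / t v = -1 -> False.
  move=> Au Av u1 v1.
  have [] := iR (Re (s v / t v)) (Re (s u / t u)) _ _ 0; [by exists v|by exists u| |].
    by rewrite u1 v1 /= ler01 lerN10.
  move=> w Aw; case: (e12 w Aw) => -> /=.
    by move/eqP; rewrite oner_eq0.
  by move/eqP; rewrite oppr_eq0 oner_eq0.
case: (e12 x Ax) => ex; case: (e12 y Ay) => ey; first by apply: neq; rewrite ex ey.
- exact: (mid x y).
- exact: (mid y x).
- by apply: neq; rewrite ex ey.
Qed.

Lemma I01_connected : connected I01.
Proof.
apply/connected_intervalP => x y /= /andP[x0 _] /andP[_ y1] z /andP[xz zy].
by rewrite (le_trans x0 xz) (le_trans zy y1).
Qed.

Lemma connected_contractible (T : topologicalType) (A : set T) (c : T * R -> T)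
    (b : T) :
  (forall x t, A x -> 0 <= t <= 1 -> A (c (x, t))) ->
  (forall x, A x -> c (x, 0) = b) -> (forall x, A x -> c (x, 1) = x) ->
  cont_on (A `*` I01) c -> connected A.
Proof.
move=> cA c0 c1 cc.
have -> : A = \bigcup_(x in A) ((fun t => c (x, t)) @` I01).
  apply/seteqP; split => [x Ax|y [x Ax [t t01 <-]]]; last exact: cA.
  by exists x => //; exists 1; rewrite /= ?lexx ?ler01// c1.
have [[x0 Ax0]|A0] := pselect (A !=set0); last first.
  rewrite bigcup0; first exact: connected0.
  by move=> x Ax; exfalso; apply: A0; exists x.
apply: bigcup_connected.
  exists b => x Ax; exists 0; rewrite /= ?lexx ?ler01//; exact: c0.
move=> x Ax; apply: cont_on_image I01_connected.
apply: cont_on_comp cc => [t t01|]; first by split.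
by apply: cont_on_pair; [exact: cont_on_cst|exact: cont_on_id].
Qed.

Lemma disc_no_sqrt (e : C) : 0 < e ->
  ~ has_sqrt [set w : C | w != 0 /\ `|w| < e] id.
Proof.
move=> e0 [s cs sw].
pose i : C := 'i%C; have i2 : i * i = -1 by rewrite /i -expr2 sqr_i.
have ii : i != 0.
  by apply: contraTneq (isT) => h; have := i2; rewrite h mul0r => /eqP; rewrite eq_sym oppr_eq0 oner_eq0.
(* Along the path from c to i c, s w * s (- w) is i w up to a constant sign;
   two quarter turns then give s (- w) * s w = - s w * s (- w). *)
have quarter c : c != 0 -> `|c| < e ->
    s (i * c) * s (- (i * c)) = i * (s c * s (- c)).
  move=> c0 ce.
  pose w (t : R) : C := c * (((1 - t)%:C%C : C) + i * (t%:C%C : C)).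
  have w0 t : I01 t -> w t != 0.
    move=> /= t01; rewrite mulf_neq0//.
    have -> : ((1 - t)%:C%C : C) + i * (t%:C%C : C) = ((1 - t) +i* t)%C.
      by rewrite [RHS]complexE.
    rewrite eq_complex /= negb_and; have [->|] := eqVneq t 0; last by rewrite orbT.
    by rewrite subr0 oner_eq0.
  have we t : I01 t -> `|w t| < e.
    move=> /= /andP[t0 t1]; apply: le_lt_trans ce; rewrite normrM.
    rewrite ler_piMr//; apply: le_trans (ler_normD _ _) _.
    rewrite normrM (_ : `|i| = 1) ?mul1r; last first.
      by rewrite normc_def /= expr0n expr1n add0r sqrtr1.
    rewrite !normc_def /= !expr0n !addr0 !sqrtr_sqr -rmorphD lecR.
    by rewrite !ger0_norm ?subr_ge0// subrK.
  have wN t : I01 t -> [set w : C | w != 0 /\ `|w| < e] (w t) /\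
     [set w : C | w != 0 /\ `|w| < e] (- w t).
    by move=> It; rewrite /= normrN oppr_eq0; do !split; auto.
  have cw : cont_on I01 w.
    apply: (@cont_onM C); first exact: cont_on_cst.
    apply: (@cont_onD C); first apply: cont_on_real.
      by apply: (@cont_onD R _ _ (fun=> 1)); [exact: cont_on_cst|apply: cont_onN; exact: cont_on_id].
    apply: (@cont_onM C); first exact: cont_on_cst.
    by apply: cont_on_real; exact: cont_on_id.
  have [] := @sqrt_sign R I01 (fun t => s (w t) * s (- w t)) (fun t => i * w t) I01_connected.
  - apply: cont_onM; first by apply: cont_on_comp cs => // t /wN[].
    by apply: cont_on_comp cs; [by move=> t /wN[]|exact: cont_onN].
  - by apply: (cont_onM _ cw); exact: cont_on_cst.
  - move=> t /wN[h1 h2]; rewrite [LHS]exprMn (sw _ h1) (sw _ h2) [RHS]exprMn.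
    by rewrite !expr2 i2 mulrN mulN1r.
  - by move=> t It; rewrite mulf_neq0// w0.
  move=> eps _ h.
  have wE0 : w 0 = c by rewrite /w subr0 mulr0 addr0 mulr1.
  have wE1 : w 1 = i * c by rewrite /w subrr add0r mulr1 mulrC.
  have := h 0; rewrite /= lexx ler01 => /(_ isT); rewrite wE0 => ->.
  have := h 1; rewrite /= lexx ler01 => /(_ isT); rewrite wE1 => ->.
  by rewrite mulrCA.
have c0 : e / 2 != 0 by rewrite mulf_neq0 ?lt0r_neq0// invr_gt0.
have ce : `|e / 2| < e.
  by rewrite gtr0_norm ?divr_gt0// ltr_pdivrMr// ltr_pMr// ltr1n.
have h1 := quarter _ c0 ce.
have := quarter (i * (e / 2)); rewrite mulf_neq0// normrM (_ : `|i| = 1) ?mul1r; last first.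
  by rewrite normc_def /= expr0n expr1n add0r sqrtr1.
move=> /(_ isT ce); rewrite h1 !mulrA i2 !mulN1r -mulNr opprK.
rewrite !mulNr [LHS]mulrC => /eqP.
rewrite -addr_eq0 -mulr2n mulrn_eq0 /= mulf_eq0 => /orP[]/eqP h.
  have := sw (e / 2); rewrite /= h expr0n /= => /(_ (conj c0 ce)) /eqP.
  by rewrite eq_sym (negbTE c0).
have := sw (- (e / 2)); rewrite /= h expr0n /= normrN oppr_eq0 => /(_ (conj c0 ce)) /eqP.
by rewrite eq_sym oppr_eq0 (negbTE c0).
Qed.

Section StarShaped.
Variables (S : set (C * C)) (b : C * C).
Let c (p : (C * C) * R) : C * C :=
  (b.1 + (p.2%:C%C : C) * (p.1.1 - b.1), b.2 + (p.2%:C%C : C) * (p.1.2 - b.2)).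
Hypothesis Sb : forall x t, S x -> 0 <= t <= 1 -> S (c (x, t)).

Let c_continuous : cont_on (S `*` I01) c.
Proof.
have co g : continuous g -> cont_on (S `*` I01) (fun p : (C * C) * R => g p.1 : C).
  move=> cg; apply: (cont_on_comp (B := setT)) => //; first exact: cont_on_fst.
  exact/cont_on_setT.
have ct : cont_on (S `*` I01) (fun p : (C * C) * R => p.2%:C%C : C).
  by apply: cont_on_real; exact: cont_on_snd.
apply: cont_on_pair; (apply: (@cont_onD C); first exact: cont_on_cst).
  apply: (@cont_onM C) => [|]; first exact: ct.
  apply: (@cont_onD C); last exact: cont_on_cst.
  by apply: co => x; exact: cvg_fst.
apply: (@cont_onM C) => [|]; first exact: ct.
apply: (@cont_onD C); last exact: cont_on_cst.
by apply: co => x; exact: cvg_snd.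
Qed.

Let c0 x : c (x, 0) = b.
Proof. by rewrite /c /= !mul0r !addr0; case: b. Qed.

Let c1 x : c (x, 1) = x.
Proof. by rewrite /c /= !mul1r; case: x => ? ? /=; rewrite ![_ + (_ - _)]addrC !subrK. Qed.

Lemma star_shaped_connected : connected S.
Proof. exact: (connected_contractible (c := c) (b := b)). Qed.

Lemma star_shaped_has_sqrt (k : C * C -> C) : cont_on S k ->
  (forall x, S x -> k x != 0) -> has_sqrt S k.
Proof. exact: (has_sqrt_contractible (c := c) (b := b)). Qed.

End StarShaped.

(* The bidisc is fibred by punctured discs; each half of the slit cover of the
   fibres is star-shaped. *)
Section Dichotomy.
Variables (u0 : C) (d e : R).
Hypotheses (d0 : 0 < d) (e0 : 0 < e).

Definition punctured_bidisc : set (C * C) :=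
  [set x | [/\ `|x.1 - u0| < d%:C%C, x.2 != 0 & `|x.2| < e%:C%C]].
Local Notation B := punctured_bidisc.

Let sector (P : C -> Prop) : set (C * C) := B `&` [set x | P x.2].
(** The plane without the half line of nonpositive reals; [slitl] omits the nonnegative ones.
    Together they cover the nonzero numbers, and they overlap exactly in the two half planes [up]
    and [down]. *)
Let slitr (w : C) := Im w != 0 \/ 0 < Re w.
Let slitl (w : C) := Im w != 0 \/ Re w < 0.
Let up (w : C) := 0 < Im w.
Let down (w : C) := Im w < 0.

Let lin_im (a w : C) (t : R) : Im (a + (t%:C%C : C) * (w - a)) = (1 - t) * Im a + t * Im w.
Proof. by case: a w => [? ?] [? ?]; simpc => /=; ring. Qed.

Let lin_re (a w : C) (t : R) : Re (a + (t%:C%C : C) * (w - a)) = (1 - t) * Re a + t * Re w.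
Proof. by case: a w => [? ?] [? ?]; simpc => /=; ring. Qed.

Let sector_star (P : C -> Prop) (a : C) : `|a| < (e%:C%C : C) ->
  (forall w, P w -> w != 0) ->
  (forall w t, P w -> 0 <= t <= 1 -> P (a + (t%:C%C : C) * (w - a))) ->
  forall x t, sector P x -> 0 <= t <= 1 ->
  sector P (u0 + (t%:C%C : C) * (x.1 - u0), a + (t%:C%C : C) * (x.2 - a)).
Proof.
move=> ae P0 Pst [u w] t [[/= ud w0 we] Pw] t01; have Pc := Pst _ _ Pw t01.
have /andP[t0 t1] := t01.
have nt : `|t%:C%C : C| = (t%:C%C : C) by rewrite ger0_norm// lecR.
split => //; split => /=.
- rewrite [u0 + _]addrC addrK normrM nt; apply: le_lt_trans ud.
  by rewrite ler_piMl// lecR.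
- exact: P0.
- have -> : a + (t%:C%C : C) * (w - a) = ((1 - t)%:C%C : C) * a + (t%:C%C : C) * w.
    by rewrite rmorphB /=; ring.
  apply: le_lt_trans (ler_normD _ _) _; rewrite !normrM nt.
  have -> : `|((1 - t)%:C%C : C)| = ((1 - t)%:C%C : C).
    by rewrite ger0_norm// lecR subr_ge0.
  have [->|tn0] := eqVneq t 0; first by rewrite subr0 mul0r addr0 mul1r.
  have -> : (e%:C%C : C) = ((1 - t)%:C%C : C) * e%:C%C + (t%:C%C : C) * e%:C%C.
    by rewrite rmorphB /=; ring.
  apply: ler_ltD; first by apply: ler_wpM2l; [rewrite lecR subr_ge0|exact: ltW].
  by rewrite ltr_pM2l// ltcR lt_def tn0.
Qed.

Let half : 0 < e / 2. Proof. by rewrite divr_gt0. Qed.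

Let half_re (z : R) : `|z| = e / 2 -> `|(z%:C%C : C)| < (e%:C%C : C).
Proof.
move=> ze; rewrite normc_def /= expr0n addr0 sqrtr_sqr ze ltcR.
by rewrite ltr_pdivrMr// ltr_pMr// ltr1n.
Qed.

Let half_im (z : R) : `|z| = e / 2 -> `|(0 +i* z)%C : C| < (e%:C%C : C).
Proof.
move=> ze; rewrite normc_def /= expr0n add0r sqrtr_sqr ze ltcR.
by rewrite ltr_pdivrMr// ltr_pMr// ltr1n.
Qed.

Let right0 w : slitr w -> w != 0.
Proof. by case=> h; apply: contraTneq h => ->; rewrite /= ?eqxx ?ltxx. Qed.

Let left0 w : slitl w -> w != 0.
Proof. by case=> h; apply: contraTneq h => ->; rewrite /= ?eqxx ?ltxx. Qed.

Let right_star w t : slitr w -> 0 <= t <= 1 ->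
  slitr (((e / 2)%:C%C : C) + (t%:C%C : C) * (w - ((e / 2)%:C%C : C))).
Proof.
move=> rw /andP[t0 t1]; rewrite /slitr lin_im lin_re /= mulr0 add0r.
have [->|tn0] := eqVneq t 0; first by right; rewrite subr0 mul1r mul0r addr0.
have tp : 0 < t by rewrite lt_def tn0.
by case: rw => h; [left; rewrite mulf_neq0|right; move: half; nra].
Qed.

Let left_star w t : slitl w -> 0 <= t <= 1 ->
  slitl (((- (e / 2))%:C%C : C) + (t%:C%C : C) * (w - ((- (e / 2))%:C%C : C))).
Proof.
move=> rw /andP[t0 t1]; rewrite /slitl lin_im lin_re /= mulr0 add0r.
have [->|tn0] := eqVneq t 0.
  by right; rewrite subr0 mul1r mul0r addr0 oppr_lt0.
have tp : 0 < t by rewrite lt_def tn0.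
by case: rw => h; [left; rewrite mulf_neq0|right; move: half; nra].
Qed.

Let up_star w t : up w -> 0 <= t <= 1 ->
  up ((0 +i* (e / 2))%C + (t%:C%C : C) * (w - (0 +i* (e / 2))%C)).
Proof. by move=> h /andP[t0 t1]; move: h; rewrite /up lin_im /=; move: half; nra. Qed.

Let down_star w t : down w -> 0 <= t <= 1 ->
  down ((0 +i* (- (e / 2)))%C + (t%:C%C : C) * (w - (0 +i* (- (e / 2)))%C)).
Proof. by move=> h /andP[t0 t1]; move: h; rewrite /down lin_im /=; move: half; nra. Qed.

Let up0 w : up w -> w != 0.
Proof. by rewrite /up => h; apply: contraTneq h => ->; rewrite /= ltxx. Qed.

Let down0 w : down w -> w != 0.
Proof. by rewrite /down => h; apply: contraTneq h => ->; rewrite /= ltxx. Qed.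

Let sector_up_right : sector up `<=` sector slitr.
Proof. by move=> x [Bx h]; split => //; left; rewrite gt_eqF. Qed.

Let sector_up_left : sector up `<=` sector slitl.
Proof. by move=> x [Bx h]; split => //; left; rewrite gt_eqF. Qed.

Let sector_down_right : sector down `<=` sector slitr.
Proof. by move=> x [Bx h]; split => //; left; rewrite lt_eqF. Qed.

Let sector_down_left : sector down `<=` sector slitl.
Proof. by move=> x [Bx h]; split => //; left; rewrite lt_eqF. Qed.

(* [p] (resp. [q]) compares the two branches on the upper (resp. lower) half. *)
Let branches (k : C * C -> C) (s t : C * C -> C) (p q : C) :=
  [/\ cont_on (sector slitr) s /\ (forall x, sector slitr x -> s x ^+ 2 = k x),
      cont_on (sector slitl) t /\ (forall x, sector slitl x -> t x ^+ 2 = k x),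
      p ^+ 2 = 1 /\ (forall x, sector up x -> s x = p * t x) &
      q ^+ 2 = 1 /\ (forall x, sector down x -> s x = q * t x)].

Let branches_exist k : cont_on B k -> (forall x, B x -> k x != 0) ->
  exists s t p q, branches k s t p q.
Proof.
move=> ck k0.
have he : `|e / 2| = e / 2 by rewrite ger0_norm// ltW.
have hNe : `|- (e / 2)| = e / 2 by rewrite normrN.
have ckP P : cont_on (sector P) k by apply: cont_on_sub ck => x [].
have kP P x : sector P x -> k x != 0 by move=> [Bx _]; exact: k0.
have [s cs sk] := star_shaped_has_sqrt (b := (u0, ((e / 2)%:C%C : C)))
  (sector_star (half_re he) right0 right_star) (ckP slitr) (@kP slitr).
have [t ct tk] := star_shaped_has_sqrt (b := (u0, ((- (e / 2))%:C%C : C)))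
  (sector_star (half_re hNe) left0 left_star) (ckP slitl) (@kP slitl).
have t0 x : sector slitl x -> t x != 0.
  by move=> lx; rewrite -sqrf_eq0 tk// k0//; case: lx.
have [p p2 st_up] := sqrt_sign
  (star_shaped_connected (b := (u0, ((0 +i* (e / 2))%C : C)))
    (sector_star (half_im he) up0 up_star))
  (cont_on_sub sector_up_right cs) (cont_on_sub sector_up_left ct)
  (fun x ux => etrans (sk _ (sector_up_right ux)) (esym (tk _ (sector_up_left ux))))
  (fun x ux => t0 x (sector_up_left ux)).
have [q q2 st_down] := sqrt_sign
    (star_shaped_connected (b := (u0, ((0 +i* (- (e / 2)))%C : C)))
      (sector_star (half_im hNe) down0 down_star))
    (cont_on_sub sector_down_right cs) (cont_on_sub sector_down_left ct)
    (fun x ux => etrans (sk _ (sector_down_right ux)) (esym (tk _ (sector_down_left ux))))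
    (fun x ux => t0 x (sector_down_left ux)).
by exists s, t, p, q; split.
Qed.

Let right_open (x : C * C) : slitr x.2 -> nbhs x [set y : C * C | slitr y.2].
Proof.
have cI : cont_on setT (fun y : C * C => Im y.2) by apply: cont_on_Im; exact: cont_on_snd.
have cR : cont_on setT (fun y : C * C => Re y.2) by apply: cont_on_Re; exact: cont_on_snd.
case=> h.
  have := (cont_onP _ _).1 cI x I _ (open_nbhs_nbhs (conj (@open_neq R 0) h)).
  by apply: filterS => y /(_ I) yh; left.
have := (cont_onP _ _).1 cR x I _ (lt_nbhsr h).
by apply: filterS => y /(_ I) yh; right.
Qed.

Let left_open (x : C * C) : slitl x.2 -> nbhs x [set y : C * C | slitl y.2].
Proof.
have cI : cont_on setT (fun y : C * C => Im y.2) by apply: cont_on_Im; exact: cont_on_snd.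
have cR : cont_on setT (fun y : C * C => Re y.2) by apply: cont_on_Re; exact: cont_on_snd.
case=> h.
  have := (cont_onP _ _).1 cI x I _ (open_nbhs_nbhs (conj (@open_neq R 0) h)).
  by apply: filterS => y /(_ I) yh; left.
have := (cont_onP _ _).1 cR x I _ (lt_nbhsl h).
by apply: filterS => y /(_ I) yh; right.
Qed.

(** With the same sign on both components of the overlap, [p * t] continues [s] all the way around:
    a disagreement of the two signs is the only obstruction to a root. *)
Let branches_glue k s t p : branches k s t p p -> has_sqrt B k.
Proof.
move=> [[cs sk] [ct tk] [p2 su] [_ sd]].
pose r x := if pselect (slitr x.2) is left _ then s x else p * t x.
have rr x : sector slitr x -> r x = s x.
  by move=> [_ h]; rewrite /r; case: pselect.
have rl x : sector slitl x -> r x = p * t x.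
  move=> [Bx h]; rewrite /r; case: pselect => // h'.
  have [i0|i0] := eqVneq (Im x.2) 0.
    by case: h h' => [|h1 [|h2]]; rewrite ?i0 ?eqxx//; move: (lt_trans h1 h2); rewrite ltxx.
  by move: i0; rewrite neq_lt => /orP[h1|h1]; [exact: sd|exact: su].
have RL x : B x -> slitr x.2 \/ slitl x.2.
  case=> _ w0 _; have [i0|i0] := eqVneq (Im x.2) 0; last by left; left.
  have : Re x.2 != 0 by move: w0; rewrite eq_complex /= i0 eqxx andbT.
  by rewrite neq_lt => /orP[h|h]; [right; right|left; right].
exists r.
  apply: cont_on_local => x Bx; have [h|h] := RL _ Bx.
    exists [set y | slitr y.2]; first exact: right_open.
    by apply: (cont_on_eq (f := s)) cs => y hy; rewrite rr.
  exists [set y | slitl y.2]; first exact: left_open.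
  apply: (cont_on_eq (f := fun x => p * t x)); first by move=> y hy; rewrite rl.
  by apply: (cont_onM _ ct); exact: cont_on_cst.
move=> x Bx; have [h|h] := RL _ Bx; first by rewrite rr// sk.
by rewrite rl// exprMn p2 mul1r tk.
Qed.

Let opp_sign (p q : C) : p ^+ 2 = 1 -> q ^+ 2 = 1 -> p = q \/ p = - q.
Proof. by move=> p1 q1; have /eqP := etrans p1 (esym q1); rewrite eqf_sqr => /orP[]/eqP; auto. Qed.

(** The punctured bidisc is homotopy equivalent to a circle, so it has one nonzero class modulo 2,
    that of the coordinate [x.2]. If [k] has opposite signs on the two half planes, so has [x.2],
    and the signs of the product agree. *)
Lemma punctured_bidisc_dichotomy (k : C * C -> C) : cont_on B k ->
  (forall x, B x -> k x != 0) ->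
  has_sqrt B k \/ has_sqrt B (fun x => k x * x.2).
Proof.
move=> ck k0.
have [s [t [p [q br]]]] := branches_exist ck k0.
have [[cs sk] [ct tk] [p2 su] [q2 sd]] := br.
have [pq|pq] := opp_sign p2 q2.
  by left; apply: branches_glue; rewrite pq in br; exact: br.
have c2 : cont_on B (fun x => x.2) by exact: cont_on_snd.
have [s' [t' [p' [q' br']]]] := branches_exist c2 (fun x (Bx : B x) => let: And3 _ h _ := Bx in h).
have [[cs' sk'] [ct' tk'] [p2' su'] [q2' sd']] := br'.
have [pq'|pq'] := opp_sign p2' q2'.
  (* Equal signs would give a root of [x.2] and, by restriction to the fibre over [u0], a root of
     the coordinate on a punctured disc. *)
  exfalso; rewrite pq' in br'; have h := branches_glue br'.
  have e0' : 0 < (e%:C%C : C) by rewrite ltcR.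
  apply: (disc_no_sqrt e0').
  have := has_sqrt_comp (f := fun w : C => (u0, w)) _ _ h; apply.
    by move=> w [w0 we]; split => //=; rewrite subrr normr0 ltcR.
  by apply: cont_on_pair; [exact: cont_on_cst|exact: cont_on_id].
right; apply: (@branches_glue _ (fun x => s x * s' x) (fun x => t x * t' x) (p * p')).
split; split.
- exact: cont_onM.
- by move=> x h; rewrite exprMn sk// sk'.
- exact: cont_onM.
- by move=> x h; rewrite exprMn tk// tk'.
- by rewrite exprMn p2 p2' mulr1.
- by move=> x h; rewrite su// su'// mulrACA.
- by rewrite exprMn p2 p2' mulr1.
- by move=> x h; rewrite sd// sd'// pq pq' mulrNN mulrACA.
Qed.

End Dichotomy.

End Sqrt.

(** * Gluing square roots; closed covers of the plane *)

Lemma closed_preimage (T U : topologicalType) (f : T -> U) (F : set U) :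
  continuous f -> closed F -> closed (f @^-1` F).
Proof. by move=> cf cF; apply: preimage_closed => // x _; exact: cf. Qed.

Lemma cont_on_closedU (T U : topologicalType) (A F1 F2 : set T) (f : T -> U) :
  closed F1 -> closed F2 -> A `<=` F1 `|` F2 ->
  cont_on (A `&` F1) f -> cont_on (A `&` F2) f -> cont_on A f.
Proof.
move=> cF1 cF2 AF cf1 cf2; apply/cont_onP => x Ax V fV.
have near_part F : closed F -> cont_on (A `&` F) f ->
    \forall y \near x, A y -> F y -> V (f y).
  move=> cF /cont_onP cf; have [Fx|nFx] := pselect (F x).
    by have := cf x (conj Ax Fx) V fV; apply: filterS => y h Ay Fy; exact: h.
  have : nbhs x (~` F) by apply: open_nbhs_nbhs; split => //; exact: closed_openC.
  by apply: filterS => y nFy _ /nFy.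
have := near_part _ cF2 cf2; have := near_part _ cF1 cf1.
by apply: filterS2 => y h1 h2 Ay; case: (AF y Ay) => ?; [exact: h1|exact: h2].
Qed.

Section Square.
Variable R : realType.
Local Notation C := (Cplx R).
Local Notation I01 := [set t : R | 0 <= t <= 1].

(** The overlap being connected, the two roots differ there by one constant sign, which is absorbed
    into the second root. *)
Lemma has_sqrt_glue (T : topologicalType) (A F1 F2 : set T) (k : T -> C) :
  closed F1 -> closed F2 -> A `<=` F1 `|` F2 -> connected (A `&` F1 `&` F2) ->
  (forall x, (A `&` F1 `&` F2) x -> k x != 0) ->
  has_sqrt (A `&` F1) k -> has_sqrt (A `&` F2) k -> has_sqrt A k.
Proof.
move=> cF1 cF2 AF conn k0 [s cs sk] [t ct tk].
have s12 : A `&` F1 `&` F2 `<=` A `&` F1 by move=> x [].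
have t12 : A `&` F1 `&` F2 `<=` A `&` F2 by move=> x [[]].
have [e e2 st] := sqrt_sign conn (cont_on_sub s12 cs) (cont_on_sub t12 ct)
  (fun x h => etrans (sk _ (s12 _ h)) (esym (tk _ (t12 _ h))))
  (fun x h => ltac:(by rewrite -sqrf_eq0 (tk _ (t12 _ h)) k0)).
pose r x := if pselect (F1 x) then s x else e * t x.
have r1 x : (A `&` F1) x -> r x = s x by move=> [_ h]; rewrite /r; case: pselect.
have r2 x : (A `&` F2) x -> r x = e * t x.
  by move=> [Ax h]; rewrite /r; case: pselect => // h1; exact: st.
exists r.
  apply: (cont_on_closedU cF1 cF2 AF).
    by apply: (cont_on_eq _ cs) => x /r1.
  apply: (@cont_on_eq _ _ _ (fun x => e * t x)); first by move=> x /r2.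
  by apply: (cont_onM _ ct); exact: cont_on_cst.
move=> x Ax; case: (AF x Ax) => h; first by rewrite r1// sk.
by rewrite r2// exprMn e2 mul1r tk.
Qed.

Lemma avoid_seq (s : seq R) (a b : R) : a < b ->
  exists2 m, a < m < b & m \notin s.
Proof.
elim: s a b => [|x s IHs] a b ab.
  by exists ((a + b) / 2) => //; apply/andP; split; lra.
have [m /andP[am mb] ms] := IHs _ _ ab.
have [mx|mx] := eqVneq m x; last by exists m; rewrite ?am ?mb// inE negb_or mx.
have [m' /andP[am' mb'] ms'] := IHs _ _ mb.
exists m'; first by rewrite (lt_trans am am') mb'.
by rewrite inE negb_or ms' andbT -mx gt_eqF.
Qed.

Lemma avoid_finite (F : set R) (a b : R) : finite_set F -> a < b ->
  exists2 m, a < m < b & ~ F m.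
Proof.
move=> /finite_seqP[s ->] /(avoid_seq s)[m mab ms]; exists m => //.
by move=> /= h; rewrite h in ms.
Qed.

Definition rect (r : (R * R) * (R * R)) : set (R * R) :=
  [set p | r.1.1 <= p.1 <= r.1.2 /\ r.2.1 <= p.2 <= r.2.2].

Let width (i : R * R) := i.2 - i.1.

Lemma segment_x_connected (m a b : R) : connected [set p : R * R | p.1 = m /\ a <= p.2 <= b].
Proof.
have -> : [set p : R * R | p.1 = m /\ a <= p.2 <= b] = (fun t => (m, t)) @` [set t | a <= t <= b].
  apply/seteqP; split; first by move=> [x y] /= [-> yab]; exists y.
  by move=> _ [y yab <-].
apply: cont_on_image; first by apply: cont_on_pair; [exact: cont_on_cst|exact: cont_on_id].
apply/connected_intervalP => x y /= /andP[x0 _] /andP[_ y1] z /andP[xz zy].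
by rewrite (le_trans x0 xz) (le_trans zy y1).
Qed.

Lemma segment_y_connected (m a b : R) : connected [set p : R * R | p.2 = m /\ a <= p.1 <= b].
Proof.
have -> : [set p : R * R | p.2 = m /\ a <= p.1 <= b] = (fun t => (t, m)) @` [set t | a <= t <= b].
  apply/seteqP; split; first by move=> [x y] /= [-> yab]; exists x.
  by move=> _ [y yab <-].
apply: cont_on_image; first by apply: cont_on_pair; [exact: cont_on_id|exact: cont_on_cst].
apply/connected_intervalP => x y /= /andP[x0 _] /andP[_ y1] z /andP[xz zy].
by rewrite (le_trans x0 xz) (le_trans zy y1).
Qed.

Lemma closed_fst_le m : closed [set p : R * R | p.1 <= m].
Proof. by apply: (@closed_preimage (R * R)%type R fst [set x | x <= m]); [move=> x; exact: cvg_fst|exact: closed_le]. Qed.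

Lemma closed_fst_ge m : closed [set p : R * R | m <= p.1].
Proof. by apply: (@closed_preimage (R * R)%type R fst [set x | m <= x]); [move=> x; exact: cvg_fst|exact: closed_ge]. Qed.

Lemma closed_snd_le m : closed [set p : R * R | p.2 <= m].
Proof. by apply: (@closed_preimage (R * R)%type R snd [set x | x <= m]); [move=> x; exact: cvg_snd|exact: closed_le]. Qed.

Lemma closed_snd_ge m : closed [set p : R * R | m <= p.2].
Proof. by apply: (@closed_preimage (R * R)%type R snd [set x | m <= x]); [move=> x; exact: cvg_snd|exact: closed_ge]. Qed.

Section Rectangle.
Variables (r0 : (R * R) * (R * R)) (P : set (R * R)) (k : R * R -> C).
Hypothesis finP : finite_set P.
Hypothesis local_sqrt : forall p, rect r0 p ->
  exists2 U, nbhs p U & has_sqrt (rect r0 `&` ~` P `&` U) k.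
Hypothesis k0 : forall p, rect r0 p -> ~ P p -> k p != 0.

(* The dividing line avoids [P], so that the two roots can be compared on it. *)
Let split_x r : rect r `<=` rect r0 -> r.1.1 < r.1.2 -> ~ has_sqrt (rect r `&` ~` P) k ->
  exists i : R * R, [/\ r.1.1 <= i.1, i.2 <= r.1.2, i.1 < i.2,
    width i <= (2 / 3) * width r.1 & ~ has_sqrt (rect (i, r.2) `&` ~` P) k].
Proof.
case: r => [[a b] [c d]] /= rr0 ab bad; rewrite /width /=.
(* A cut in the middle third leaves room to dodge the finitely many punctures, while both pieces
   have at most two thirds of the width. *)
have [m /andP[am mb] mP] : exists2 m, a + (b - a) / 3 < m < b - (b - a) / 3 & ~ (fst @` P) m.
  by apply: avoid_finite; [exact: finite_image|lra].
have [h1|] := pselect (has_sqrt (rect ((a, m), (c, d)) `&` ~` P) k); last first.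
  by exists (a, m) => /=; split => //; lra.
have [h2|] := pselect (has_sqrt (rect ((m, b), (c, d)) `&` ~` P) k); last first.
  by exists (m, b) => /=; split => //; lra.
exfalso; apply: bad.
apply: (has_sqrt_glue (closed_fst_le (m := m)) (closed_fst_ge (m := m))).
- by move=> p _; case/orP: (le_total p.1 m); [left|right].
- suff -> : rect (a, b, (c, d)) `&` ~` P `&` [set p | p.1 <= m] `&` [set p | m <= p.1] =
      [set p | p.1 = m /\ c <= p.2 <= d] by exact: segment_x_connected.
  apply/seteqP; split => [[x y] /= [[[/= [_ ?] _] h h']]|[x y] /= [-> yy]].
    by split => //; apply/eqP; rewrite eq_le h h'.
  do !split => //=; first by apply/andP; split; lra.
  by move=> h; apply: mP; exists (m, y).
- by move=> p [[[rp nP] _] _]; apply: k0 => //; exact: rr0.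
- apply: has_sqrt_sub h1 => -[x y] /= [[[/= /andP[? ?] ?] ?] ?]; split => //; split => //=.
  by apply/andP.
- apply: has_sqrt_sub h2 => -[x y] /= [[[/= /andP[? ?] ?] ?] ?]; split => //; split => //=.
  by apply/andP.
Qed.

Let split_y r : rect r `<=` rect r0 -> r.2.1 < r.2.2 -> ~ has_sqrt (rect r `&` ~` P) k ->
  exists i : R * R, [/\ r.2.1 <= i.1, i.2 <= r.2.2, i.1 < i.2,
    width i <= (2 / 3) * width r.2 & ~ has_sqrt (rect (r.1, i) `&` ~` P) k].
Proof.
case: r => [[a b] [c d]] /= rr0 cd bad; rewrite /width /=.
have [m /andP[am mb] mP] : exists2 m, c + (d - c) / 3 < m < d - (d - c) / 3 & ~ (snd @` P) m.
  by apply: avoid_finite; [exact: finite_image|lra].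
have [h1|] := pselect (has_sqrt (rect ((a, b), (c, m)) `&` ~` P) k); last first.
  by exists (c, m) => /=; split => //; lra.
have [h2|] := pselect (has_sqrt (rect ((a, b), (m, d)) `&` ~` P) k); last first.
  by exists (m, d) => /=; split => //; lra.
exfalso; apply: bad.
apply: (has_sqrt_glue (closed_snd_le (m := m)) (closed_snd_ge (m := m))).
- by move=> p _; case/orP: (le_total p.2 m); [left|right].
- suff -> : rect (a, b, (c, d)) `&` ~` P `&` [set p | p.2 <= m] `&` [set p | m <= p.2] =
      [set p | p.2 = m /\ a <= p.1 <= b] by exact: segment_y_connected.
  apply/seteqP; split => [[x y] /= [[[/= [? _] _] h h']]|[x y] /= [-> yy]].
    by split => //; apply/eqP; rewrite eq_le h h'.
  do !split => //=; first by apply/andP; split; lra.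
  by move=> h; apply: mP; exists (x, m).
- by move=> p [[[rp nP] _] _]; apply: k0 => //; exact: rr0.
- apply: has_sqrt_sub h1 => -[x y] /= [[[/= ? /andP[? ?]] ?] ?]; split => //; split => //=.
  by apply/andP.
- apply: has_sqrt_sub h2 => -[x y] /= [[[/= ? /andP[? ?]] ?] ?]; split => //; split => //=.
  by apply/andP.
Qed.

Let bad r := [/\ rect r `<=` rect r0, r.1.1 < r.1.2, r.2.1 < r.2.2 &
  ~ has_sqrt (rect r `&` ~` P) k].

Let smaller r r' := [/\ r.1.1 <= r'.1.1, r'.1.2 <= r.1.2, r.2.1 <= r'.2.1,
  r'.2.2 <= r.2.2 & width r'.1 <= (2 / 3) * width r.1 /\ width r'.2 <= (2 / 3) * width r.2].

Let step r : bad r -> exists2 r', bad r' & smaller r r'.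
Proof.
move=> [rr0 x01 y01 nr].
have [i [i1 i2 i12 iw ni]] := split_x rr0 x01 nr.
have ri : rect (i, r.2) `<=` rect r.
  move=> p [/= /andP[p1 p2] ?]; split => //.
  by rewrite (le_trans i1 p1) (le_trans p2 i2).
have [j [j1 j2 j12 jw nj]] := split_y (r := (i, r.2)) (subset_trans ri rr0) y01 ni.
exists (i, j) => /=; split => //=.
move=> p [/= ? /andP[p1 p2]]; apply/rr0/ri; split => //=.
by rewrite (le_trans j1 p1) (le_trans p2 j2).
Qed.

(** Subdivision in the manner of Goursat: a rectangle without a root contains a smaller one without
    a root, and these shrink to a point, near which [local_sqrt] provides one. That point may be a
    puncture, so the local roots must exist around punctures as well. *)
Lemma has_sqrt_rect : r0.1.1 < r0.1.2 -> r0.2.1 < r0.2.2 -> has_sqrt (rect r0 `&` ~` P) k.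
Proof.
move=> x01 y01; apply: contrapT => nr0.
have bad0 : bad r0 by split.
have [f [f0 fS]] := @dependent_choice {r | bad r} (fun r r' => smaller (sval r) (sval r'))
  (fun r => ltac:(by apply: cid; have [r' br' sr'] := step (svalP r); exists (exist _ r' br'))) (exist _ r0 bad0).
pose g n := sval (f n).
have gb n : bad (g n) by exact: svalP.
have mono n m : (n <= m)%N -> [/\ (g n).1.1 <= (g m).1.1, (g m).1.2 <= (g n).1.2,
    (g n).2.1 <= (g m).2.1 & (g m).2.2 <= (g n).2.2].
  move=> /subnKC <-; elim: (m - n)%N => [|d [h1 h2 h3 h4]]; first by rewrite addn0.
  rewrite addnS; have [s1 s2 s3 s4 _] := fS (n + d)%N.
  by split; [exact: le_trans s1|exact: le_trans h2|exact: le_trans s3|exact: le_trans h4].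
have wid n : width (g n).1 <= (2 / 3) ^+ n * width r0.1 /\
    width (g n).2 <= (2 / 3) ^+ n * width r0.2.
  elim: n => [|n [h1 h2]]; first by rewrite !mul1r /g f0.
  have [_ _ _ _ [s1 s2]] := fS n; rewrite exprS -!(mulrA (2 / 3)).
  have p23 : 0 <= 2 / 3 :> R by lra.
  by split; [apply: le_trans s1 _|apply: le_trans s2 _]; exact: ler_wpM2l.
(* The supremum of the lower ends lies in all the nested intervals. *)
have inter (lo hi : nat -> R) : (forall n m, lo n <= hi m) ->
    exists c, forall n, lo n <= c <= hi n.
  move=> lh; exists (sup (range lo)) => n; apply/andP; split.
    apply: ub_le_sup; last by exists n.
    by exists (hi 0%N) => _ [m _ <-].
  by apply: ge_sup; [exists (lo 0%N), 0%N|move=> _ [m _ <-]].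
have [x xg] : exists x, forall n, (g n).1.1 <= x <= (g n).1.2.
  apply: inter => n m; have [_ h _ _] := gb (maxn n m).
  have [h1 _ _ _] := mono n _ (leq_maxl n m); have [_ h2 _ _] := mono m _ (leq_maxr n m).
  exact: le_trans h1 (le_trans (ltW h) h2).
have [y yg] : exists y, forall n, (g n).2.1 <= y <= (g n).2.2.
  apply: inter => n m; have [_ _ h _] := gb (maxn n m).
  have [_ _ h1 _] := mono n _ (leq_maxl n m); have [_ _ _ h2] := mono m _ (leq_maxr n m).
  exact: le_trans h1 (le_trans (ltW h) h2).
have r0xy : rect r0 (x, y) by have := xg 0%N; have := yg 0%N; rewrite /g f0.
have [U xyU hU] := local_sqrt r0xy.
have /nbhs_ballP[e /= e0 eU] := xyU.
have [n [n1 n2]] : exists n, (2 / 3) ^+ n * width r0.1 < e /\ (2 / 3) ^+ n * width r0.2 < e.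
  have w0 : 0 < width r0.1 + width r0.2 by rewrite /width; lra.
  have c23 : `|2 / 3 : R| < 1 by rewrite ger0_norm; lra.
  have /cvgrPdist_lt/(_ (e / (width r0.1 + width r0.2))) := @cvg_expr R _ c23.
  rewrite divr_gt0// => /(_ isT)[N _ /(_ N (leqnn N))] /=.
  have p23 : 0 <= (2 / 3 : R) ^+ N by rewrite exprn_ge0//; lra.
  rewrite sub0r normrN ger0_norm// ltr_pdivlMr// mulrDr => h; exists N.
  have : 0 <= (2 / 3) ^+ N * width r0.1 by rewrite mulr_ge0// /width; lra.
  have : 0 <= (2 / 3) ^+ N * width r0.2 by rewrite mulr_ge0// /width; lra.
  by move=> *; split; lra.
have [gr0 _ _ ng] := gb n; apply: ng; apply: has_sqrt_sub hU => p [gp nP].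
split; first by split => //; exact: gr0.
apply: eU; have [w1 w2] := wid n; have /andP[x1 x2] := xg n; have /andP[y1 y2] := yg n.
move: gp => [/andP[p1 p2] /andP[p3 p4]]; rewrite /width in w1 w2 n1 n2.
split; rewrite /= -ball_normE /= ltr_norml; apply/andP; split; lra.
Qed.

End Rectangle.

(** Finitely many disjoint closed sets covering the line are also open, so connectedness leaves only
    one of them. *)
Lemma line_closed_cover (I : finType) (F : I -> set R) :
  (forall i, closed (F i)) -> (forall x, exists i, F i x) ->
  (forall i j x, F i x -> F j x -> i = j) -> exists i, forall x, F i x.
Proof.
move=> cF cov disj; have [i Fi0] := cov 0; exists i => x.
suff -> : F i = setT by [].
have cR : connected [set: R] by apply/connected_intervalP.
apply: cR; first by exists 0.
  exists (~` (\big[setU/set0]_(j <- enum I | j != i) F j)).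
    by apply: closed_openC; rewrite -big_filter; apply: closed_bigsetU.
  rewrite setTI; apply/seteqP; split => y.
    move=> Fiy; rewrite -bigcup_seq_cond => -[j /= /andP[_ ji] Fjy].
    by move: ji; rewrite (disj _ _ _ Fjy Fiy) eqxx.
  rewrite -bigcup_seq_cond => nF; have [j Fjy] := cov y.
  have [<-//|ji] := eqVneq j i; exfalso; apply: nF; exists j => //=.
  by rewrite mem_enum ji.
by exists (F i) => //; rewrite setTI.
Qed.

(** Off the finite set [E] of overlaps the sets are disjoint, so each horizontal or vertical line
    missing [E] lies in a single one of them. A horizontal line of this kind meets all the vertical
    ones and forces the same index on them; the vertical lines through [E] are limits of the
    others. *)
Lemma plane_closed_cover (I : finType) (F : I -> set C) :
  (forall i, closed (F i)) -> (forall z, exists i, F i z) ->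
  (forall i j, i != j -> finite_set (F i `&` F j)) -> exists i, forall z, F i z.
Proof.
move=> cF cov fin.
pose E := \bigcup_(p in [set p : I * I | p.1 != p.2]) (F p.1 `&` F p.2).
have finE : finite_set E by apply: bigcup_finite => // p; exact: fin.
pose re : set R := (@complex.Re R) @` E; pose im : set R := (@complex.Im R) @` E.
have finre : finite_set re by exact: finite_image.
have finim : finite_set im by exact: finite_image.
have one i j z : F i z -> F j z -> ~ E z -> i = j.
  move=> Fi Fj nE; apply: contrapT => /eqP ij; apply: nE; by exists (i, j).
have line (c : R -> C) : cont_on setT c -> (forall t, ~ E (c t)) ->
    exists i, forall t, F i (c t).
  move=> /cont_on_setT cc nE; apply: (@line_closed_cover I (fun i => c @^-1` F i)).
  - by move=> i; exact: closed_preimage.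
  - by move=> t; exact: cov.
  - by move=> i j t Fi Fj; exact: (one i j (c t)).
have ver x : ~ re x -> exists i, forall y, F i (x +i* y)%C.
  move=> nx; apply: (line (fun y => (x +i* y)%C)).
    by apply: cont_on_complex; [exact: cont_on_cst|exact: cont_on_id].
  by move=> t Et; apply: nx; exists (x +i* t)%C.
have hor y : ~ im y -> exists i, forall x, F i (x +i* y)%C.
  move=> ny; apply: (line (fun x => (x +i* y)%C)).
    by apply: cont_on_complex; [exact: cont_on_id|exact: cont_on_cst].
  by move=> t Et; apply: ny; exists (t +i* y)%C.
(* The horizontal line that links all good vertical lines. *)
have [y0 _ ny0] := avoid_finite finim (ltr01 : 0 < 1 :> R).
have [i Fi] := hor _ ny0; exists i.
have Fver x y : ~ re x -> F i (x +i* y)%C.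
  move=> nx; have [j Fj] := ver _ nx.
  suff -> : i = j by exact: Fj.
  apply: (one _ _ (x +i* y0)%C) => // Exy; apply: nx; by exists (x +i* y0)%C.
move=> [x y]; have : closed [set t : R | F i (t +i* y)%C].
  apply: (@closed_preimage R C (fun t => (t +i* y)%C)) => //.
  by apply/cont_on_setT; apply: cont_on_complex; [exact: cont_on_id|exact: cont_on_cst].
apply => B /nbhs_ballP[e /= e0 eB].
have xe : x < x + e by rewrite ltrDl.
have [m /andP[xm me] nm] := avoid_finite finre xe.
exists m; split; first exact: Fver.
by apply: eB; rewrite -ball_normE /= ltr_norml; apply/andP; split; lra.
Qed.

End Square.

(** * The topology of the projective plane *)

Lemma nbhs_neq0 (K : numFieldType) (a : K) : a != 0 -> nbhs a [set c | c != 0].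
Proof.
move=> a0; apply/nbhs_ballP; exists `|a| => [|c]; first by rewrite /= normr_gt0.
by rewrite -ball_normE /= => h; apply: contraTneq h => ->; rewrite subr0 ltxx.
Qed.

Lemma near_neq0 (K : numFieldType) (T : topologicalType) (A : set T) (f : T -> K) x :
  cont_on A f -> A x -> f x != 0 -> \forall y \near x, A y -> f y != 0.
Proof. by move=> /cont_onP cf Ax fx; exact: (cf x Ax _ (nbhs_neq0 fx)). Qed.

Section HomogeneousCoordinates.
Variable K : fieldType.
Implicit Types (a b c k : K) (v : 'rV[K]_3).

Lemma ord3P (j : 'I_3) : [\/ j = 0, j = 1 | j = 2].
Proof.
by case: j => -[|[|[|//]]] p; [apply: Or31|apply: Or32|apply: Or33]; exact: val_inj.
Qed.

Lemma sum3 (F : 'I_3 -> K) : \sum_j F j = F 0 + F 1 + F 2.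
Proof.
rewrite !big_ord_recl big_ord0 addr0 addrA; congr (_ + F _ + F _); exact: val_inj.
Qed.

Lemma row3E a b c :
  [/\ row3 a b c 0 0 = a, row3 a b c 0 1 = b & row3 a b c 0 2 = c].
Proof. by split; rewrite mxE. Qed.

Lemma row3_eta v : v = row3 (v 0 0) (v 0 1) (v 0 2).
Proof.
apply/rowP => j; have [h0 h1 h2] := row3E (v 0 0) (v 0 1) (v 0 2).
by case: (ord3P j) => ->.
Qed.

Lemma row3_eq0 a b c : (row3 a b c == 0) = [&& a == 0, b == 0 & c == 0].
Proof.
have [ha hb hc] := row3E a b c.
apply/eqP/and3P => [h|[/eqP-> /eqP-> /eqP->]].
  by split; [rewrite -ha|rewrite -hb|rewrite -hc]; rewrite h mxE.
by apply/rowP => j; have [h0 h1 h2] := row3E 0 0 0; rewrite [RHS]mxE; case: (ord3P j) => ->.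
Qed.

Lemma row3_scale k a b c : row3 (k * a) (k * b) (k * c) = k *: row3 a b c.
Proof.
have [h0 h1 h2] := row3E a b c; have [g0 g1 g2] := row3E (k * a) (k * b) (k * c).
apply/rowP => j; rewrite [RHS]mxE.
by case: (ord3P j) => ->; rewrite ?h0 ?h1 ?h2 ?g0 ?g1 ?g2.
Qed.

Lemma val_nzvec v : v != 0 -> \val (insubd (nzvec_default K) v) = v.
Proof. by move=> v0; rewrite insubdK//; exact/mem_set. Qed.

Lemma hcoord_neq0 (P : proj_plane K) : hcoord P != 0.
Proof. by have := valP (repr P); rewrite inE. Qed.

Lemma hpoint_hcoord (P : proj_plane K) :
  P = hpoint (hcoord P 0 0) (hcoord P 0 1) (hcoord P 0 2).
Proof.
rewrite /hpoint -row3_eta -[LHS]reprK; congr (\pi_(proj_plane K) _)%qT.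
by apply: val_inj; rewrite val_nzvec//; exact: hcoord_neq0.
Qed.

Lemma hpoint_scale k a b c : k != 0 -> hpoint (k * a) (k * b) (k * c) = hpoint a b c.
Proof.
move=> k0; rewrite /hpoint row3_scale.
have [->|v0] := eqVneq (row3 a b c) 0; first by rewrite scaler0.
have h : proportional (insubd (nzvec_default K) (k *: row3 a b c))
    (insubd (nzvec_default K) (row3 a b c)).
  rewrite /proportional !val_nzvec ?scaler_eq0 ?negb_or ?k0//.
  by apply/eqmxP; exact: eqmx_scale.
exact/eqmodP.
Qed.

End HomogeneousCoordinates.

Section ProjectivePlaneTopology.
Variable R : realType.
Local Notation C := (Cplx R).
Local Notation K := (R[i]^o : fieldType).
Local Notation V := 'rV[R[i]^o]_3.

Definition cpt (x y z : C) : CP2 R := @hpoint K x y z.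

Lemma cptP (P : CP2 R) : exists x y z : C,
  [/\ row3 (x : R[i]^o) y z != 0, P = cpt x y z & hcoord P = row3 (x : R[i]^o) y z].
Proof.
exists (hcoord P 0 0), (hcoord P 0 1), (hcoord P 0 2).
by rewrite -row3_eta hcoord_neq0; split => //; exact: (@hpoint_hcoord K).
Qed.

Lemma cpt_scale (k x y z : C) : k != 0 -> cpt (k * x) (k * y) (k * z) = cpt x y z.
Proof. exact: (@hpoint_scale K). Qed.

Lemma pi_cpt (v : nzvec (R[i]^o)) :
  \pi_(proj_plane (R[i]^o))%qT v = cpt (\val v 0 0) (\val v 0 1) (\val v 0 2).
Proof.
rewrite /cpt /hpoint -row3_eta; congr (\pi_(proj_plane _) _)%qT.
by apply: val_inj; rewrite val_nzvec//; have := valP v; rewrite inE.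
Qed.

Definition lf (l : R * R * R) (x y z : C) : C :=
  (l.1.1%:C%C : C) * x + (l.1.2%:C%C : C) * y + (l.2%:C%C : C) * z.

(** The value at a chosen representative of [P]: its vanishing is meaningful, the value itself is
    not and need not vary continuously. Functions on the plane are therefore built from the
    quotients [fmq], of degree 0. *)
Definition fm (l : R * R * R) (P : CP2 R) : C :=
  lf l (hcoord P 0 0) (hcoord P 0 1) (hcoord P 0 2).

Lemma lf_scale l (k x y z : C) : lf l (k * x) (k * y) (k * z) = k * lf l x y z.
Proof. by rewrite /lf; ring. Qed.

Lemma fm_cpt (x y z : C) : row3 (x : R[i]^o) y z != 0 ->
  exists2 k : C, k != 0 & forall l, fm l (cpt x y z) = k * lf l x y z.
Proof.
move=> v0; have [k k0 hk] := hcoord_hpoint v0; exists k => // l.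
by rewrite /fm /cpt hk; have [h0 h1 h2] := row3E x y z; rewrite !mxE /= -lf_scale.
Qed.

Definition fmq (l m : R * R * R) (P : CP2 R) : C := fm l P / fm m P.

Lemma fmq_cpt l m (x y z : C) : row3 (x : R[i]^o) y z != 0 ->
  fmq l m (cpt x y z) = lf l x y z / lf m x y z.
Proof.
move=> /fm_cpt[k k0 hk]; rewrite /fmq !hk.
by rewrite invfM mulrACA divff// mul1r.
Qed.

Lemma fm_cpt_eq0 l (x y z : C) : row3 (x : R[i]^o) y z != 0 ->
  (fm l (cpt x y z) == 0) = (lf l x y z == 0).
Proof. by move=> /fm_cpt[k k0 ->]; rewrite mulf_eq0 (negbTE k0). Qed.

(** Openness for the quotient topology, tested on the cone over [S]; [U] has to agree with this cone
    on nonzero vectors only. *)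
Lemma open_CP2 (S : set (CP2 R)) (U : set V) : open U ->
  (forall x y z : C, row3 (x : R[i]^o) y z != 0 -> S (cpt x y z) <-> U (row3 (x : R[i]^o) y z)) ->
  open S.
Proof.
move=> oU SU; exists U => //; apply/seteqP; split => v /=.
  move=> Uv; suff : S (\pi_(proj_plane (R[i]^o))%qT v) by [].
  rewrite pi_cpt; apply/SU; rewrite -row3_eta//.
  by have := valP v; rewrite inE.
move=> Sv; have : S (\pi_(proj_plane (R[i]^o))%qT v) by [].
rewrite pi_cpt => /SU; rewrite -row3_eta; apply.
by have := valP v; rewrite inE.
Qed.

Lemma cont_on_lf (T : topologicalType) (A : set T) l (x y z : T -> C) :
  cont_on A x -> cont_on A y -> cont_on A z -> cont_on A (fun t => lf l (x t) (y t) (z t)).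
Proof.
move=> cx cy cz.
by apply: (@cont_onD C); [apply: (@cont_onD C)|];
  (apply: (@cont_onM C) => [|]; [exact: cont_on_cst|]); [exact: cx|exact: cy|exact: cz].
Qed.

Lemma cont_on_fm_row (A : set V) l :
  cont_on A (fun v : V => lf l (v 0 0) (v 0 1) (v 0 2)).
Proof.
have cc j : cont_on A (fun v : V => v 0 j : C).
  by apply: cont_on_continuous; exact: (@coord_continuous C).
by apply: cont_on_lf; exact: cc.
Qed.

Lemma cont_on_fmq l m : cont_on [set P | fm m P != 0] (fmq l m).
Proof.
apply/cont_onP => P mP O; rewrite nbhsE => -[O' [oO' O'P] O'O].
pose S := [set Q | fm m Q != 0 /\ O' (fmq l m Q)].
have oS : open S.
  pose U := [set v : V | lf m (v 0 0) (v 0 1) (v 0 2) != 0 /\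
    O' (lf l (v 0 0) (v 0 1) (v 0 2) / lf m (v 0 0) (v 0 1) (v 0 2))].
  apply: (@open_CP2 _ U).
    rewrite openE => v [mv Ov]; rewrite /interior.
    have n0 := near_neq0 (@cont_on_fm_row setT m) I mv.
    have nO : nbhs (lf l (v 0 0) (v 0 1) (v 0 2) / lf m (v 0 0) (v 0 1) (v 0 2)) O'.
      exact: open_nbhs_nbhs.
    have cq : cont_on [set v : V | lf m (v 0 0) (v 0 1) (v 0 2) != 0]
        (fun v => lf l (v 0 0) (v 0 1) (v 0 2) / lf m (v 0 0) (v 0 1) (v 0 2)).
      apply: cont_onM; first exact: cont_on_fm_row.
      by apply: cont_onV => [x //|]; exact: cont_on_fm_row.
    have := (cont_onP _ _).1 cq v mv _ nO.
    by move: n0; apply: filterS2 => w w0 h; have w1 := w0 I; split => //; exact: h.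
  move=> x y z v0; rewrite /S /U /= fm_cpt_eq0// fmq_cpt//.
  by have [-> -> ->] := row3E x y z.
have : nbhs P S by apply: open_nbhs_nbhs; split.
by apply: filterS => Q [_ h] _; exact: O'O.
Qed.

Lemma closed_fm l : closed [set P : CP2 R | fm l P = 0].
Proof.
rewrite -[X in closed X]setCK; apply: open_closedC.
apply: (@open_CP2 _ [set v : V | lf l (v 0 0) (v 0 1) (v 0 2) != 0]).
  rewrite openE => v mv; rewrite /interior.
  by have := near_neq0 (@cont_on_fm_row setT l) I mv; apply: filterS => w /(_ I).
move=> x y z v0; have [h0 h1 h2] := row3E x y z; rewrite /= h0 h1 h2.
rewrite -fm_cpt_eq0//=; split; [by move=> h; apply/eqP|by move=> /eqP].
Qed.

Lemma open_fm l : open [set P : CP2 R | fm l P != 0].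
Proof.
have -> : [set P : CP2 R | fm l P != 0] = ~` [set P | fm l P = 0].
  by apply/seteqP; split => P /= /eqP.
exact/closed_openC/closed_fm.
Qed.

Lemma cont_on_cpt (T : topologicalType) (A : set T) (x y z : T -> C) :
  cont_on A x -> cont_on A y -> cont_on A z ->
  (forall t, A t -> row3 (x t : R[i]^o) (y t) (z t) != 0) ->
  cont_on A (fun t => cpt (x t) (y t) (z t)).
Proof.
move=> /cont_onP cx /cont_onP cy /cont_onP cz v0.
apply/cont_onP => t At O; rewrite nbhsE => -[O' [[U oU UO'] O't] O'O].
have OU s : A s -> U (row3 (x s : R[i]^o) (y s) (z s)) -> O (cpt (x s) (y s) (z s)).
  move=> As Us; apply: O'O; rewrite /cpt /hpoint.
  set w := insubd _ _.
  have : (set_val @^-1` U) w by change (U (\val w)); rewrite /w val_nzvec//; exact: v0.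
  by rewrite UO'.
have Ut : U (row3 (x t : R[i]^o) (y t) (z t)).
  move: O't; rewrite /cpt /hpoint; set w := insubd _ _ => h.
  have : (set_val @^-1` U) w by rewrite UO'.
  by move=> h2; have : U (\val w) by []; rewrite /w val_nzvec//; exact: v0.
have [P Pn PU] : nbhs (row3 (x t : R[i]^o) (y t) (z t)) U by exact: open_nbhs_nbhs.
have [hx hy hz] := row3E (x t) (y t) (z t).
have n0 := cx t At (P 0 0) ltac:(by rewrite -hx; exact: Pn).
have n1 := cy t At (P 0 1) ltac:(by rewrite -hy; exact: Pn).
have n2 := cz t At (P 0 2) ltac:(by rewrite -hz; exact: Pn).
near=> s => As; apply: OU => //; apply: PU => i j.
rewrite (ord1 i); have [gx gy gz] := row3E (x s) (y s) (z s).
by case: (ord3P j) => ->; rewrite ?gx ?gy ?gz; [apply: (near n0 s)|apply: (near n1 s)|apply: (near n2 s)].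
Unshelve. all: by end_near. Qed.

End ProjectivePlaneTopology.

(** * Coordinates of the configuration *)

(* Coordinates in Z[sqrt 2], the pair (m, n) standing for m + n sqrt 2. *)
Definition zz : Type := int * int.
Definition zz_mul (p q : zz) : zz := (p.1 * q.1 + 2 * (p.2 * q.2), p.1 * q.2 + p.2 * q.1).
Definition zz_add (p q : zz) : zz := (p.1 + q.1, p.2 + q.2).
Definition zz_opp (p : zz) : zz := (- p.1, - p.2).
(** The norm of Z[sqrt 2]. An integer computation showing it nonzero certifies that the real number
    is nonzero, see [ev_neq0]. *)
Definition zz_norm (p : zz) : int := p.1 * p.1 - 2 * (p.2 * p.2).
Definition zz_minor (a b c d : zz) : zz := zz_add (zz_mul a d) (zz_opp (zz_mul b c)).
Definition zz_det (u v w : zz * zz * zz) : zz :=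
  zz_add (zz_mul w.1.1 (zz_minor u.1.2 u.2 v.1.2 v.2))
    (zz_add (zz_mul w.1.2 (zz_minor u.2 u.1.1 v.2 v.1.1))
            (zz_mul w.2 (zz_minor u.1.1 u.1.2 v.1.1 v.1.2))).

Definition sgn (s : bool) : int := if s then 1 else -1.

(* Entries 0 to 2 are the vertices V1 to V3, entries 3 to 14 the
   surrounding-points S1 to S12; alpha and beta are [sgn s] and [sgn t]. *)
Definition table (s t : bool) : seq (zz * zz * zz) :=
  let q (n : int) : zz := (n, 0) in let r (n : int) : zz := (0, n) in
  let a := sgn s in let b := sgn t in
  [:: (q 0, q 0, q 1); (q 1, q 0, q 0); (q 0, q 1, q 0);
      (q 1, q 1, q 1); (q 4, q 1, q 1); (q 4, q 1, q 4);
      (q 2, q 2, q 1); (q 4, q (-2), q 1); (q (-1), q 1, q 4);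
      (q 4, q (-2), r a); (r (2 * a), q (-2), q 1); (q 2, r (- a), q 1);
      (q (-1), q 1, r b); (q (-1), r (2 * b), q 4); (r (- b), q 4, q 2)].

Definition zcoord s t i : zz * zz * zz := nth ((0, 0), (0, 0), (0, 0)) (table s t) i.

(** Every triple contains exactly one vertex, written first, and each vertex pairs off the twelve
    surrounding-points. *)
Definition triples : seq (nat * nat * nat) :=
  [:: (0, 3, 6); (0, 4, 5); (0, 7, 9); (0, 8, 12); (0, 10, 11); (0, 13, 14);
      (1, 3, 4); (1, 5, 8); (1, 6, 14); (1, 7, 10); (1, 9, 11); (1, 12, 13);
      (2, 3, 5); (2, 4, 7); (2, 6, 11); (2, 8, 13); (2, 9, 10); (2, 12, 14)]%N.

Definition aligned (i j k : nat) : bool :=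
  [|| (i, j, k) \in triples, (i, k, j) \in triples, (j, i, k) \in triples,
      (j, k, i) \in triples, (k, i, j) \in triples | (k, j, i) \in triples].

Lemma zz_det_table s t : all (fun i => all (fun j => all (fun k =>
  (i == j) || (j == k) || (i == k) ||
  if aligned i j k then zz_det (zcoord s t i) (zcoord s t j) (zcoord s t k) == (0, 0)
  else zz_norm (zz_det (zcoord s t i) (zcoord s t j) (zcoord s t k)) != 0)
  (iota 0 15)) (iota 0 15)) (iota 0 15).
Proof. by case: s t => -[]; vm_compute. Qed.

Lemma zz_minor_table s t : all (fun i => all (fun j => (i == j) ||
  let u := zcoord s t i in let v := zcoord s t j in
  [|| zz_norm (zz_minor u.1.2 u.2 v.1.2 v.2) != 0,
      zz_norm (zz_minor u.2 u.1.1 v.2 v.1.1) != 0 |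
      zz_norm (zz_minor u.1.1 u.1.2 v.1.1 v.1.2) != 0])
  (iota 0 15)) (iota 0 15).
Proof. by case: s t => -[]; vm_compute. Qed.

Lemma aligned_neq i j k : aligned i j k -> [/\ i != j, i != k & j != k].
Proof.
have h x y z : (x, y, z) \in triples -> [/\ x != y, x != z & y != z].
  move=> hx; have : all (fun t => [&& t.1.1 != t.1.2, t.1.1 != t.2 & t.1.2 != t.2]) triples by [].
  by move=> /allP/(_ _ hx) /= /and3P[].
by move=> /or4P[|||/or3P[]] /h[? ? ?]; split; rewrite // eq_sym.
Qed.

(* A vertex lies in six triples, a surrounding-point in three; ordered pairs
   are counted. *)
Lemma card_aligned (i : 'I_15) :
  #|[set p : 'I_15 * 'I_15 | aligned i p.1 p.2]%SET| = (if i < 3 then 12 else 6)%N.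
Proof.
rewrite -sum1dep_card big_mkcond /=.
rewrite -(pair_bigA _ (fun j k : 'I_15 => if aligned i j k then 1 else 0))%N /=.
under eq_bigr => j _ do rewrite -(big_mkord xpredT (fun k => if aligned i j k then 1 else 0))%N.
rewrite -(big_mkord xpredT (fun j => \sum_(0 <= k < 15) if aligned i j k then 1 else 0))%N.
have : all (fun i => (\sum_(0 <= j < 15) \sum_(0 <= k < 15) if aligned i j k then 1 else 0) ==
  if (i < 3)%N then 12 else 6)%N (iota 0 15) by rewrite unlock; vm_compute.
by move=> /allP/(_ i); rewrite mem_iota ltn_ord => /(_ isT)/eqP.
Qed.

(** An alignment-preserving injection sends the twelve ordered pairs aligned with a vertex to
    distinct pairs aligned with its image, whereas a surrounding-point has only six. This serves for
    stability and, dually, for the lines of the arrangement. *)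
Lemma aligned_vertices (g : 'I_15 -> 'I_15) : injective g ->
  (forall i j k : 'I_15, aligned i j k -> aligned (g i) (g j) (g k)) ->
  forall i : 'I_15, (i < 3)%N -> (g i < 3)%N.
Proof.
move=> gI ga i i3; have := card_aligned (g i); case: ltnP => // _ c6.
have := card_aligned i; rewrite i3 => c12.
have sub : ([set (g p.1, g p.2) | p in [set p : 'I_15 * 'I_15 | aligned i p.1 p.2]]%SET
  \subset [set p : 'I_15 * 'I_15 | aligned (g i) p.1 p.2]%SET).
  by apply/fintype.subsetP => _ /imsetP[p + ->]; rewrite !inE; exact: ga.
have := subset_leq_card sub.
by rewrite card_imset ?c12 ?c6; last by move=> [a b] [c d] /= [/gI -> /gI ->].
Qed.

Section Coordinates.
Variable R : realType.
Local Notation sqrt2 := (Num.sqrt 2 : R).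

Definition ev (p : zz) : R := p.1%:~R + p.2%:~R * sqrt2.

Lemma sqrt2M : sqrt2 * sqrt2 = 2.
Proof. by rewrite -expr2 sqr_sqrtr. Qed.

Lemma evM p q : ev (zz_mul p q) = ev p * ev q.
Proof.
rewrite /ev /zz_mul /= !rmorphD !rmorphM /= -[2%:~R]sqrt2M; ring.
Qed.

Lemma evD p q : ev (zz_add p q) = ev p + ev q.
Proof. by rewrite /ev /zz_add /= !rmorphD /=; ring. Qed.

Lemma evN p : ev (zz_opp p) = - ev p.
Proof. by rewrite /ev /zz_opp /= !rmorphN /=; ring. Qed.

Lemma ev_neq0 p : zz_norm p != 0 -> ev p != 0.
Proof.
apply: contraNneq => h; rewrite -(intr_eq0 R) /zz_norm rmorphB !rmorphM /=.
have -> : 2%:~R * (p.2%:~R * p.2%:~R) = (p.2%:~R * sqrt2) * (p.2%:~R * sqrt2).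
  by rewrite -[2%:~R]sqrt2M; ring.
have -> : p.1%:~R = - (p.2%:~R * sqrt2) by apply/eqP; rewrite -addr_eq0 -h.
by rewrite mulrNN subrr.
Qed.

Lemma ev0 : ev (0, 0) = 0.
Proof. by rewrite /ev /= mul0r addr0. Qed.

Definition homog s t i : R * R * R :=
  let u := zcoord s t i in (ev u.1.1, ev u.1.2, ev u.2).

Definition cross (K : pzRingType) (u v : K * K * K) : K * K * K :=
  (u.1.2 * v.2 - u.2 * v.1.2, u.2 * v.1.1 - u.1.1 * v.2, u.1.1 * v.1.2 - u.1.2 * v.1.1).

Definition dot (K : pzRingType) (u v : K * K * K) : K :=
  u.1.1 * v.1.1 + u.1.2 * v.1.2 + u.2 * v.2.

Lemma ev_minor a b c d : ev (zz_minor a b c d) = ev a * ev d - ev b * ev c.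
Proof. by rewrite evD evN !evM. Qed.

Lemma ev_det s t i j k : dot (homog s t k) (cross (homog s t i) (homog s t j)) =
  ev (zz_det (zcoord s t i) (zcoord s t j) (zcoord s t k)).
Proof. by rewrite /zz_det !evD !evM !ev_minor /dot /cross /= addrA. Qed.

Lemma homog_det s t (i j k : 'I_15) : i != j -> j != k -> i != k ->
  (dot (homog s t k) (cross (homog s t i) (homog s t j)) == 0) = aligned i j k.
Proof.
move=> ij jk ik; rewrite ev_det.
have /allP/(_ i) := zz_det_table s t; rewrite mem_iota ltn_ord => /(_ isT).
move=> /allP/(_ j); rewrite mem_iota ltn_ord => /(_ isT).
move=> /allP/(_ k); rewrite mem_iota ltn_ord => /(_ isT).
rewrite -!val_eqE /= in ij jk ik; rewrite (negbTE ij) (negbTE jk) (negbTE ik) /=.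
case: ifP => al; first by move=> /eqP ->; rewrite ev0 eqxx.
by move=> /ev_neq0/negbTE.
Qed.

Lemma homog_cross s t (i j : 'I_15) : i != j ->
  cross (homog s t i) (homog s t j) != (0, 0, 0).
Proof.
move=> ij; have /allP/(_ i) := zz_minor_table s t; rewrite mem_iota ltn_ord => /(_ isT).
move=> /allP/(_ j); rewrite mem_iota ltn_ord => /(_ isT).
rewrite -val_eqE /= in ij; rewrite (negbTE ij) /= => h.
apply/eqP => -[]; rewrite -!ev_minor => /eqP h1 /eqP h2 /eqP h3.
by case/or3P: h => /ev_neq0; rewrite ?h1 ?h2 ?h3.
Qed.

End Coordinates.

(** * Combinatorics and stability *)

Section LinearAlgebra3.
Variable K : fieldType.
Implicit Types u v w x : K * K * K.

Lemma dot_cross_l u v : dot u (cross u v) = 0.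
Proof. by rewrite /dot /cross /=; ring. Qed.

Lemma dot_cross_r u v : dot v (cross u v) = 0.
Proof. by rewrite /dot /cross /=; ring. Qed.

Lemma dotC u v : dot u v = dot v u.
Proof. by rewrite /dot; ring. Qed.

(** Cramer's rule: [dot w (cross u v)] is the determinant of the system. *)
Lemma common_zero u v w x : dot u x = 0 -> dot v x = 0 -> dot w x = 0 ->
  dot w (cross u v) != 0 -> x = (0, 0, 0).
Proof.
move=> ux vx wx d0.
have E c : c * dot w (cross u v) = 0 -> c = 0.
  by move=> /eqP; rewrite mulf_eq0 (negbTE d0) orbF => /eqP.
have e1 : x.1.1 * dot w (cross u v) = dot u x * (cross v w).1.1 + dot v x * (cross w u).1.1
   + dot w x * (cross u v).1.1 by rewrite /dot /cross /=; ring.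
have e2 : x.1.2 * dot w (cross u v) = dot u x * (cross v w).1.2 + dot v x * (cross w u).1.2
   + dot w x * (cross u v).1.2 by rewrite /dot /cross /=; ring.
have e3 : x.2 * dot w (cross u v) = dot u x * (cross v w).2 + dot v x * (cross w u).2
   + dot w x * (cross u v).2 by rewrite /dot /cross /=; ring.
rewrite ux vx wx !mul0r !addr0 in e1 e2 e3.
by rewrite [x]surjective_pairing [x.1]surjective_pairing (E _ e1) (E _ e2) (E _ e3).
Qed.

Lemma hpoint_inj u v : cross u v != (0, 0, 0) ->
  hpoint u.1.1 u.1.2 u.2 <> hpoint v.1.1 v.1.2 v.2.
Proof.
move=> uv.
have u0 : row3 u.1.1 u.1.2 u.2 != 0.
  rewrite row3_eq0; apply: contraNN uv => /and3P[/eqP h1 /eqP h2 /eqP h3].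
  by rewrite /cross h1 h2 h3 !mul0r !subr0 eqxx.
have v0 : row3 v.1.1 v.1.2 v.2 != 0.
  rewrite row3_eq0; apply: contraNN uv => /and3P[/eqP h1 /eqP h2 /eqP h3].
  by rewrite /cross h1 h2 h3 !mulr0 !subr0 eqxx.
move=> e; have [k k0 hk] := hcoord_hpoint u0; have [l l0 hl] := hcoord_hpoint v0.
rewrite e hl in hk; have [h1 h2 h3] := row3E u.1.1 u.1.2 u.2.
have [g1 g2 g3] := row3E v.1.1 v.1.2 v.2.
move/eqP: uv; apply.
have vE : v = ((l^-1 * k) * u.1.1, (l^-1 * k) * u.1.2, (l^-1 * k) * u.2).
  have ZE (c : K) (r : 'rV_3) j : (c *: r) 0 j = c * r 0 j by rewrite mxE.
  have lE j : row3 v.1.1 v.1.2 v.2 0 j = l^-1 * k * row3 u.1.1 u.1.2 u.2 0 j.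
    by have /rowP/(_ j) := hk; rewrite !ZE => h; rewrite -mulrA -h mulKf.
  by case: (v) g1 g2 g3 lE => [[a b] c] /= g1 g2 g3 lE; congr (_, _, _);
    [rewrite -g1 lE h1|rewrite -g2 lE h2|rewrite -g3 lE h3].
by rewrite vE /cross /=; congr (_, _, _); ring.
Qed.

Lemma incident_hpoint l u : row3 u.1.1 u.1.2 u.2 != 0 ->
  incident l (hcoord (hpoint u.1.1 u.1.2 u.2)) <-> dot (l 0 0, l 0 1, l 0 2) u = 0.
Proof.
move=> /hcoord_hpoint[k k0 ->]; rewrite /incident sum3 !mxE /dot /=.
have -> : forall a b c, a * (k * u.1.1) + b * (k * u.1.2) + c * (k * u.2) =
   k * (a * u.1.1 + b * u.1.2 + c * u.2) by move=> a b c; ring.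
by split => [/eqP|->]; rewrite ?mulr0// mulf_eq0 (negbTE k0) => /eqP.
Qed.

End LinearAlgebra3.

Section Configuration.
Variable R : realType.
Variables s t : bool.
Local Notation alpha := ((sgn s)%:~R : R).
Local Notation beta := ((sgn t)%:~R : R).
Local Notation D := (configD alpha beta).
Local Notation u := (homog R s t).

Definition pnt (i : nat) : RP2 R := hpoint (u i).1.1 (u i).1.2 (u i).2.

Lemma pnt_named :
  [/\ [/\ V1 = pnt 0, V2 = pnt 1 & V3 = pnt 2],
      [/\ S1 = pnt 3, S2 = pnt 4 & S3 = pnt 5],
      [/\ S4 = pnt 6, S5 = pnt 7 & S6 = pnt 8],
      [/\ S7 alpha = pnt 9, S8 alpha = pnt 10 & S9 alpha = pnt 11] &
      [/\ S10 beta = pnt 12, S11 beta = pnt 13 & S12 beta = pnt 14]].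
Proof.
have evq n : ev R (n, 0) = n%:~R by rewrite /ev /= mulr0z mul0r addr0.
have evr n : ev R (0, n) = n%:~R * Num.sqrt 2 by rewrite /ev /= mulr0z add0r.
rewrite /pnt /homog /= !evq !evr !rmorphN !rmorphM /=.
by split; split.
Qed.

Lemma pnt_row (i : 'I_15) : row3 (u i).1.1 (u i).1.2 (u i).2 != 0.
Proof.
have [j ij] : exists j : 'I_15, i != j.
  by have [->|] := eqVneq i 0; [exists 1|exists 0].
rewrite row3_eq0; apply: contraNN (homog_cross R s t ij) => /and3P[/eqP h1 /eqP h2 /eqP h3].
by rewrite /cross h1 h2 h3 !mul0r !subr0 eqxx.
Qed.

Lemma pnt_inj (i j : 'I_15) : pnt i = pnt j -> i = j.
Proof.
by move=> e; apply/eqP; apply: contraPT e => ij; exact/hpoint_inj/homog_cross.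
Qed.

Lemma vertices_pnt P : vertices D P <-> exists2 i : 'I_15, (i < 3)%N & P = pnt i.
Proof.
have [[v1 v2 v3] _ _ _ _] := pnt_named; split => /=.
  by move=> [[]|] ->; [exists 0|exists 1|exists 2].
move=> [[[|[|[|//]]] ?] _ ->] /=; [left; left|left; right|right]; by [].
Qed.

Lemma set15P (U : Type) (f : nat -> U) x :
  ([set f 0; f 1; f 2] `|` [set f 3; f 4; f 5; f 6; f 7; f 8; f 9; f 10; f 11;
     f 12; f 13; f 14])%N x <-> exists i : 'I_15, x = f i.
Proof.
split; last first.
  move=> [[n n0] ->]; rewrite /setU /=.
  by do 15?[case: n n0 => [|n] n0; first by tauto].
move=> h; suff [n n15 ->] : exists2 n, (n < 15)%N & x = f n by exists (Ordinal n15).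
by case: h => [[[->|->]|->]|[[[[[[[[[[[->|->]|->]|->]|->]|->]|->]|->]|->]|->]|->]|->]];
  [exists 0%N|exists 1%N|exists 2%N|exists 3%N|exists 4%N|exists 5%N|exists 6%N|exists 7%N|
   exists 8%N|exists 9%N|exists 10%N|exists 11%N|exists 12%N|exists 13%N|exists 14%N].
Qed.

Lemma points_pnt P : points D P <-> exists i : 'I_15, P = pnt i.
Proof.
have [[v1 v2 v3] [s1 s2 s3] [s4 s5 s6] [s7 s8 s9] [s10 s11 s12]] := pnt_named.
by rewrite /points /= v1 v2 v3 s1 s2 s3 s4 s5 s6 s7 s8 s9 s10 s11 s12; exact: (set15P pnt).
Qed.

Lemma collinear_pnt (i j k : 'I_15) : i != j -> j != k -> i != k ->
  collinear [set pnt i; pnt j; pnt k] <-> aligned i j k.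
Proof.
move=> ij jk ik; rewrite -(homog_det R s t ij jk ik); split.
  move=> [l l0 hl]; apply: contraNT l0 => d0.
  have h m : [set pnt i; pnt j; pnt k] (pnt m) -> (exists n : 'I_15, m = n) ->
      dot (u m) (l 0 0, l 0 1, l 0 2) = 0.
    by move=> hm [n mn]; subst m; rewrite dotC; apply/incident_hpoint; [exact: pnt_row|exact: hl].
  have := common_zero (h i _ _) (h j _ _) (h k _ _) d0.
  move=> /(_ (or_introl (or_introl erefl)) (ex_intro _ i erefl)).
  move=> /(_ (or_introl (or_intror erefl)) (ex_intro _ j erefl)).
  move=> /(_ (or_intror erefl) (ex_intro _ k erefl)) [e0 e1 e2].
  by rewrite (row3_eta l) e0 e1 e2 row3_eq0 !eqxx.
move=> /eqP d0; pose c := cross (u i) (u j).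
have [c1 c2 c3] := row3E c.1.1 c.1.2 c.2.
exists (row3 c.1.1 c.1.2 c.2).
  rewrite row3_eq0; apply: contraNN (homog_cross R s t ij) => /and3P[/eqP h1 /eqP h2 /eqP h3].
  by apply/eqP; rewrite -/c; case: (c) h1 h2 h3 => [[? ?] ?] /= -> -> ->.
move=> P /= [[->|->]|->]; (apply/incident_hpoint; first exact: pnt_row);
  rewrite c1 c2 c3 -!surjective_pairing dotC; [exact: dot_cross_l|exact: dot_cross_r|exact: d0].
Qed.

Lemma card_set3P (U : choiceType) (T : set U) : (T #= `I_3)%card <->
  exists x y z, [/\ x <> y, x <> z, y <> z & T = [set x; y; z]].
Proof.
split.
  move=> /(@card_set_bijP _ nat)[f [fT fI fS]].
  have [x Tx fx] := fS 0%N isT; have [y Ty fy] := fS 1%N isT; have [z Tz fz] := fS 2%N isT.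
  have D n m : f n <> f m -> n <> m by move=> h e; apply: h; rewrite e.
  exists x, y, z; split; try (by apply: D; rewrite ?fx ?fy ?fz).
  apply/seteqP; split => [P TP|P [[->|->]|->//]] //.
  have E Q : T Q -> f P = f Q -> P = Q by move=> TQ; apply: fI; rewrite in_setE.
  have := fT P TP; case fP : (f P) => [|[|[|//]]] _.
  - by left; left; apply: E => //; rewrite fP.
  - by left; right; apply: E => //; rewrite fP.
  - by right; apply: E => //; rewrite fP.
move=> [x [y [z [/eqP xy /eqP xz /eqP yz ->]]]]; apply/(@card_set_bijP _ nat).
exists (fun w => if w == x then 0 else if w == y then 1 else 2)%N; split.
- by move=> w /= _; case: ifP => // _; case: ifP.
- move=> v w; rewrite !in_setE => -[[->|->]|->] [[->|->]|->] /=;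
  rewrite ?eqxx ?(negbTE xy) ?(negbTE xz) ?(negbTE yz) ?[y == x]eq_sym ?[z == x]eq_sym ?[z == y]eq_sym
   ?(negbTE xy) ?(negbTE xz) ?(negbTE yz) //.
- move=> [|[|[|//]]] _; [exists x|exists y|exists z]; rewrite /=; try tauto;
  by rewrite ?eqxx ?[y == x]eq_sym ?[z == x]eq_sym ?[z == y]eq_sym
   ?(negbTE xy) ?(negbTE xz) ?(negbTE yz).
Qed.

Definition triple_set (e : nat * nat * nat) : set (RP2 R) :=
  [set pnt e.1.1; pnt e.1.2; pnt e.2].

Lemma combinatorics_pnt (i j k : 'I_15) : i != j -> j != k -> i != k ->
  combinatorics D [set pnt i; pnt j; pnt k] <-> aligned i j k.
Proof.
move=> ij jk ik; rewrite -collinear_pnt//; split => [[]//|col]; split => //.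
  by move=> P [[->|->]|->]; apply/points_pnt; eexists.
apply/card_set3P; exists (pnt i), (pnt j), (pnt k); split => //;
  by move=> /pnt_inj/eqP; apply/negP.
Qed.

Lemma set3_perm (U : Type) (x y z : U) :
  [/\ [set x; z; y] = [set x; y; z], [set y; x; z] = [set x; y; z],
      [set y; z; x] = [set x; y; z], [set z; x; y] = [set x; y; z] &
      [set z; y; x] = [set x; y; z]].
Proof. by split; apply/seteqP; split => w /= [[]|]; tauto. Qed.

Lemma combinatorics_triples :
  combinatorics D = [set triple_set e | e in [set` triples]].
Proof.
apply/seteqP; split => T.
  move=> [TD /card_set3P[x [y [z [xy xz yz TE]]]] col].
  have [i xi] : exists i : 'I_15, x = pnt i by apply/points_pnt/TD; rewrite TE; left; left.
  have [j yj] : exists j : 'I_15, y = pnt j by apply/points_pnt/TD; rewrite TE; left; right.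
  have [k zk] : exists k : 'I_15, z = pnt k by apply/points_pnt/TD; rewrite TE; right.
  subst x y z.
  have ij : i != j by apply: contra_notN xy => /eqP ->.
  have ik : i != k by apply: contra_notN xz => /eqP ->.
  have jk : j != k by apply: contra_notN yz => /eqP ->.
  have [p1 p2 p3 p4 p5] := set3_perm (pnt i) (pnt j) (pnt k).
  move: col; rewrite TE collinear_pnt// => /or4P[h|h|h|/or3P[h|h|h]];
    by [exists (nat_of_ord i, nat_of_ord j, nat_of_ord k)|exists (nat_of_ord i, nat_of_ord k, nat_of_ord j)
       |exists (nat_of_ord j, nat_of_ord i, nat_of_ord k)|exists (nat_of_ord j, nat_of_ord k, nat_of_ord i)
       |exists (nat_of_ord k, nat_of_ord i, nat_of_ord j)|exists (nat_of_ord k, nat_of_ord j, nat_of_ord i)].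
move=> [[[i j] k] h <-]; rewrite /triple_set /=.
have al : aligned i j k by rewrite /aligned h.
have [ij ik jk] := aligned_neq al.
have : all (fun e => [&& e.1.1 < 15, e.1.2 < 15 & e.2 < 15]%N) triples by [].
move=> /allP/(_ _ h) /= /and3P[i15 j15 k15].
exact/(@combinatorics_pnt (Ordinal i15) (Ordinal j15) (Ordinal k15)).
Qed.

Lemma triplesE (U : Type) (f : nat * nat * nat -> U) :
  [set f e | e in [set` triples]] =
  [set f (0, 3, 6); f (0, 4, 5); f (0, 7, 9); f (0, 8, 12); f (0, 10, 11);
    f (0, 13, 14); f (1, 3, 4); f (1, 5, 8); f (1, 6, 14); f (1, 7, 10);
    f (1, 9, 11); f (1, 12, 13); f (2, 3, 5); f (2, 4, 7); f (2, 6, 11);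
    f (2, 8, 13); f (2, 9, 10); f (2, 12, 14)]%N.
Proof.
apply/seteqP; split => [x [e + <-]|x].
  rewrite /= !inE.
  by repeat (case/orP => [/eqP ->|]; [repeat (first [by right|left]); reflexivity|]); move=> /eqP ->; right.
move=> /= h; repeat (destruct h as [h|h]); rewrite h;
  (eexists; last reflexivity); by [].
Qed.

Lemma combinatorics_configD : combinatorics D =
        [set [set V1; S1; S4]; [set V1; S2; S3]; [set V1; S5; S7 alpha];
             [set V1; S6; S10 beta]; [set V1; S8 alpha; S9 alpha];
             [set V1; S11 beta; S12 beta];
             [set V2; S1; S2]; [set V2; S3; S6]; [set V2; S4; S12 beta];
             [set V2; S5; S8 alpha]; [set V2; S7 alpha; S9 alpha];
             [set V2; S10 beta; S11 beta];
             [set V3; S1; S3]; [set V3; S2; S5]; [set V3; S4; S9 alpha];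
             [set V3; S6; S11 beta]; [set V3; S7 alpha; S8 alpha];
             [set V3; S10 beta; S12 beta]].
Proof.
rewrite combinatorics_triples triplesE /triple_set /=.
by have [[-> -> ->] [-> -> ->] [-> -> ->] [-> -> ->] [-> -> ->]] := pnt_named.
Qed.

Lemma stable_configD : stable D.
Proof.
move=> f [fD fI _] fc.
have /choice[g fg] : forall i : 'I_15, exists j : 'I_15, f (pnt i) = pnt j.
  by move=> i; apply/points_pnt/fD/points_pnt; exists i.
have gI : injective g.
  move=> i j gij; apply/pnt_inj/fI; rewrite ?in_setE; try by apply/points_pnt; eexists.
  by rewrite !fg gij.
have ga (i j k : 'I_15) : aligned i j k -> aligned (g i) (g j) (g k).
  move=> al; have [ij ik jk] := aligned_neq al.
  rewrite val_eqE in ij; rewrite val_eqE in ik; rewrite val_eqE in jk.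
  have c := (combinatorics_pnt ij jk ik).2 al.
  apply/combinatorics_pnt; rewrite ?(inj_eq gI)//.
  rewrite -fc; exists [set pnt i; pnt j; pnt k] => //.
  by rewrite !image_setU !image_set1 !fg.
have gV := aligned_vertices gI ga.
have gK : forall i : 'I_15, (i < 3)%N -> exists2 j : 'I_15, (j < 3)%N & g j = i.
  move=> i i3.
  pose A := [set j : 'I_15 | (j < 3)%N]%SET.
  have gA : ([set g j | j in A] = A)%SET.
    (* An injection of the three vertices into themselves is onto, which turns the inclusion into an
       equality. *)
    apply/eqP; rewrite eqEcard card_imset// leqnn andbT.
    by apply/fintype.subsetP => _ /imsetP[j + ->]; rewrite !inE; exact: gV.
  have : i \in A by rewrite inE.
  by rewrite -gA => /imsetP[j]; rewrite inE => j3 ->; exists j.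
apply/seteqP; split => P.
  by move=> [Q /vertices_pnt[i i3 ->] <-]; apply/vertices_pnt; exists (g i); rewrite ?fg ?gV.
move=> /vertices_pnt[i /gK[j j3 <-] ->]; exists (pnt j); last by rewrite fg.
by apply/vertices_pnt; exists j.
Qed.

End Configuration.

(** * Lines of the dual arrangement *)

Section DualLines.
Variable R : realType.
Local Notation C := (Cplx R).
Local Notation K := (R[i]^o : fieldType).
Implicit Types v w : C * C * C.

Definition cx (l : R * R * R) : C * C * C := (l.1.1%:C%C, l.1.2%:C%C, l.2%:C%C).
Definition cptv v : CP2 R := cpt v.1.1 v.1.2 v.2.
Definition vscale (k : C) v : C * C * C := (k * v.1.1, k * v.1.2, k * v.2).
Definition vadd v w : C * C * C := (v.1.1 + w.1.1, v.1.2 + w.1.2, v.2 + w.2).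

Lemma vscaleD k v w : vscale k (vadd v w) = vadd (vscale k v) (vscale k w).
Proof. by rewrite /vscale /vadd /= !mulrDr. Qed.

Lemma vscaleA k m v : vscale k (vscale m v) = vscale (k * m) v.
Proof. by rewrite /vscale /= !mulrA. Qed.

Lemma vscale1 v : vscale 1 v = v.
Proof. by rewrite /vscale !mul1r -!surjective_pairing. Qed.

Lemma vscale0 v : vscale 0 v = (0, 0, 0).
Proof. by rewrite /vscale !mul0r. Qed.

Lemma vaddC v w : vadd v w = vadd w v.
Proof. by rewrite /vadd /=; congr (_, _, _); rewrite addrC. Qed.

Lemma vadd0 v : vadd v (0, 0, 0) = v.
Proof. by rewrite /vadd !addr0 -!surjective_pairing. Qed.

Lemma row3v_neq0 v : v <> (0, 0, 0) -> row3 (v.1.1 : R[i]^o) v.1.2 v.2 != 0.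
Proof.
move=> v0; rewrite row3_eq0; apply: contra_notN v0 => /and3P[/eqP h1 /eqP h2 /eqP h3].
by case: v h1 h2 h3 => [[? ?] ?] /= -> -> ->.
Qed.

Lemma cptvP (P : CP2 R) : exists2 v, v <> (0, 0, 0) & P = cptv v.
Proof.
have [x [y [z [v0 -> _]]]] := cptP P; exists (x, y, z) => // -[hx hy hz].
by move: v0; rewrite row3_eq0 hx hy hz !eqxx.
Qed.

Lemma cptv_scale k v : k != 0 -> cptv (vscale k v) = cptv v.
Proof. exact: cpt_scale. Qed.

Lemma fm_cptv l v : v <> (0, 0, 0) -> fm l (cptv v) = 0 <-> dot (cx l) v = 0.
Proof.
move=> /row3v_neq0/(fm_cpt_eq0 l) h; split => /eqP e; apply/eqP; move: e.
  by rewrite h.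
by rewrite h.
Qed.

Lemma fmq_cptv l m v : v <> (0, 0, 0) ->
  fmq l m (cptv v) = dot (cx l) v / dot (cx m) v.
Proof. by move=> /row3v_neq0/(fmq_cpt l m). Qed.

Lemma cptv_eq v w : v <> (0, 0, 0) -> w <> (0, 0, 0) -> cptv v = cptv w ->
  exists2 k : C, k != 0 & w = vscale k v.
Proof.
move=> v0 w0 e; have [k k0 hk] := hcoord_hpoint (row3v_neq0 v0).
have [l l0 hl] := hcoord_hpoint (row3v_neq0 w0).
have {}e : k *: row3 (v.1.1 : R[i]^o) v.1.2 v.2 = l *: row3 (w.1.1 : R[i]^o) w.1.2 w.2.
  by rewrite -hk -hl; congr hcoord.
have eE j : k * row3 (v.1.1 : R[i]^o) v.1.2 v.2 0 j = l * row3 (w.1.1 : R[i]^o) w.1.2 w.2 0 j.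
  have ZE (c : K) (r : 'rV_3) : (c *: r) 0 j = c * r 0 j by rewrite mxE.
  by rewrite -!ZE e.
exists (l^-1 * k : C); first by rewrite mulf_neq0 ?invr_eq0.
have [h1 h2 h3] := row3E (v.1.1 : R[i]^o) v.1.2 v.2.
have [g1 g2 g3] := row3E (w.1.1 : R[i]^o) w.1.2 w.2.
have e1 := eE 0; have e2 := eE 1; have e3 := eE 2.
rewrite h1 g1 in e1; rewrite h2 g2 in e2; rewrite h3 g3 in e3.
rewrite [w]surjective_pairing [w.1]surjective_pairing /vscale.
by congr (_, _, _); apply: (mulfI l0); [rewrite -e1|rewrite -e2|rewrite -e3];
  rewrite mulrA mulVKf.
Qed.

Lemma cross_eq0 v w : v <> (0, 0, 0) -> cross v w = (0, 0, 0) ->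
  exists k : C, w = vscale k v.
Proof.
case: v w => [[a b] c] [[a' b'] c'] v0 [/= /eqP e1 /eqP e2 /eqP e3].
rewrite subr_eq0 in e1; rewrite subr_eq0 in e2; rewrite subr_eq0 in e3.
move: e1 e2 e3 => /eqP e1 /eqP e2 /eqP e3; rewrite /vscale /=.
have [a0|a0] := eqVneq a 0; last first.
  exists (a' / a); congr (_, _, _); apply: (mulfI a0); rewrite mulrA mulrCA divff// mulr1.
  - by rewrite mulrC.
  - by rewrite e3 mulrC.
  - by rewrite -e2 mulrC.
have [b0|b0] := eqVneq b 0; last first.
  exists (b' / b); congr (_, _, _); apply: (mulfI b0); rewrite mulrA mulrCA divff// mulr1.
  - by rewrite -e3 mulrC.
  - by rewrite mulrC.
  - by rewrite e1 mulrC.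
have [c0|c0] := eqVneq c 0; first by exfalso; apply: v0; rewrite a0 b0 c0.
exists (c' / c); congr (_, _, _); apply: (mulfI c0); rewrite mulrA mulrCA divff// mulr1.
- by rewrite e2 mulrC.
- by rewrite -e1 mulrC.
- by rewrite mulrC.
Qed.

Lemma cx_cross l m : cross (cx l) (cx m) = cx (cross l m).
Proof. by rewrite /cx /cross /= !rmorphB !rmorphM. Qed.

Lemma dot_cx l m : dot (cx l) (cx m) = ((dot l m)%:C%C : C).
Proof. by rewrite /dot /cx /= !rmorphD !rmorphM. Qed.

Lemma cx_eq0 l : cx l = (0, 0, 0) -> l = (0, 0, 0).
Proof. by case: l => [[a b] c] [-> -> ->]. Qed.

(** By the double cross product identity (l x m) x v = (l.v) m - (m.v) l, a common zero [v] is
    proportional to l x m. *)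
Lemma two_forms_zero l m v : cross l m != (0, 0, 0) -> v <> (0, 0, 0) ->
  dot (cx l) v = 0 -> dot (cx m) v = 0 -> cptv v = cptv (cx (cross l m)).
Proof.
move=> lm0 v0 lv mv.
have c0 : cross (cx l) (cx m) <> (0, 0, 0).
  by rewrite cx_cross => /cx_eq0/eqP; apply/negP.
have : cross (cross (cx l) (cx m)) v = (0, 0, 0).
  have -> : cross (cross (cx l) (cx m)) v = vadd (vscale (dot (cx l) v) (cx m))
      (vscale (- dot (cx m) v) (cx l)).
    by rewrite /vadd /vscale /cross /dot /=; congr (_, _, _); ring.
  by rewrite lv mv oppr0 /vadd /vscale !mul0r !addr0.
move=> /(cross_eq0 c0)[k vk]; rewrite vk cptv_scale ?cx_cross//.
by apply: contra_notN v0 => /eqP k0; rewrite vk k0 /vscale !mul0r.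
Qed.

Lemma line_basis (l : R * R * R) : l != (0, 0, 0) -> exists p q : C * C * C,
  [/\ forall a b, dot (cx l) (vadd (vscale a p) (vscale b q)) = 0,
      forall v, dot (cx l) v = 0 -> exists a b, v = vadd (vscale a p) (vscale b q) &
      forall a b, vadd (vscale a p) (vscale b q) = (0, 0, 0) -> a = 0 /\ b = 0].
Proof.
case: l => [[a b] c] l0; rewrite /dot /vadd /vscale /=.
have nz (x : R) : x != 0 -> (x%:C%C : C) != 0.
  by apply: contraNneq => h; apply/eqP; exact: (complexI h).
have [c0|c0] := eqVneq c 0; last first.
  exists (1, 0, - (a%:C%C : C) / (c%:C%C : C)), (0, 1, - (b%:C%C : C) / (c%:C%C : C)); split => /=.
  - by move=> x y; field; exact: nz.
  - move=> [[x y] z] /= h; exists x, y; congr (_, _, _); [ring|ring|].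
    apply: (mulfI (nz _ c0)); apply/eqP; rewrite -subr_eq0 -h; apply/eqP; field; exact: nz.
  - by move=> x y; rewrite !mulr1 !mulr0 addr0 add0r => -[-> -> _].
have [b0|b0] := eqVneq b 0; last first.
  exists (1, - (a%:C%C : C) / (b%:C%C : C), 0), (0, - (c%:C%C : C) / (b%:C%C : C), 1); split => /=.
  - by move=> x y; field; exact: nz.
  - move=> [[x y] z] /= h; exists x, z; congr (_, _, _); [ring| |ring].
    apply: (mulfI (nz _ b0)); apply/eqP; rewrite -subr_eq0 -h; apply/eqP; field; exact: nz.
  - by move=> x y; rewrite !mulr1 !mulr0 addr0 add0r => -[-> _ ->].
have a0 : a != 0 by apply: contraNneq l0 => ->; rewrite b0 c0.
exists (- (b%:C%C : C) / (a%:C%C : C), 1, 0), (- (c%:C%C : C) / (a%:C%C : C), 0, 1); split => /=.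
- by move=> x y; field; exact: nz.
- move=> [[x y] z] /= h; exists y, z; congr (_, _, _); [|ring|ring].
  apply: (mulfI (nz _ a0)); apply/eqP; rewrite -subr_eq0 -h; apply/eqP; field; exact: nz.
- by move=> x y; rewrite !mulr1 !mulr0 addr0 add0r => -[_ -> ->].
Qed.

Lemma cont_on_cptv (T : topologicalType) (A : set T) (v : T -> C * C * C) :
  cont_on A (fun t => (v t).1.1) -> cont_on A (fun t => (v t).1.2) ->
  cont_on A (fun t => (v t).2) -> (forall t, A t -> v t <> (0, 0, 0)) ->
  cont_on A (fun t => cptv (v t)).
Proof. by move=> c1 c2 c3 v0; apply: cont_on_cpt => // t At; exact/row3v_neq0/v0. Qed.

Lemma cont_on_pencil (A : set C) (p q : C * C * C) :
  (forall z, A z -> vadd p (vscale z q) <> (0, 0, 0)) ->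
  cont_on A (fun z => cptv (vadd p (vscale z q))).
Proof.
have ca (x y : C) : cont_on A (fun z : C => x + z * y).
  apply: (@cont_onD C); first exact: cont_on_cst.
  by apply: (@cont_onM C) => [|]; [exact: cont_on_id|exact: cont_on_cst].
by move=> v0; apply: cont_on_cptv => //; exact: ca.
Qed.

(** An affine chart p + zq reduces the claim to the complex plane. The only point left out, that of
    q, is the limit of q + zp as z tends to 0 and is caught because the sets are closed. *)
Lemma line_closed_cover_CP2 (I : finType) (F : I -> set (CP2 R)) l :
  l != (0, 0, 0) -> (forall i, closed (F i)) ->
  (forall P, fm l P = 0 -> exists i, F i P) ->
  (forall i j P Q, i != j -> F i P -> F j P -> F i Q -> F j Q -> P = Q) ->
  exists i, forall P, fm l P = 0 -> F i P.
Proof.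
move=> l0 cF cov disj; have [p [q [lpq span free]]] := line_basis l0.
have chart0 z : vadd p (vscale z q) <> (0, 0, 0).
  have -> : vadd p (vscale z q) = vadd (vscale 1 p) (vscale z q).
    by rewrite {2}/vscale !mul1r.
  by move=> /free[/eqP]; rewrite oner_eq0.
have chart0' z : vadd q (vscale z p) <> (0, 0, 0).
  have -> : vadd q (vscale z p) = vadd (vscale z p) (vscale 1 q).
    by rewrite /vadd /vscale /= !mul1r; congr (_, _, _); rewrite addrC.
  by move=> /free[_ /eqP]; rewrite oner_eq0.
pose chart z := cptv (vadd p (vscale z q)).
have fm_chart z : fm l (chart z) = 0.
  apply/fm_cptv => //; have := lpq 1 z.
  by rewrite {1}/vscale !mul1r -!surjective_pairing.
have chartI : injective chart.
  move=> z z' /cptv_eq [//|//|k k0 e].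
  have : vadd (vscale (k - 1) p) (vscale (k * z - z') q) = (0, 0, 0).
    case: e => e1 e2 e3; rewrite /vadd /vscale /=; congr (_, _, _).
    - by rewrite -(subrr (k * (p.1.1 + z * q.1.1))) -{2}e1; ring.
    - by rewrite -(subrr (k * (p.1.2 + z * q.1.2))) -{2}e2; ring.
    - by rewrite -(subrr (k * (p.2 + z * q.2))) -{2}e3; ring.
  move=> /free[/eqP]; rewrite subr_eq0 => /eqP -> /eqP.
  by rewrite mul1r subr_eq0 => /eqP.
have [|||i Fi] := @plane_closed_cover R I (fun i => chart @^-1` F i).
- move=> i; apply: closed_preimage => //; apply/cont_on_setT.
  by apply: cont_on_pencil => z _; exact: chart0.
- by move=> z; apply: cov.
- move=> i j ij; have [[z0 [Fi0 Fj0]]|none] := pselect ((chart @^-1` F i `&` chart @^-1` F j) !=set0).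
    apply: (sub_finite_set (B := [set z0])) => // z [Fiz Fjz].
    exact/chartI/(disj i j).
  by apply: (sub_finite_set (B := set0)) => // z Fz; apply: none; exists z.
exists i => P lP; have [v v0 Pv] := cptvP P.
have [a [b vab]] := span v ((fm_cptv l v0).1 (etrans (congr1 _ (esym Pv)) lP)).
have [a0|a0] := eqVneq a 0; last first.
  have -> : P = chart (b / a); last exact: Fi.
  by rewrite Pv vab /chart -[RHS](cptv_scale _ a0) vscaleD vscaleA mulrCA divff// mulr1.
have b0 : b != 0.
  by apply: contra_notN v0 => /eqP b0; rewrite vab a0 b0 !vscale0 vadd0.
have -> : P = cptv (vadd q (vscale 0 p)).
  by rewrite Pv vab a0 -[RHS](cptv_scale _ b0) !vscale0 vadd0 vaddC vadd0.
have : closed [set z : C | F i (cptv (vadd q (vscale z p)))].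
  apply: (@closed_preimage C _ (fun z => cptv (vadd q (vscale z p)))) => //; apply/cont_on_setT.
  by apply: cont_on_pencil => z _; exact: chart0'.
apply => B /nbhs_ballP[e /= e0 eB].
have e20 : e / 2 != 0 by rewrite mulf_neq0 ?invr_neq0// gt_eqF.
exists (e / 2); split => /=; last first.
  apply: eB; rewrite -ball_normE /= sub0r normrN gtr0_norm ?divr_gt0//.
  by rewrite ltr_pdivrMr// ltr_pMr// ltr1n.
have -> : cptv (vadd q (vscale (e / 2) p)) = chart (2 / e); last exact: Fi.
rewrite /chart -[RHS](cptv_scale _ e20) vscaleD vscaleA vaddC.
suff -> : e / 2 * (2 / e) = 1 by rewrite vscale1.
by rewrite mulrA mulfVK ?divff// ?lt0r_neq0.
Qed.

End DualLines.

(** * Incidence of the lines and their permutation by a homeomorphism *)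

Section ArrangementLines.
Variable R : realType.
Local Notation C := (Cplx R).

Definition line s t i : set (CP2 R) := [set P | fm (homog R s t i) P = 0].

Lemma line_closed s t i : closed (line s t i).
Proof. exact: closed_fm. Qed.

Lemma homog_neq0 s t (i : 'I_15) : homog R s t i != (0, 0, 0).
Proof.
apply: contraNneq (pnt_row R s t i) => h; rewrite row3_eq0.
by rewrite h /= !eqxx.
Qed.

Lemma dual_line_pnt s t (i : 'I_15) : dual_line (pnt R s t i) = line s t i.
Proof.
apply/seteqP; rewrite /dual_line /line /fm /lf /pnt.
have [k k0 hk] := hcoord_hpoint (pnt_row R s t i).
have [h1 h2 h3] := row3E (homog R s t i).1.1 (homog R s t i).1.2 (homog R s t i).2.
have E Q : incident (map_mx (real_complex R) (hcoord (pnt R s t i)) : 'rV[R[i]^o]_3) (hcoord Q) <->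
    fm (homog R s t i) Q = 0.
  rewrite /incident sum3 /pnt hk.
  have ZE j : (map_mx (real_complex R) (k *: row3 (homog R s t i).1.1 (homog R s t i).1.2 (homog R s t i).2)) 0 j
    = (k%:C%C : C) * ((row3 (homog R s t i).1.1 (homog R s t i).1.2 (homog R s t i).2 0 j)%:C%C : C).
    by rewrite !mxE rmorphM.
  rewrite !ZE h1 h2 h3 /fm /lf -!mulrA -!mulrDr; split => [/eqP|->]; last exact: mulr0.
  rewrite mulf_eq0 => /orP[/eqP e|/eqP //].
  by have := complexI e => /eqP; rewrite (negbTE k0).
by split => Q /E.
Qed.

Lemma bigcup_arrangementM s t :
  \bigcup_(L in arrangementM ((sgn s)%:~R : R) (sgn t)%:~R) L = \bigcup_(i in [set: 'I_15]) line s t i.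
Proof.
apply/seteqP; split => P.
  by move=> [_ [_ /points_pnt[i ->] <-]]; rewrite dual_line_pnt => LP; exists i.
move=> [i _ LP]; exists (line s t i) => //; exists (pnt R s t i); last exact: dual_line_pnt.
by apply/points_pnt; exists i.
Qed.

Lemma line_meet s t (i j : 'I_15) P Q : i != j ->
  line s t i P -> line s t j P -> line s t i Q -> line s t j Q -> P = Q.
Proof.
move=> ij iP jP iQ jQ; have [v v0 Pv] := cptvP P; have [w w0 Qw] := cptvP Q; subst P Q.
move: iP jP iQ jQ; rewrite /line /= => /(fm_cptv _ v0) iv /(fm_cptv _ v0) jv.
move=> /(fm_cptv _ w0) iw /(fm_cptv _ w0) jw; have c0 := homog_cross R s t ij.
by rewrite (two_forms_zero c0 v0 iv jv) (two_forms_zero c0 w0 iw jw).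
Qed.

Lemma aligned_concurrent s t (i j k : 'I_15) : i != j -> j != k -> i != k ->
  (exists P, [/\ line s t i P, line s t j P & line s t k P]) <-> aligned i j k.
Proof.
move=> ij jk ik; rewrite -(homog_det R s t ij jk ik).
have c0 := homog_cross R s t ij.
have cc0 : cx (cross (homog R s t i) (homog R s t j)) <> (0, 0, 0).
  by move=> /cx_eq0/eqP; apply/negP.
split.
  move=> [P]; have [v v0 ->] := cptvP P; move=> -[iv jv kv].
  have e := two_forms_zero c0 v0 ((fm_cptv _ v0).1 iv) ((fm_cptv _ v0).1 jv).
  move: kv; rewrite /line /= e => /(fm_cptv _ cc0); rewrite dot_cx => h.
  by rewrite (complexI h).
move=> /eqP d0; exists (cptv (cx (cross (homog R s t i) (homog R s t j)))); split;
  apply/(fm_cptv _ cc0); rewrite dot_cx.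
- by rewrite dot_cross_l.
- by rewrite dot_cross_r.
- by rewrite d0.
Qed.

Lemma line_two_points s t (i : 'I_15) : exists P Q, [/\ P <> Q, line s t i P & line s t i Q].
Proof.
have [p [q [lpq _ free]]] := line_basis (homog_neq0 s t i).
have p0 : vadd (vscale 1 p) (vscale 0 q) <> (0, 0, 0) by move=> /free[/eqP]; rewrite oner_eq0.
have q0 : vadd (vscale 0 p) (vscale 1 q) <> (0, 0, 0) by move=> /free[_ /eqP]; rewrite oner_eq0.
exists (cptv (vadd (vscale 1 p) (vscale 0 q))), (cptv (vadd (vscale 0 p) (vscale 1 q))).
split; [|exact/fm_cptv|exact/fm_cptv].
move=> /(cptv_eq p0 q0)[k k0]; rewrite /vadd /vscale !mul0r !mul1r !addr0 !add0r /= => -[e1 e2 e3].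
have : vadd (vscale k p) (vscale (-1) q) = (0, 0, 0).
  by rewrite /vadd /vscale /= e1 e2 e3 !mulN1r !subrr.
by move=> /free[k00]; rewrite k00 eqxx in k0.
Qed.

Lemma line_subset s t (i j : 'I_15) : line s t i `<=` line s t j -> i = j.
Proof.
move=> ij; apply: contrapT => /eqP n; have [P [Q [PQ iP iQ]]] := line_two_points s t i.
by apply: PQ; apply: (line_meet n (s := s) (t := t)) => //; exact: ij.
Qed.

(** The covering argument yields inclusions only, for [f] and for [g]. Since no line of the
    arrangement lies in another, the composite map on indices is the identity, which turns the
    inclusions into equivalences. *)
Lemma homeomorphism_lines s t s' t' (f g : CP2 R -> CP2 R) :
  continuous f -> continuous g -> cancel f g -> cancel g f ->
  (forall P, (exists i : 'I_15, line s t i P) -> exists i : 'I_15, line s' t' i (f P)) ->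
  (forall P, (exists i : 'I_15, line s' t' i P) -> exists i : 'I_15, line s t i (g P)) ->
  exists2 p : 'I_15 -> 'I_15, injective p &
    forall (i : 'I_15) P, line s t i P <-> line s' t' (p i) (f P).
Proof.
have into a b a' b' (h k : CP2 R -> CP2 R) : continuous h -> cancel h k ->
    (forall P, (exists i : 'I_15, line a b i P) -> exists i : 'I_15, line a' b' i (h P)) ->
    forall i : 'I_15, exists j : 'I_15, line a b i `<=` h @^-1` line a' b' j.
  move=> ch hk hU i.
  apply: (line_closed_cover_CP2 (F := fun j : 'I_15 => h @^-1` line a' b' j)).
  - exact: homog_neq0.
  - by move=> j; apply: closed_preimage => //; exact: line_closed.
  - by move=> P iP; apply: hU; exists i.
  - move=> j l P Q jl jP lP jQ lQ; apply: (can_inj hk); exact: (line_meet jl (s := a') (t := b')).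
move=> cf cg fg gf fU gU.
have /choice[p fp] := into _ _ _ _ _ _ cf fg fU.
have /choice[r gr] := into _ _ _ _ _ _ cg gf gU.
have rp i : r (p i) = i.
  apply/esym/(line_subset (s := s) (t := t)) => P iP; rewrite -(fg P); exact/gr/fp.
exists p; first exact: (can_inj rp).
move=> i P; split; first exact: fp.
by move=> /gr; rewrite /= fg rp.
Qed.

Lemma homeomorphism_vertex_lines s t s' t' (f : CP2 R -> CP2 R) (p : 'I_15 -> 'I_15) :
  injective p -> (forall Q, exists P, f P = Q) ->
  (forall (i : 'I_15) P, line s t i P <-> line s' t' (p i) (f P)) ->
  forall i, (p i < 3)%N = (i < 3)%N.
Proof.
move=> pI fS fp.
have pa (i j k : 'I_15) : aligned i j k -> aligned (p i) (p j) (p k).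
  move=> al; have [ij ik jk] := aligned_neq al.
  rewrite val_eqE in ij; rewrite val_eqE in ik; rewrite val_eqE in jk.
  have [P [iP jP kP]] := (aligned_concurrent s t ij jk ik).2 al.
  apply/(aligned_concurrent s' t'); rewrite ?(inj_eq pI)//.
  by exists (f P); split; apply: (fp _ _).1.
have pV := aligned_vertices pI pa.
move=> i; apply/idP/idP => [pi3|]; last exact: pV.
pose A := [set j : 'I_15 | (j < 3)%N]%SET.
have pA : ([set p j | j in A] = A)%SET.
  apply/eqP; rewrite eqEcard card_imset// leqnn andbT.
  by apply/fintype.subsetP => _ /imsetP[j + ->]; rewrite !inE; exact: pV.
have : p i \in A by rewrite inE.
by rewrite -pA => /imsetP[j]; rewrite inE => j3 /pI ->.
Qed.

End ArrangementLines.

(** * Monodromy of h around the lines *)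

Section LocalRoots.
Variable R : realType.
Local Notation C := (Cplx R).

Lemma cont_on_prod (T : topologicalType) (A : set T) (I : Type) (r : seq I) (Q : pred I)
    (F : I -> T -> C) :
  (forall i, Q i -> cont_on A (F i)) -> cont_on A (fun x => \prod_(i <- r | Q i) F i x).
Proof.
move=> cF; elim: r => [|i r IHr].
  by apply: (@cont_on_eq _ _ _ (fun=> 1 : C)) => [x _|]; [rewrite big_nil|exact: cont_on_cst].
have [Qi|nQi] := boolP (Q i); last first.
  by apply: (cont_on_eq _ IHr) => x _; rewrite big_cons (negbTE nQi).
apply: (@cont_on_eq _ _ _ (fun x => F i x * \prod_(j <- r | Q j) F j x)).
  by move=> x _; rewrite big_cons Qi.
by apply: (@cont_onM C) => [|]; [exact: cF|exact: IHr].
Qed.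

Lemma has_sqrt_near (T : topologicalType) (A : set T) (f : T -> C) x :
  cont_on A f -> A x -> f x != 0 -> exists2 U, nbhs x U & has_sqrt (A `&` U) f.
Proof.
move=> cf Ax fx.
have cr : cont_on A (fun y => f y / f x).
  by apply: (@cont_onM C) => [|]; [exact: cf|exact: cont_on_cst].
have /cont_onP/(_ x Ax) := cont_on_Re cr.
move=> /(_ [set r | 0 < r]) h.
have : nbhs (complex.Re (f x / f x)) [set r : R | 0 < r] by rewrite divff//; exact: lt_nbhsr ltr01.
move=> /h xU; exists [set y | A y -> 0 < complex.Re (f y / f x)] => //.
apply: (@has_sqrt_eq _ _ _ (fun y => (f y / f x) * f x)) => [y _|].
  by rewrite divfK.
apply: has_sqrtM; last exact: has_sqrt_cst.
have AU : A `&` [set y | A y -> 0 < complex.Re (f y / f x)] `<=` A by move=> y [].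
exists (fun y => csqrt (f y / f x)).
  apply: cont_on_csqrt; last exact: cont_on_sub cr.
  by move=> y [Ay]; apply.
by move=> y [Ay yU]; rewrite sqr_csqrt//; exact: yU.
Qed.

(** Radii of balls in [C] are themselves elements of [C]; being positive they are real, and the real
    number is extracted here. *)
Lemma nbhs_real_ball (z : C) A : nbhs z A ->
  exists2 e : R, 0 < e & forall w, `|z - w| < (e%:C%C : C) -> A w.
Proof.
move=> /nbhs_ballP[[e e'] /= e0 eA]; move: e0; rewrite ltcE /= => /andP[/eqP e'0 e0].
by exists e => // w zw; apply: eA; rewrite -ball_normE /= e'0.
Qed.

Section Arrangement.
Variables s t : bool.
Local Notation u := (homog R s t).

Definition off_surrounding : set (CP2 R) :=
  [set P | forall i : 'I_15, (3 <= i)%N -> ~ line s t i P].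
Local Notation X := off_surrounding.

(** The factor of index 3 is 1 off its line, where the other eleven forms are then divided by the
    eleventh power of [u 3]: the order along that line is -11, as odd as the order 1 along the
    others. *)
Definition hfun (P : CP2 R) : C := \prod_(i < 15 | (3 <= i)%N) fmq (u i) (u 3) P.

Definition on_only (i : 'I_15) (P : CP2 R) : Prop :=
  line s t i P /\ forall j : 'I_15, (3 <= j)%N -> j != i -> ~ line s t j P.

Lemma fm_neq0 i P : ~ line s t i P -> fm (u i) P != 0.
Proof. by move=> h; apply/eqP. Qed.

Lemma off_fm3 P : X P -> fm (u 3) P != 0.
Proof. by move=> /(_ (Ordinal (isT : (3 < 15)%N)) isT)/fm_neq0. Qed.

Lemma cont_on_hfun : cont_on X hfun.
Proof.
apply: cont_on_prod => i _; apply: (cont_on_sub _ (@cont_on_fmq R (u i) (u 3))).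
exact: off_fm3.
Qed.

Lemma hfun_neq0 P : X P -> hfun P != 0.
Proof.
move=> XP; apply/prodf_neq0 => i i3; rewrite mulf_neq0 ?invr_eq0 ?off_fm3//.
exact/fm_neq0/XP.
Qed.

Lemma near_off_others i P : on_only i P ->
  nbhs P [set Q | forall j : 'I_15, (3 <= j)%N -> j != i -> ~ line s t j Q].
Proof.
move=> [_ h].
have near_off (j : 'I_15) : nbhs P [set Q | (3 <= j)%N -> j != i -> ~ line s t j Q].
  have [j3|nj3] := boolP (3 <= j)%N; last first.
    by apply: filterS filterT => Q _ /=.
  have [->|ji] := eqVneq j i; first by apply: filterS filterT => Q _ _ /eqP.
  have : nbhs P [set Q | fm (u j) Q != 0].
    by apply: open_nbhs_nbhs; split; [exact: open_fm|exact/fm_neq0/h].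
  by apply: filterS => Q /eqP hQ _ _.
exact: (filter_forall _ near_off).
Qed.

(** Near a generic point of line [i], h is the local equation [fmq (u i) m] times a nonvanishing
    [r], which has a root nearby, times a square. Hence h and the local equation have the same
    class. *)
Lemma hfun_local (i : 'I_15) (m : R * R * R) P : (3 <= i)%N -> on_only i P ->
  fm m P != 0 -> exists2 N, nbhs P N &
    has_sqrt (N `&` X) (fun Q => hfun Q * fmq (u i) m Q) /\ N `<=` [set Q | fm m Q != 0].
Proof.
move=> i3 [iP oP] mP.
pose r Q := \prod_(j < 15 | (3 <= j)%N && (j != i)) fmq (u j) m Q.
have cq j : cont_on [set Q | fm m Q != 0] (fmq (u j) m) by exact: cont_on_fmq.
have cr : cont_on [set Q | fm m Q != 0] r by apply: cont_on_prod => j _; exact: cq.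
have rP : r P != 0.
  apply/prodf_neq0 => j /andP[j3 ji]; rewrite mulf_neq0 ?invr_eq0//.
  exact/fm_neq0/oP.
have [U PU hU] := has_sqrt_near cr mP rP.
exists ([set Q | fm m Q != 0] `&` U).
  by apply: filterI => //; apply: open_nbhs_nbhs; split => //; exact: open_fm.
split; last by move=> Q [].
pose n := #|[pred j : 'I_15 | (3 <= j)%N]|.
(* Replacing the denominator [u 3] by [m] introduces a twelfth power, the square of a sixth
   power. *)
have n12 : n = (6 * 2)%N.
  by rewrite /n -sum1_card big_mkcond /= !big_ord_recl big_ord0.
apply: (@has_sqrt_eq _ _ _ (fun Q => fmq (u i) m Q ^+ 2 * r Q * (fmq m (u 3) Q ^+ 6) ^+ 2)).
  move=> Q [[mQ _] XQ].
  have -> : hfun Q = (fmq (u i) m Q * r Q) * fmq m (u 3) Q ^+ n.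
    rewrite /r -(bigD1 i) //= -prodr_const -big_split /=; apply: eq_bigr => j _.
    by rewrite /fmq mulrA divfK.
  by rewrite n12 exprM expr2; ring.
apply: has_sqrtM; [apply: has_sqrtM|].
- apply: has_sqrt_sqr; apply: (cont_on_sub _ (cq i)); by move=> Q [[]].
- by apply: has_sqrt_sub hU => Q [[]].
- apply: has_sqrt_sqr; apply: cont_onX; apply: (cont_on_sub _ (@cont_on_fmq R m (u 3))).
  by move=> Q [_ XQ]; exact: off_fm3.
Qed.

Lemma dot_linear (l v w : C * C * C) (a : C) :
  dot l (vadd v (vscale a w)) = dot l v + a * dot l w.
Proof. by rewrite /dot /vadd /vscale /=; ring. Qed.

Lemma dot_scale (l w : C * C * C) (a : C) : dot l (vscale a w) = a * dot l w.
Proof. by rewrite /dot /vscale /=; ring. Qed.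

(* On a small disc transverse to the line, hfun is the disc coordinate times a
   square. *)
Lemma hfun_no_sqrt (i : 'I_15) P N : (3 <= i)%N -> on_only i P -> nbhs P N ->
  ~ has_sqrt (N `&` X) hfun.
Proof.
move=> i3 oP PN hN.
have [v0 v0n Pv0] := cptvP P.
(* The line of [m], which misses [P], plays the line at infinity of an affine chart around [P]. *)
have [m mv0] : exists m, dot (cx m) v0 != 0.
  have [a0|a0] := eqVneq v0.1.1 0; last first.
    by exists (1, 0, 0); rewrite /dot /cx /= mul1r !mul0r !addr0.
  have [b0|b0] := eqVneq v0.1.2 0; last first.
    by exists (0, 1, 0); rewrite /dot /cx /= mul1r !mul0r addr0 add0r.
  have [c0|c0] := eqVneq v0.2 0; last first.
    by exists (0, 0, 1); rewrite /dot /cx /= mul1r !mul0r !add0r.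
  by exfalso; apply: v0n; rewrite [v0]surjective_pairing [v0.1]surjective_pairing a0 b0 c0.
pose v := vscale (dot (cx m) v0)^-1 v0.
have Pv : P = cptv v by rewrite Pv0 /v cptv_scale// invr_eq0.
have mv : dot (cx m) v = 1 by rewrite /v dot_scale mulVf.
have vn : v <> (0, 0, 0).
  by move=> e; move: mv; rewrite e /dot !mulr0 !addr0 => /eqP; rewrite eq_sym oner_eq0.
have iv : dot (cx (u i)) v = 0 by apply/(fm_cptv _ vn); rewrite -Pv; exact: oP.1.
have uu : dot (cx (u i)) (cx (u i)) != 0.
  have -> : dot (cx (u i)) (cx (u i)) = ((dot (u i) (u i))%:C%C : C).
    exact: dot_cx.
  apply: contraNneq (homog_neq0 R s t i) => h; have {h} := complexI h.
  rewrite /dot -!expr2 => /eqP; rewrite paddr_eq0 ?addr_ge0 ?sqr_ge0// => /andP[].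
  rewrite paddr_eq0 ?sqr_ge0// !sqrf_eq0 => /andP[/eqP h1 /eqP h2] /eqP h3.
  by rewrite [u i]surjective_pairing [(u i).1]surjective_pairing h1 h2 h3.
(* The direction sought has value 1 under [u i] and 0 under [m], so that [fmq (u i) m] at the point
   of parameter [w] is [w] itself. The real vector [u i] is transverse to its own line; [n] corrects
   it along [v]. *)
pose n0 := vscale (dot (cx (u i)) (cx (u i)))^-1 (cx (u i)).
have in0 : dot (cx (u i)) n0 = 1 by rewrite /n0 dot_scale mulVf.
pose n := vadd n0 (vscale (- dot (cx m) n0) v).
have mn : dot (cx m) n = 0 by rewrite /n dot_linear mv mulr1 subrr.
have inn : dot (cx (u i)) n = 1 by rewrite /n dot_linear iv mulr0 addr0.
pose tau w := vadd v (vscale w n).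
have mtau w : dot (cx m) (tau w) = 1 by rewrite /tau dot_linear mn mulr0 addr0.
have taun w : tau w <> (0, 0, 0).
  by move=> e; have := mtau w; rewrite e /dot !mulr0 !addr0 => /eqP; rewrite eq_sym oner_eq0.
have itau w : dot (cx (u i)) (tau w) = w by rewrite /tau dot_linear iv inn mulr1 add0r.
have mP : fm m P != 0.
  by apply/eqP; rewrite Pv => /(fm_cptv _ vn); rewrite mv => /eqP; rewrite oner_eq0.
have [N' PN' [hN' _]] := hfun_local i3 oP mP.
have ct : cont_on setT (fun w => cptv (tau w)) by apply: cont_on_pencil => w _; exact: taun.
have tau0 : cptv (tau 0) = P by rewrite /tau vscale0 vadd0.
pose M := N `&` N' `&` [set Q | forall j : 'I_15, (3 <= j)%N -> j != i -> ~ line s t j Q].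
have PM : nbhs (cptv (tau 0)) M.
  by rewrite tau0; apply: filterI; [exact: filterI|exact: near_off_others].
have /nbhs_real_ball[e e0 eM] := (cont_onP _ _).1 ct 0 I _ PM.
have e0' : 0 < (e%:C%C : C) by rewrite ltcR.
apply: (disc_no_sqrt e0').
have tX w : w != 0 /\ `|w| < (e%:C%C : C) -> (N `&` N' `&` X) (cptv (tau w)).
  move=> [w0 we]; have [[Nw N'w] ow] := eM w ltac:(by rewrite sub0r normrN) I.
  split => // j j3; have [->|ji] := eqVneq j i; last exact: ow.
  by rewrite /line /= => /(fm_cptv _ (taun w)); rewrite itau; apply/eqP.
apply: (@has_sqrt_eq _ _ _ (fun w => fmq (u i) m (cptv (tau w)))).
  by move=> w _; rewrite fmq_cptv// itau mtau divr1.
apply: (has_sqrt_comp (B := N `&` N' `&` X)); first exact: tX.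
  exact: cont_on_sub ct.
apply: (@has_sqrt_eq _ _ _ (fun Q => hfun Q * fmq (u i) m Q * hfun Q * (hfun Q)^-1 ^+ 2)).
  by move=> Q [_ XQ]; rewrite expr2; field; exact: hfun_neq0.
apply: has_sqrtM; first apply: has_sqrtM.
- by apply: has_sqrt_sub hN' => Q [[]].
- by apply: has_sqrt_sub hN => Q [[]].
- apply: has_sqrt_sqr; apply: cont_onV => [Q [_]|]; first exact: hfun_neq0.
  by apply: (cont_on_sub _ cont_on_hfun) => Q [].
Qed.

(** In a bidisc with the equation [W] of the line as second coordinate, the dichotomy leaves a root
    of [k * W], as [k] has none; [hfun * W] has one too, and the two factors [W] cancel up to a
    square. *)
Lemma local_root_product (k : CP2 R -> C) (i : 'I_15) P : (3 <= i)%N -> on_only i P ->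
  fm (1, 0, 0) P != 0 -> (u i).2 != 0 ->
  cont_on X k -> (forall Q, X Q -> k Q != 0) ->
  (forall N, nbhs P N -> ~ has_sqrt (N `&` X) k) ->
  exists2 N, nbhs P N & has_sqrt (N `&` X) (fun Q => k Q * hfun Q).
Proof.
move=> i3 oP xP u3 ck k0 nk.
have u3' : (((u i).2)%:C%C : C) != 0.
  by apply: contraNneq u3 => h; apply/eqP; exact: (complexI h).
pose e1 : R * R * R := (1, 0, 0); pose e2 : R * R * R := (0, 1, 0).
(* Inverse of the affine coordinates (y/x, u_i/x); solving for the third homogeneous coordinate
   divides by the third coefficient of [u i]. *)
pose chi (x : C * C) : C * C * C :=
  (1, x.1, (x.2 - ((u i).1.1)%:C%C - ((u i).1.2)%:C%C * x.1) / ((u i).2)%:C%C).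
have chin x : chi x <> (0, 0, 0) by case=> /eqP; rewrite oner_eq0.
have cchi : cont_on setT (fun x => cptv (chi x)).
  have c1 : cont_on setT (fun x : C * C => x.1) by exact: cont_on_fst.
  have c2 : cont_on setT (fun x : C * C => x.2) by exact: cont_on_snd.
  apply: cont_on_cptv; [exact: cont_on_cst|exact: c1| |by move=> x _; exact: chin].
  apply: (@cont_onM C); last exact: cont_on_cst.
  apply: (@cont_onD C); first apply: (@cont_onD C); [exact: c2|exact: cont_on_cst|].
  apply: (@cont_onN C); apply: (@cont_onM C); [exact: cont_on_cst|exact: c1].
pose U Q := fmq e2 e1 Q; pose W Q := fmq (u i) e1 Q.
have chiK Q : fm e1 Q != 0 -> cptv (chi (U Q, W Q)) = Q.
  have [v vn ->] := cptvP Q => h.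
  have v1 : v.1.1 != 0.
    apply: contraNneq h => v1; apply/eqP/(fm_cptv _ vn).
    by rewrite /dot /cx /= v1 mulr0 !mul0r !addr0.
  rewrite /U /W !fmq_cptv// -[RHS](cptv_scale _ (invr_neq0 v1)); congr cptv.
  rewrite /chi /vscale /dot /cx /= !mul1r !mul0r !addr0 add0r mulVf//.
  congr (_, _, _); first by rewrite mulrC.
  by field; rewrite v1.
have iP : fm (u i) P = 0 by exact: oP.1.
have chiP : cptv (chi (U P, 0)) = P by rewrite -{2}(chiK P xP) /W /fmq iP mul0r.
have chi_i x : line s t i (cptv (chi x)) <-> x.2 = 0.
  rewrite /line /= fm_cptv//.
  have -> : dot (cx (u i)) (chi x) = x.2 by rewrite /dot /cx /chi /=; field.
  by [].
have oP' : nbhs (cptv (chi (U P, 0))) [set Q | forall j : 'I_15, (3 <= j)%N -> j != i -> ~ line s t j Q].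
  by rewrite chiP; exact: near_off_others.
have [[A1 A2] /= [A1P A2P] A12] := (cont_onP _ _).1 cchi (U P, 0) I _ oP'.
have [d d0 dA] := nbhs_real_ball A1P; have [e e0 eA] := nbhs_real_ball A2P.
pose B := punctured_bidisc (U P) d e.
have BX x : B x -> X (cptv (chi x)).
  case: x => a w [/= ad w0 we] j j3.
  have [->|ji] := eqVneq j i; first by move=> /chi_i/eqP; apply/negP.
  apply: (A12 (a, w)) => //; split; [apply: dA|apply: eA].
    by rewrite distrC.
  by rewrite sub0r normrN.
have cU : cont_on [set Q | fm e1 Q != 0] U by exact: cont_on_fmq.
have cW : cont_on [set Q | fm e1 Q != 0] W by exact: cont_on_fmq.
pose N := [set Q | fm e1 Q != 0 /\ (`|U Q - U P| < (d%:C%C : C) /\ `|W Q| < (e%:C%C : C))].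
have PN : nbhs P N.
  have h0 : nbhs P [set Q | fm e1 Q != 0] by apply: open_nbhs_nbhs; split => //; exact: open_fm.
  have hU : nbhs (U P) [set z : C | `|z - U P| < (d%:C%C : C)].
    apply/nbhs_ballP; exists (d%:C%C : C) => [|z]; first by rewrite /= ltcR.
    by rewrite -ball_normE /= distrC.
  have hW : nbhs (W P) [set z : C | `|z| < (e%:C%C : C)].
    have WP : W P = 0 by rewrite /W /fmq iP mul0r.
    rewrite WP; apply/nbhs_ballP; exists (e%:C%C : C) => [|z]; first by rewrite /= ltcR.
    by rewrite -ball_normE /= sub0r normrN.
  have := (cont_onP _ _).1 cU P xP _ hU; have := (cont_onP _ _).1 cW P xP _ hW.
  apply: filterS3 h0 => Q /= hQ h1 h2; split => //; split; [exact: h2|exact: h1].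
have NB Q : (N `&` X) Q -> B (U Q, W Q).
  move=> [[xQ [UQ WQ]] XQ]; split => //=.
  by rewrite /W /fmq mulf_neq0 ?invr_eq0//; exact/fm_neq0/XQ.
have cUW : cont_on (N `&` X) (fun Q => (U Q, W Q)).
  by apply: cont_on_pair; [apply: (cont_on_sub _ cU)|apply: (cont_on_sub _ cW)] => Q [[]].
have ck' : cont_on B (fun x => k (cptv (chi x))).
  by apply: cont_on_comp ck; [exact: BX|exact: cont_on_sub cchi].
have k0' x : B x -> k (cptv (chi x)) != 0 by move=> /BX/k0.
have kE Q : (N `&` X) Q -> k (cptv (chi (U Q, W Q))) = k Q.
  by move=> [[xQ _] _]; rewrite chiK.
have [h|h] := punctured_bidisc_dichotomy d0 e0 ck' k0'.
  exfalso; apply: (nk N PN); apply: (has_sqrt_eq kE).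
  exact: (has_sqrt_comp NB cUW h).
have [N' PN' [hN' _]] := hfun_local i3 oP xP.
exists (N `&` N'); first exact: filterI.
apply: (@has_sqrt_eq _ _ _ (fun Q => k Q * W Q * (hfun Q * W Q) * (W Q)^-1 ^+ 2)).
  move=> Q [[NQ _] XQ]; have [_ W0 _] := NB Q (conj NQ XQ).
  by rewrite expr2 /=; field.
have NX : N `&` N' `&` X `<=` N `&` X by move=> Q [[]].
apply: has_sqrtM; first apply: has_sqrtM.
- apply: (has_sqrt_sub NX); apply: (has_sqrt_eq (k := fun Q => k (cptv (chi (U Q, W Q))) * W Q)).
    by move=> Q NQ; rewrite kE.
  exact: (has_sqrt_comp NB cUW h).
- by apply: has_sqrt_sub hN' => Q [[]].
- apply: has_sqrt_sqr; apply: cont_onV => [Q /NX/NB[] //|].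
  by apply: (cont_on_sub _ cW) => Q [[[]]].
Qed.

End Arrangement.
End LocalRoots.

(** * The triangle *)

(** The vertices are the coordinate points, so nonzero coordinates mean that a surrounding-point
    lies on no line joining two vertices. *)
Lemma surrounding_table s t : all (fun i => let u := zcoord s t i in
  [&& zz_norm u.1.1 != 0, zz_norm u.1.2 != 0 & zz_norm u.2 != 0]) (iota 3 12).
Proof. by case: s t => -[]; vm_compute. Qed.

Section Disc.
Variable R : realType.
Local Notation C := (Cplx R).
Variables s t : bool.
Local Notation u := (homog R s t).
Local Notation X := (@off_surrounding R s t).
Local Notation h := (@hfun R s t).

Lemma surrounding_neq0 (i : 'I_15) : (3 <= i)%N ->
  [/\ (u i).1.1 != 0, (u i).1.2 != 0 & (u i).2 != 0].
Proof.
move=> i3; have /allP/(_ i) := surrounding_table s t.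
rewrite mem_iota i3 ltn_ord => /(_ isT) /= /and3P[h1 h2 h3].
by split; exact: ev_neq0.
Qed.

(* The point (r : i s : - (1 + i) t) for r = 1 - q.1, s = q.1 (1 - q.2),
   t = q.1 q.2. The only real linear relation between 1, i and - (1 + i) is that
   their sum is 0, so the line of (a, b, c) is met exactly when a r = b s = c t,
   which gives at most one point of the triangle r + s + t = 1. *)
Definition disc_coord (q : R * R) : C * C * C :=
  (((1 - q.1) +i* 0)%C, (0 +i* (q.1 * (1 - q.2)))%C,
   ((- (q.1 * q.2)) +i* (- (q.1 * q.2)))%C).

Definition disc (q : R * R) : CP2 R := cptv (disc_coord q).

Lemma disc_coord_neq0 q : disc_coord q <> (0, 0, 0).
Proof.
move=> [/eqP]; rewrite subr_eq0 => /eqP <-; rewrite !mul1r => /eqP.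
by rewrite subr_eq0 => /eqP <- /eqP; rewrite oppr_eq0 oner_eq0.
Qed.

Lemma disc_continuous : cont_on setT disc.
Proof.
have c1 : cont_on setT (fun q : R * R => q.1) by exact: cont_on_fst.
have c2 : cont_on setT (fun q : R * R => q.2) by exact: cont_on_snd.
have c12 : cont_on setT (fun q : R * R => q.1 * q.2) by exact: (@cont_onM R).
apply: cont_on_cptv; [| | |by move=> q _; exact: disc_coord_neq0].
- apply: cont_on_complex; last exact: cont_on_cst.
  by apply: (@cont_onD R); [exact: cont_on_cst|exact: (@cont_onN R)].
- apply: cont_on_complex; first exact: cont_on_cst.
  apply: (@cont_onM R); first exact: c1.
  by apply: (@cont_onD R); [exact: cont_on_cst|exact: (@cont_onN R)].
- by apply: cont_on_complex; exact: (@cont_onN R).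
Qed.

Lemma line_disc i q : line s t i (disc q) <->
  (u i).1.1 * (1 - q.1) = (u i).2 * (q.1 * q.2) /\
  (u i).1.2 * (q.1 * (1 - q.2)) = (u i).2 * (q.1 * q.2).
Proof.
rewrite /line /= (fm_cptv _ (disc_coord_neq0 (q := q))).
have -> : dot (cx (u i)) (disc_coord q) =
   (((u i).1.1 * (1 - q.1) - (u i).2 * (q.1 * q.2)) +i*
    ((u i).1.2 * (q.1 * (1 - q.2)) - (u i).2 * (q.1 * q.2)))%C.
  by rewrite /dot /cx /disc_coord /=; simpc; congr (_ +i* _)%C; ring.
split => [[h1 h2]|[-> ->]]; last by rewrite !subrr.
by split; apply/eqP; rewrite -subr_eq0 ?h1 ?h2.
Qed.

Local Notation Q01 := (rect ((0, 1), (0, 1)) : set (R * R)).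

(** The three barycentric coordinates, scaled by nonzero coefficients, are equal: if one vanished
    all would, but their sum is 1. Thus the punctures avoid the sides of the triangle. *)
Lemma line_disc_interior (i : 'I_15) q : (3 <= i)%N -> line s t i (disc q) ->
  [/\ 1 - q.1 != 0, q.1 * (1 - q.2) != 0 & q.1 * q.2 != 0].
Proof.
move=> i3 /line_disc[h1 h2]; have [a0 b0 c0] := surrounding_neq0 i3.
have key : q.1 * q.2 != 0.
  apply/eqP => e; rewrite e mulr0 in h1 h2.
  move: h1 h2 => /eqP; rewrite mulf_eq0 (negbTE a0) /= => /eqP h1 /eqP.
  rewrite mulf_eq0 (negbTE b0) /= => /eqP h2.
  have : 1 = (1 - q.1) + (q.1 * (1 - q.2)) + q.1 * q.2 by ring.
  by rewrite h1 h2 e !addr0 => /eqP; rewrite oner_eq0.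
have ct : (u i).2 * (q.1 * q.2) != 0 by rewrite mulf_neq0.
split => //.
  by apply: contraNneq ct => e; rewrite -h1 e mulr0.
by apply: contraNneq ct => e; rewrite -h2 e mulr0.
Qed.

Lemma line_disc_unique (i : 'I_15) q q' : (3 <= i)%N ->
  line s t i (disc q) -> line s t i (disc q') -> q = q'.
Proof.
move=> i3 iq iq'; have [r0 s0 t0] := line_disc_interior i3 iq.
have [a0 b0 c0] := surrounding_neq0 i3.
have [r0' s0' t0'] := line_disc_interior i3 iq'.
move: iq iq' => /line_disc[h1 h2] /line_disc[h1' h2'].
set a := (u i).1.1 in a0 h1 h1'; set b := (u i).1.2 in b0 h2 h2'.
set c := (u i).2 in c0 h1 h1' h2 h2'.
(* If x is the common value of the three scaled coordinates, their sum being 1 reads x (1/a + 1/b +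
   1/c) = 1; this is that equation cleared of denominators. *)
have sum z w : a * (1 - z) = c * (z * w) -> b * (z * (1 - w)) = c * (z * w) ->
    c * (z * w) * (b * c + a * c + a * b) = a * b * c.
  move=> e1 e2.
  have -> : c * (z * w) * (b * c + a * c + a * b) =
    b * c * (c * (z * w)) + a * c * (c * (z * w)) + a * b * (c * (z * w)) by ring.
  by rewrite -{1}e1 -{1}e2; ring.
have abc : a * b * c != 0 by rewrite !mulf_neq0.
have S0 : b * c + a * c + a * b != 0.
  by apply: contraNneq abc => e; rewrite -(sum _ _ h1 h2) e mulr0.
have e : c * (q.1 * q.2) = c * (q'.1 * q'.2).
  by apply: (mulIf S0); rewrite (sum _ _ h1 h2) (sum _ _ h1' h2').
have e1 : q.1 = q'.1.
  have : 1 - q.1 = 1 - q'.1 by apply: (mulfI a0); rewrite h1 h1'.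
  by move/addrI/oppr_inj.
have q10 : q.1 != 0 by apply: contraNneq t0 => ->; rewrite mul0r.
have e2 : q.2 = q'.2.
  by apply: (mulfI q10); apply: (mulfI c0); rewrite e e1.
by rewrite [q]surjective_pairing [q']surjective_pairing e1 e2.
Qed.

(** Two lines through this point would both have coefficients inversely proportional to its nonzero
    barycentric coordinates, hence proportional to each other. *)
Lemma line_disc_on_only (i : 'I_15) q : (3 <= i)%N -> line s t i (disc q) ->
  on_only s t i (disc q).
Proof.
move=> i3 iq; split => // j j3 ji jq.
have [r0 s0 t0] := line_disc_interior i3 iq.
move: iq jq => /line_disc[h1 h2] /line_disc[h1' h2'].
have /eqP := homog_cross R s t ji; apply; rewrite /cross.
set r := 1 - q.1 in r0 h1 h1'; set x := q.1 * (1 - q.2) in s0 h2 h2'.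
set y := q.1 * q.2 in t0 h1 h1' h2 h2'.
congr (_, _, _).
- apply: (mulIf s0); apply: (mulIf t0); rewrite !mul0r.
  have -> : ((u j).1.2 * (u i).2 - (u j).2 * (u i).1.2) * x * y =
    ((u j).1.2 * x) * ((u i).2 * y) - ((u j).2 * y) * ((u i).1.2 * x) by ring.
  by rewrite h2 h2' subrr.
- apply: (mulIf r0); apply: (mulIf t0); rewrite !mul0r.
  have -> : ((u j).2 * (u i).1.1 - (u j).1.1 * (u i).2) * r * y =
    ((u j).2 * y) * ((u i).1.1 * r) - ((u j).1.1 * r) * ((u i).2 * y) by ring.
  by rewrite h1 h1' subrr.
- apply: (mulIf r0); apply: (mulIf s0); rewrite !mul0r.
  have -> : ((u j).1.1 * (u i).1.2 - (u j).1.2 * (u i).1.1) * r * x =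
    ((u j).1.1 * r) * ((u i).1.2 * x) - ((u j).1.2 * x) * ((u i).1.1 * r) by ring.
  by rewrite h1 h1' h2 h2' subrr.
Qed.

Definition disc_punctures : set (R * R) :=
  [set q | exists2 i : 'I_15, (3 <= i)%N & line s t i (disc q)].
Local Notation P := disc_punctures.

Lemma finite_disc_punctures : finite_set P.
Proof.
have -> : P = \bigcup_(i in [set: 'I_15]) [set q | (3 <= i)%N /\ line s t i (disc q)].
  apply/seteqP; split => q; first by move=> [i i3 iq]; exists i.
  by move=> [i _ [i3 iq]]; exists i.
apply: bigcup_finite => // i _.
have [[q0 [i3 iq0]]|none] := pselect ([set q | (3 <= i)%N /\ line s t i (disc q)] !=set0).
  apply: (sub_finite_set (B := [set q0])) => // q [_ iq].
  exact: (line_disc_unique i3).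
by apply: (sub_finite_set (B := set0)) => // q iq; apply: none; exists q.
Qed.

Lemma off_disc q : ~ P q -> X (disc q).
Proof. by move=> nq i i3 iq; apply: nq; exists i. Qed.

(** Local roots on the square come from continuity away from the punctures and from
    [local_root_product] at them, where exactly one surrounding line passes; [has_sqrt_rect] makes
    them global. *)
Lemma has_sqrt_disc (k : CP2 R -> C) :
  cont_on X k -> (forall Q, X Q -> k Q != 0) ->
  (forall (i : 'I_15) Q N, (3 <= i)%N -> on_only s t i Q -> nbhs Q N ->
     ~ has_sqrt (N `&` X) k) ->
  has_sqrt (Q01 `&` ~` P) (fun q => k (disc q) * h (disc q)).
Proof.
move=> ck k0 nk.
have ckh : cont_on (Q01 `&` ~` P) (fun q => k (disc q) * h (disc q)).
  have cd : cont_on (Q01 `&` ~` P) disc by exact: cont_on_sub disc_continuous.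
  apply: (@cont_onM C); [apply: cont_on_comp ck|apply: cont_on_comp (@cont_on_hfun R s t)] => //;
    by move=> q [_ /off_disc].
have kh0 q : ~ P q -> k (disc q) * h (disc q) != 0.
  by move=> /off_disc Xq; rewrite mulf_neq0 ?k0 ?hfun_neq0.
apply: has_sqrt_rect => /=.
- exact: finite_disc_punctures.
- move=> q Qq; have [[i i3 iq]|nPq] := pselect (P q); last first.
    exact: (has_sqrt_near ckh (conj Qq nPq) (kh0 q nPq)).
  have [r0 _ _] := line_disc_interior i3 iq; have [_ _ c0] := surrounding_neq0 i3.
  have o := line_disc_on_only i3 iq.
  have x0 : fm (1, 0, 0) (disc q) != 0.
    apply/eqP => /(fm_cptv _ (disc_coord_neq0 (q := q))).
    rewrite /dot /cx /= !mul0r !addr0 mul1r => -[/eqP]; exact/negP.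
  have [N qN hN] := local_root_product i3 o x0 c0 ck k0 (fun N => nk i _ N i3 o).
  have U := (cont_onP _ _).1 disc_continuous q I _ qN.
  exists [set y | [set: R * R] y -> N (disc y)]; first exact: U.
  apply: (has_sqrt_comp (B := N `&` X)) hN.
    by move=> y [[_ nPy] Ny]; split; [exact: Ny|exact: off_disc].
  exact: cont_on_sub disc_continuous.
- by move=> q _; exact: kh0.
- exact: ltr01.
- exact: ltr01.
Qed.

(** * Explicit square roots on the vertex lines *)

Local Notation A := ((sgn s)%:~R : C).
Local Notation B := ((sgn t)%:~R : C).
Local Notation s2 := ((Num.sqrt 2)%:C%C : C).

Lemma s2M : s2 * s2 = 2.
Proof. by rewrite -rmorphM /= sqrt2M rmorph_nat. Qed.

Lemma sgnM (b : bool) : ((sgn b)%:~R : C) * (sgn b)%:~R = 1.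
Proof. by case: b; rewrite /= ?mulr1 // mulrN1z mulrNN mulr1. Qed.

Lemma cev (p : zz) : ((ev R p)%:C%C : C) = p.1%:~R + p.2%:~R * s2.
Proof. by rewrite /ev rmorphD rmorphM !rmorph_int. Qed.

Section Forms.
Variable Q : CP2 R.
Local Notation x := (hcoord Q 0 0 : C).
Local Notation y := (hcoord Q 0 1 : C).
Local Notation z := (hcoord Q 0 2 : C).

Lemma fm_explicit :
  [/\ [/\ fm (u 0) Q = z, fm (u 1) Q = x & fm (u 2) Q = y],
      [/\ fm (u 3) Q = x + y + z, fm (u 4) Q = 4 * x + y + z & fm (u 5) Q = 4 * x + y + 4 * z],
      [/\ fm (u 6) Q = 2 * x + 2 * y + z, fm (u 7) Q = 4 * x - 2 * y + z &
          fm (u 8) Q = - x + y + 4 * z],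
      [/\ fm (u 9) Q = 4 * x - 2 * y + A * s2 * z, fm (u 10) Q = 2 * A * s2 * x - 2 * y + z &
          fm (u 11) Q = 2 * x - A * s2 * y + z] &
      [/\ fm (u 12) Q = - x + y + B * s2 * z, fm (u 13) Q = - x + 2 * B * s2 * y + 4 * z &
          fm (u 14) Q = - (B * s2) * x + 4 * y + 2 * z]].
Proof.
have evq n : ((ev R (n, 0))%:C%C : C) = n%:~R by rewrite cev /= mulr0z mul0r addr0.
have evr n : ((ev R (0, n))%:C%C : C) = n%:~R * s2 by rewrite cev /= mulr0z add0r.
rewrite /fm /lf /homog /= !evq !evr !rmorphN !rmorphM /=.
by split; split; ring.
Qed.

End Forms.

(** A square root of [A * B]. On the three vertex lines the factors of proportionality of the six
    pairs multiply to 2AB, 4AB and 4AB; together with [s2] and 2 it provides the constants of the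
    roots. *)
Definition half_turn : C := if s == t then 1 else 'i%C.
Local Notation m := half_turn.

Lemma half_turnM : m * m = A * B.
Proof.
rewrite /half_turn; case: s t => -[] //=; rewrite ?mulr1// -?expr2 ?sqr_i ?mul1r ?mulr1 ?mulrN1z//.
by rewrite sqrrN expr1n.
Qed.

Definition ratios (l : seq nat) (Q : CP2 R) : C := \prod_(i <- l) fmq (u i) (u 3) Q.

(* Square roots of h on the three vertex lines: on such a line the factors
   of h come in proportional pairs, one of each pair is kept. *)
Definition root1 Q := m * s2 * A * ratios [:: 3; 4; 7; 8; 10; 13]%N Q.
Definition root2 Q := 2 * m * ratios [:: 3; 5; 6; 7; 9; 12]%N Q.
Definition root3 Q := 2 * m * ratios [:: 3; 4; 6; 8; 9; 12]%N Q.

Lemma hfunE Q : h Q = ratios [:: 3; 4; 5; 6; 7; 8; 9; 10; 11; 12; 13; 14]%N Q.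
Proof.
by rewrite /hfun -(big_geq_mkord 3 15 xpredT (fun i => fmq (u i) (u 3) Q)).
Qed.

Lemma cont_on_ratios l : cont_on X (ratios l).
Proof.
apply: cont_on_prod => i _; apply: (cont_on_sub _ (@cont_on_fmq R (u i) (u 3))).
by move=> Q; exact: off_fm3.
Qed.

Lemma ratiosE l Q : ratios l Q = (\prod_(i <- l) fm (u i) Q) / fm (u 3) Q ^+ size l.
Proof.
rewrite /ratios; elim: l => [|i l IHl]; first by rewrite !big_nil divr1.
by rewrite !big_cons IHl /fmq /= exprS invfM mulrACA.
Qed.

Let As2 : A * s2 * (A * s2) = 2.
Proof. by rewrite mulrACA sgnM s2M mul1r. Qed.

Let Bs2 : B * s2 * (B * s2) = 2.
Proof. by rewrite mulrACA sgnM s2M mul1r. Qed.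

(** The pairs are those of [triples] containing the vertex: a point collinear with the vertex and
    another one has, on the dual line of the vertex, a form proportional to that of the other. *)
Lemma root1_sqr Q : line s t 0 Q -> root1 Q ^+ 2 = h Q.
Proof.
have [[e0 e1 e2] [e3 e4 e5] [e6 e7 e8] [e9 e10 e11] [e12 e13 e14]] := fm_explicit Q.
rewrite /line /= e0 => z0; rewrite z0 ?mulr0 ?addr0 in e3 e4 e5 e6 e7 e8 e9 e10 e11 e12 e13 e14.
have p1 : fm (u 6) Q = 2 * fm (u 3) Q by rewrite e6 e3; ring.
have p2 : fm (u 5) Q = fm (u 4) Q by rewrite e5 e4.
have p3 : fm (u 9) Q = fm (u 7) Q by rewrite e9 e7.
have p4 : fm (u 12) Q = fm (u 8) Q by rewrite e12 e8.
have p5 : 2 * fm (u 11) Q = A * s2 * fm (u 10) Q.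
  rewrite e11 e10.
  have -> : A * s2 * (2 * A * s2 * hcoord Q 0 0 - 2 * hcoord Q 0 1) =
    2 * (A * s2 * (A * s2) * hcoord Q 0 0 - A * s2 * hcoord Q 0 1) by ring.
  by rewrite As2.
have p6 : fm (u 14) Q = B * s2 * fm (u 13) Q.
  rewrite e14 e13.
  have -> : B * s2 * (- hcoord Q 0 0 + 2 * B * s2 * hcoord Q 0 1) =
    - (B * s2) * hcoord Q 0 0 + 2 * (B * s2 * (B * s2)) * hcoord Q 0 1 by ring.
  by rewrite Bs2; ring.
have D12 : (fm (u 3) Q ^+ 12)^-1 = (fm (u 3) Q ^+ 6)^-1 * (fm (u 3) Q ^+ 6)^-1.
  by rewrite -invfM -exprD.
rewrite hfunE /root1 !ratiosE /= !big_cons !big_nil p1 p2 p3 p4 p6 D12.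
move: (fm (u 3) Q ^+ 6)^-1 p5 => D; move: (fm (u 3) Q) (fm (u 4) Q) (fm (u 7) Q) (fm (u 8) Q) (fm (u 10) Q) (fm (u 11) Q) (fm (u 13) Q).
move=> a b c d e f g p5.
have -> : (m * s2 * A * (a * (b * (c * (d * (e * (g * 1))))) * D)) ^+ 2 =
  (m * m) * (A * s2 * (A * s2)) * (a * b * c * d * e * g * D) ^+ 2 by ring.
rewrite half_turnM As2.
have -> : a * (b * (b * (2 * a * (c * (d * (c * (e * (f * (d * (g * (B * s2 * g * 1))))))))))) * (D * D) =
  (2 * f) * e * (B * s2) * (a * b * c * d * g * D) ^+ 2 by ring.
rewrite p5.
have -> : A * s2 * e * e * (B * s2) * (a * b * c * d * g * D) ^+ 2 =
   A * B * (s2 * s2) * (a * b * c * d * e * g * D) ^+ 2 by ring.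
by rewrite s2M.
Qed.

Lemma root2_sqr Q : line s t 1 Q -> root2 Q ^+ 2 = h Q.
Proof.
have [[e0 e1 e2] [e3 e4 e5] [e6 e7 e8] [e9 e10 e11] [e12 e13 e14]] := fm_explicit Q.
rewrite /line /= e1 => x0; rewrite x0 ?mulr0 ?oppr0 ?add0r in e3 e4 e5 e6 e7 e8 e9 e10 e11 e12 e13 e14.
have p1 : fm (u 4) Q = fm (u 3) Q by rewrite e4 e3.
have p2 : fm (u 8) Q = fm (u 5) Q by rewrite e8 e5.
have p3 : fm (u 14) Q = 2 * fm (u 6) Q by rewrite e14 e6; ring.
have p4 : fm (u 10) Q = fm (u 7) Q by rewrite e10 e7.
have p5 : 2 * fm (u 11) Q = A * s2 * fm (u 9) Q.
  rewrite e11 e9.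
  have -> : A * s2 * (- (2 * hcoord Q 0 1) + A * s2 * hcoord Q 0 2) =
    A * s2 * (A * s2) * hcoord Q 0 2 - 2 * (A * s2 * hcoord Q 0 1) by ring.
  by rewrite As2; ring.
have p6 : fm (u 13) Q = 2 * (B * s2) * fm (u 12) Q.
  rewrite e13 e12.
  have -> : 2 * (B * s2) * (hcoord Q 0 1 + B * s2 * hcoord Q 0 2) =
    2 * B * s2 * hcoord Q 0 1 + 2 * (B * s2 * (B * s2)) * hcoord Q 0 2 by ring.
  by rewrite Bs2; ring.
have D12 : (fm (u 3) Q ^+ 12)^-1 = (fm (u 3) Q ^+ 6)^-1 * (fm (u 3) Q ^+ 6)^-1.
  by rewrite -invfM -exprD.
rewrite hfunE /root2 !ratiosE /= !big_cons !big_nil p1 p2 p3 p4 p6 D12.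
move: (fm (u 3) Q ^+ 6)^-1 p5 => D; move: (fm (u 3) Q) (fm (u 5) Q) (fm (u 6) Q) (fm (u 7) Q) (fm (u 9) Q) (fm (u 11) Q) (fm (u 12) Q).
move=> a b c d e f g p5.
have -> : (2 * m * (a * (b * (c * (d * (e * (g * 1))))) * D)) ^+ 2 =
  4 * (m * m) * (a * b * c * d * e * g * D) ^+ 2 by ring.
rewrite half_turnM.
have -> : a * (a * (b * (c * (d * (b * (e * (d * (f * (g * (2 * (B * s2) * g * (2 * c * 1))))))))))) * (D * D) =
  2 * (2 * f) * e * (B * s2) * (a * b * c * d * g * D) ^+ 2 by ring.
rewrite p5.
have -> : 2 * (A * s2 * e) * e * (B * s2) * (a * b * c * d * g * D) ^+ 2 =
   2 * (s2 * s2) * (A * B) * (a * b * c * d * e * g * D) ^+ 2 by ring.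
by rewrite s2M; ring.
Qed.

Lemma root3_sqr Q : line s t 2 Q -> root3 Q ^+ 2 = h Q.
Proof.
have [[e0 e1 e2] [e3 e4 e5] [e6 e7 e8] [e9 e10 e11] [e12 e13 e14]] := fm_explicit Q.
rewrite /line /= e2 => y0; rewrite y0 ?mulr0 ?subr0 ?addr0 in e3 e4 e5 e6 e7 e8 e9 e10 e11 e12 e13 e14.
have p1 : fm (u 5) Q = 4 * fm (u 3) Q by rewrite e5 e3; ring.
have p2 : fm (u 7) Q = fm (u 4) Q by rewrite e7 e4.
have p3 : fm (u 11) Q = fm (u 6) Q by rewrite e11 e6.
have p4 : fm (u 13) Q = fm (u 8) Q by rewrite e13 e8.
have p5 : 2 * fm (u 10) Q = A * s2 * fm (u 9) Q.
  rewrite e10 e9.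
  have -> : A * s2 * (4 * hcoord Q 0 0 + A * s2 * hcoord Q 0 2) =
    A * s2 * (A * s2) * hcoord Q 0 2 + 4 * (A * s2 * hcoord Q 0 0) by ring.
  by rewrite As2; ring.
have p6 : fm (u 14) Q = B * s2 * fm (u 12) Q.
  rewrite e14 e12.
  have -> : B * s2 * (- hcoord Q 0 0 + B * s2 * hcoord Q 0 2) =
    - (B * s2) * hcoord Q 0 0 + (B * s2 * (B * s2)) * hcoord Q 0 2 by ring.
  by rewrite Bs2; ring.
have D12 : (fm (u 3) Q ^+ 12)^-1 = (fm (u 3) Q ^+ 6)^-1 * (fm (u 3) Q ^+ 6)^-1.
  by rewrite -invfM -exprD.
rewrite hfunE /root3 !ratiosE /= !big_cons !big_nil p1 p2 p3 p4 p6 D12.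
move: (fm (u 3) Q ^+ 6)^-1 p5 => D; move: (fm (u 3) Q) (fm (u 4) Q) (fm (u 6) Q) (fm (u 8) Q) (fm (u 9) Q) (fm (u 10) Q) (fm (u 12) Q).
move=> a b c d e f g p5.
have -> : (2 * m * (a * (b * (c * (d * (e * (g * 1))))) * D)) ^+ 2 =
  4 * (m * m) * (a * b * c * d * e * g * D) ^+ 2 by ring.
rewrite half_turnM.
have -> : a * (b * (4 * a * (c * (b * (d * (e * (f * (c * (g * (d * (B * s2 * g * 1))))))))))) * (D * D) =
  2 * (2 * f) * e * (B * s2) * (a * b * c * d * g * D) ^+ 2 by ring.
rewrite p5.
have -> : 2 * (A * s2 * e) * e * (B * s2) * (a * b * c * d * g * D) ^+ 2 =
   2 * (s2 * s2) * (A * B) * (a * b * c * d * e * g * D) ^+ 2 by ring.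
by rewrite s2M; ring.
Qed.

Lemma root13_vertex Q : line s t 0 Q -> line s t 2 Q -> root1 Q = root3 Q.
Proof.
have [[e0 e1 e2] [e3 e4 e5] [e6 e7 e8] [e9 e10 e11] [e12 e13 e14]] := fm_explicit Q.
rewrite /line /= e0 e2 => z0 y0.
rewrite z0 y0 ?mulr0 ?oppr0 ?addr0 in e3 e4 e6 e7 e8 e9 e10 e12 e13.
rewrite /root1 /root3 !ratiosE /= !big_cons !big_nil e3 e4 e6 e7 e8 e9 e10 e12 e13.
move: (hcoord Q 0 0 : C) => x; move: (_ ^+ 6)^-1 => D.
have -> : m * s2 * A * (x * (4 * x * (4 * x * (- x * (2 * A * s2 * x * (- x * 1))))) * D) =
  A * s2 * (A * s2) * (32 * m * x ^+ 6 * D) by ring.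
by rewrite As2; ring.
Qed.

(** The sign that tells the arrangements apart. At (0 : 1 : 0) both sides are 16AB times
    [half_turn], up to a common factor. The factor [A] in [root1] was put there to make [root1] and
    [root3] agree at (1 : 0 : 0), so the whole discrepancy is concentrated here. *)
Lemma root12_vertex Q : line s t 0 Q -> line s t 1 Q -> root1 Q = A * B * root2 Q.
Proof.
have [[e0 e1 e2] [e3 e4 e5] [e6 e7 e8] [e9 e10 e11] [e12 e13 e14]] := fm_explicit Q.
rewrite /line /= e0 e1 => z0 x0.
rewrite z0 x0 ?mulr0 ?oppr0 ?add0r ?addr0 in e3 e4 e5 e6 e7 e8 e9 e10 e12 e13.
rewrite /root1 /root2 !ratiosE /= !big_cons !big_nil e3 e4 e5 e6 e7 e8 e9 e10 e12 e13.
move: (hcoord Q 0 1 : C) => y; move: (_ ^+ 6)^-1 => D.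
have -> : m * s2 * A * (y * (y * (- (2 * y) * (y * (- (2 * y) * (2 * B * s2 * y * 1))))) * D) =
  s2 * s2 * (8 * A * B * m * y ^+ 6 * D) by ring.
by rewrite s2M; ring.
Qed.

Lemma root23_vertex Q : line s t 1 Q -> line s t 2 Q -> root2 Q = root3 Q.
Proof.
have [[e0 e1 e2] [e3 e4 e5] [e6 e7 e8] [e9 e10 e11] [e12 e13 e14]] := fm_explicit Q.
rewrite /line /= e1 e2 => x0 y0.
rewrite x0 y0 ?mulr0 ?oppr0 ?add0r ?addr0 in e3 e4 e5 e6 e7 e8 e9 e12.
by rewrite /root2 /root3 !ratiosE /= !big_cons !big_nil e3 e4 e5 e6 e7 e8 e9 e12; ring.
Qed.

Lemma cont_on_root1 : cont_on X root1.
Proof. by apply: (@cont_onM C) => [|]; [exact: cont_on_cst|exact: cont_on_ratios]. Qed.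

Lemma cont_on_root2 : cont_on X root2.
Proof. by apply: (@cont_onM C) => [|]; [exact: cont_on_cst|exact: cont_on_ratios]. Qed.

Lemma cont_on_root3 : cont_on X root3.
Proof. by apply: (@cont_onM C) => [|]; [exact: cont_on_cst|exact: cont_on_ratios]. Qed.

Definition vertex_lines : set (CP2 R) :=
  [set Q | exists2 i : 'I_15, (i < 3)%N & line s t i Q].
Local Notation T := vertex_lines.

Lemma vertex_linesP Q : T Q <-> [\/ line s t 0 Q, line s t 1 Q | line s t 2 Q].
Proof.
split; last by case=> iQ; [exists 0|exists 1|exists 2].
by move=> [[[|[|[|//]]] ?] _ iQ]; [apply: Or31|apply: Or32|apply: Or33].
Qed.

(** When [A * B] is 1 the three roots agree wherever two vertex lines meet, so they paste along
    these closed sets. *)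
Lemma has_sqrt_vertex_lines : s = t -> has_sqrt (T `&` X) h.
Proof.
move=> st; have AB : A * B = 1 by rewrite st sgnM.
pose r Q := if pselect (line s t 0 Q) then root1 Q else
  if pselect (line s t 1 Q) then root2 Q else root3 Q.
have r1 Q : line s t 0 Q -> r Q = root1 Q by move=> l0; rewrite /r; case: pselect.
have r2 Q : line s t 1 Q -> r Q = root2 Q.
  move=> l1; rewrite /r; case: pselect => [l0|n0] /=; first by rewrite root12_vertex// AB mul1r.
  by case: pselect.
have r3 Q : line s t 2 Q -> r Q = root3 Q.
  move=> l2; rewrite /r; case: pselect => [l0|n0] /=; first exact: root13_vertex.
  by case: pselect => // l1; exact: root23_vertex.
exists r; last first.
  by move=> Q [/vertex_linesP[] lQ _];
    [rewrite r1// root1_sqr|rewrite r2// root2_sqr|rewrite r3// root3_sqr].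
have XT F : (T `&` X) `&` F `<=` X by move=> Q [[]].
apply: (@cont_on_closedU _ _ _ (line s t 0) (line s t 1 `|` line s t 2)).
- exact: line_closed.
- by apply: closedU; exact: line_closed.
- by move=> Q [/vertex_linesP[] lQ _]; [left|right; left|right; right].
- by apply: (cont_on_eq _ (cont_on_sub (@XT _) cont_on_root1)) => Q [_ /r1].
apply: (@cont_on_closedU _ _ _ (line s t 1) (line s t 2)).
- exact: line_closed.
- exact: line_closed.
- by move=> Q [].
- apply: (cont_on_eq _ (cont_on_sub _ cont_on_root2)) => [Q [_ /r2]//|Q [/XT]//].
- apply: (cont_on_eq _ (cont_on_sub _ cont_on_root3)) => [Q [_ /r3]//|Q [/XT]//].
Qed.

Definition boundary : set (R * R) :=
  [set q | Q01 q /\ [\/ q.1 = 0, q.1 = 1, q.2 = 0 | q.2 = 1]].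

Lemma boundary_off q : boundary q -> ~ P q.
Proof.
move=> [_ bq] [i i3 /(line_disc_interior i3)[r0 s0 t0]].
case: bq => e; move: r0 s0 t0; rewrite e ?subr0 ?subrr ?mulr0 ?mul0r ?eqxx //.
Qed.

Lemma line0_disc x : line s t 0 (disc (x, 0)).
Proof.
by apply/line_disc; rewrite /homog /= !ev0 /= !mul0r !mulr0.
Qed.

Lemma line1_disc y : line s t 1 (disc (1, y)).
Proof.
by apply/line_disc; rewrite /homog /= !ev0 /= subrr !mul0r !mulr0.
Qed.

Lemma line2_disc x : line s t 2 (disc (x, 1)).
Proof.
by apply/line_disc; rewrite /homog /= !ev0 /= subrr !mul0r !mulr0.
Qed.

Lemma disc0 y : disc (0, y) = disc (0, 0).
Proof. by rewrite /disc /disc_coord /= !mul0r. Qed.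

Lemma boundary_vertex_lines q : boundary q -> (T `&` X) (disc q).
Proof.
move=> bq; split; last exact/off_disc/boundary_off.
case: q bq => x y [_ /= bq]; apply/vertex_linesP; case: bq => ->.
- by rewrite disc0; apply: Or31; exact: line0_disc.
- by apply: Or32; exact: line1_disc.
- by apply: Or31; exact: line0_disc.
- by apply: Or33; exact: line2_disc.
Qed.

(* Around the triangle the roots root1, root2, root3 agree at two vertices and
   differ by the factor A * B at the third one. *)
Lemma has_sqrt_boundary : has_sqrt boundary (fun q => h (disc q)) -> s = t.
Proof.
move=> [sg csg sgh]; apply: contrapT => st.
have AB : A * B = -1 by move: st; case: s t => -[] //=; rewrite ?mulr1 ?mul1r mulrN1z.
have side (S : set (R * R)) (r : CP2 R -> C) : S `<=` boundary -> connected S ->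
    cont_on X r -> (forall q, S q -> r (disc q) ^+ 2 = h (disc q)) ->
    exists2 e : C, e ^+ 2 = 1 & forall q, S q -> sg q = e * r (disc q).
  move=> Sb cS cr rh; apply: sqrt_sign => //.
  - exact: cont_on_sub csg.
  - apply: (cont_on_comp (B := X)) cr; first by move=> q /Sb/boundary_vertex_lines[].
    exact: cont_on_sub disc_continuous.
  - by move=> q Sq; rewrite rh// sgh//; exact: Sb.
  - move=> q Sq; rewrite -sqrf_eq0 rh//; apply: hfun_neq0.
    by have [] := boundary_vertex_lines (Sb q Sq).
have [ea ea1 ha] := side _ root1
  (fun q (hq : q.2 = 0 /\ 0 <= q.1 <= 1) => ltac:(by case: q hq => x y /= [-> x01]; split; [split; rewrite /= ?lexx ?ler01|apply: Or43]))
  (segment_y_connected (m := 0) (a := 0) (b := 1)) cont_on_root1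
  (fun q hq => ltac:(by case: q hq => x y /= [-> _]; apply/root1_sqr/line0_disc)).
have [eb eb1 hb] := side _ root2
  (fun q (hq : q.1 = 1 /\ 0 <= q.2 <= 1) => ltac:(by case: q hq => x y /= [-> x01]; split; [split; rewrite /= ?lexx ?ler01|apply: Or42]))
  (segment_x_connected (m := 1) (a := 0) (b := 1)) cont_on_root2
  (fun q hq => ltac:(by case: q hq => x y /= [-> _]; apply/root2_sqr/line1_disc)).
have [ec ec1 hc] := side _ root3
  (fun q (hq : q.2 = 1 /\ 0 <= q.1 <= 1) => ltac:(by case: q hq => x y /= [-> x01]; split; [split; rewrite /= ?lexx ?ler01|apply: Or44]))
  (segment_y_connected (m := 1) (a := 0) (b := 1)) cont_on_root3
  (fun q hq => ltac:(by case: q hq => x y /= [-> _]; apply/root3_sqr/line2_disc)).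
have b00 : boundary (0, 0) by split; [split; rewrite /= lexx ler01|apply: Or41].
(* On the collapsed side h is constant, so the root [sg] can be compared with a constant; it takes
   the same value at both ends. *)
have [ed ed1 hd] := side _ (fun=> sg (0, 0))
  (fun q (hq : q.1 = 0 /\ 0 <= q.2 <= 1) => ltac:(by case: q hq => x y /= [-> x01]; split; [split; rewrite /= ?lexx ?ler01|apply: Or41]))
  (segment_x_connected (m := 0) (a := 0) (b := 1)) (@cont_on_cst _ _ _ _)
  (fun q hq => ltac:(by case: q hq => x y /= [-> _]; rewrite disc0 sgh)).
have i0 : (0 : R) <= (0 : R) <= (1 : R).
  by rewrite lexx ler01.
have i1 : (0 : R) <= (1 : R) <= (1 : R).
  by rewrite ler01 lexx.
have sg01 : sg (0, 1) = sg (0, 0).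
  by rewrite (hd (0, 1) (conj erefl i1)) -(hd (0, 0) (conj erefl i0)).
have nz Q : X Q -> line s t 1 Q -> root2 Q != 0.
  by move=> XQ lQ; rewrite -sqrf_eq0 root2_sqr// hfun_neq0.
have nz3 Q : X Q -> line s t 2 Q -> root3 Q != 0.
  by move=> XQ lQ; rewrite -sqrf_eq0 root3_sqr// hfun_neq0.
have b10 : boundary (1, 0) by split; [split; rewrite /= lexx ler01|apply: Or42].
have b11 : boundary (1, 1) by split; [split; rewrite /= lexx ler01|apply: Or42].
have eab : eb = - ea.
  have := ha (1, 0) (conj erefl i1); rewrite (hb (1, 0) (conj erefl i0)).
  rewrite (root12_vertex (line0_disc 1) (line1_disc 0)) AB mulN1r mulrN -mulNr.
  by apply: mulIf; apply: nz; [exact: (boundary_vertex_lines b10).2|exact: line1_disc].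
have ebc : eb = ec.
  have := hb (1, 1) (conj erefl i1); rewrite (hc (1, 1) (conj erefl i1)).
  rewrite (root23_vertex (line1_disc 1) (line2_disc 1)) => /esym.
  by apply: mulIf; apply: nz3; [exact: (boundary_vertex_lines b11).2|exact: line2_disc].
have eac : ea = ec.
  have := ha (0, 0) (conj erefl i0); rewrite -sg01 (hc (0, 1) (conj erefl i0)).
  have l2 : line s t 2 (disc (0, 0)) by rewrite -(disc0 1); exact: line2_disc.
  rewrite disc0 (root13_vertex (line0_disc 0) l2) => /esym.
  by apply: mulIf; apply: nz3 => //; exact: (boundary_vertex_lines b00).2.
(* Going once around gives [ea = - ea], impossible for a sign. *)
move: eab; rewrite ebc -eac => /eqP; rewrite -addr_eq0 -mulr2n mulrn_eq0 /= => /eqP e0.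
by move: ea1; rewrite e0 expr0n /= => /eqP; rewrite eq_sym oner_eq0.
Qed.

End Disc.

(** * Comparison of two arrangements *)

Section NoHomeomorphism.
Variable R : realType.
Local Notation C := (Cplx R).

(** Let k be the pullback of the target's h. As [s' = t'], k has a root on the vertex lines; k h has
    one on the punctured disc. On the boundary both apply, so h has a root there and
    [has_sqrt_boundary] concludes. *)
Lemma no_homeomorphism s t s' t' (f g : CP2 R -> CP2 R) :
  continuous f -> continuous g -> cancel f g -> cancel g f ->
  (forall P, (exists i : 'I_15, line s t i P) -> exists i : 'I_15, line s' t' i (f P)) ->
  (forall P, (exists i : 'I_15, line s' t' i P) -> exists i : 'I_15, line s t i (g P)) ->
  s' = t' -> s = t.
Proof.
move=> cf cg fg gf fU gU st'.
have [p pI fp] := homeomorphism_lines cf cg fg gf fU gU.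
have p3 := homeomorphism_vertex_lines pI (fun Q => ex_intro _ (g Q) (gf Q)) fp.
have [r pr rp] := injF_bij pI.
have fX Q : @off_surrounding R s t Q <-> @off_surrounding R s' t' (f Q).
  split=> XQ i i3 iQ.
    apply: (XQ (r i)); first by rewrite leqNgt -p3 rp -leqNgt.
    by apply/fp; rewrite rp.
  by apply: (XQ (p i)); [rewrite leqNgt p3 -leqNgt|exact/fp].
have only (i : 'I_15) Q : on_only s t i Q -> on_only s' t' (p i) (f Q).
  move=> [iQ oQ]; split; first exact/fp.
  move=> j j3 ji jQ; apply: (oQ (r j)).
  - by rewrite leqNgt -p3 rp -leqNgt.
  - by apply: contraNneq ji => <-; rewrite rp.
  - by apply/fp; rewrite rp.
pose k Q := @hfun R s' t' (f Q).
have ck : cont_on (@off_surrounding R s t) k.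
  apply: cont_on_comp (@cont_on_hfun R s' t'); first by move=> Q /fX.
  exact: cont_on_continuous.
have k0 Q : @off_surrounding R s t Q -> k Q != 0 by move=> /fX; exact: hfun_neq0.
(* A root of [k] near [Q] would be carried by [g] to a root of the target's h near [f Q]. *)
have nk (i : 'I_15) Q N : (3 <= i)%N -> on_only s t i Q -> nbhs Q N ->
    ~ has_sqrt (N `&` @off_surrounding R s t) k.
  move=> i3 oQ QN hN.
  have pi3 : (3 <= p i)%N by rewrite leqNgt p3 -leqNgt.
  have gN : nbhs (f Q) (g @^-1` N) by apply: cg; rewrite fg.
  apply: (hfun_no_sqrt pi3 (only i Q oQ) gN).
  apply: (@has_sqrt_eq _ _ _ (fun P => k (g P))); first by move=> P _; rewrite /k gf.
  apply: (has_sqrt_comp (B := N `&` @off_surrounding R s t)) hN.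
    by move=> P [NP XP]; split => //; apply/fX; rewrite gf.
  exact: cont_on_continuous.
have hd := has_sqrt_disc ck k0 nk.
have hT : has_sqrt (vertex_lines s t `&` @off_surrounding R s t) k.
  apply: (has_sqrt_comp (B := vertex_lines s' t' `&` @off_surrounding R s' t')).
  - move=> Q [[i i3 iQ] /fX XQ]; split => //; exists (p i); first by rewrite p3.
    exact/fp.
  - exact: cont_on_continuous.
  - exact: has_sqrt_vertex_lines.
apply: (@has_sqrt_boundary R).
have bT q : boundary q -> (vertex_lines s t `&` @off_surrounding R s t) (disc q).
  exact: boundary_vertex_lines.
have bX q : boundary q -> @off_surrounding R s t (disc q) by move=> /bT[].
have cdisc : cont_on (@boundary R) (@disc R) by exact: cont_on_sub (@disc_continuous R).
(* Here h is written as (k h) k / k^2, each factor of which has a root on the boundary. *)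
apply: (@has_sqrt_eq _ _ _ (fun q => k (disc q) * @hfun R s t (disc q) * k (disc q) * (k (disc q))^-1 ^+ 2)).
  by move=> q /bX/k0 kq; rewrite expr2; field.
apply: has_sqrtM; first apply: has_sqrtM.
- by apply: has_sqrt_sub hd => q bq; split; [case: bq|exact: boundary_off].
- exact: (has_sqrt_comp bT).
- apply: has_sqrt_sqr; apply: cont_onV => [q /bX/k0//|].
  exact: cont_on_comp ck.
Qed.

End NoHomeomorphism.

Theorem theorem5p1 (R : realType) (alpha beta : R)
    (halpha : alpha \in [:: -1; 1]) (hbeta : beta \in [:: -1; 1]) :
  [/\ combinatorics (configD alpha beta) =
        [set [set V1; S1; S4]; [set V1; S2; S3]; [set V1; S5; S7 alpha];
             [set V1; S6; S10 beta]; [set V1; S8 alpha; S9 alpha];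
             [set V1; S11 beta; S12 beta];
             [set V2; S1; S2]; [set V2; S3; S6]; [set V2; S4; S12 beta];
             [set V2; S5; S8 alpha]; [set V2; S7 alpha; S9 alpha];
             [set V2; S10 beta; S11 beta];
             [set V3; S1; S3]; [set V3; S2; S5]; [set V3; S4; S9 alpha];
             [set V3; S6; S11 beta]; [set V3; S7 alpha; S8 alpha];
             [set V3; S10 beta; S12 beta]],
      stable (configD alpha beta)
    & forall alpha' beta' : R,
        alpha' \in [:: -1; 1] -> beta' \in [:: -1; 1] ->
        alpha * beta != alpha' * beta' ->
        ~ homeomorphic_pairs (arrangementM alpha beta)
                             (arrangementM alpha' beta')].
Proof.
have sgnP (a : R) : a \in [:: -1; 1] -> exists b : bool, a = (sgn b)%:~R.
  by rewrite !inE => /orP[] /eqP->; [exists false|exists true].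
have [s ->] := sgnP _ halpha; have [t ->] := sgnP _ hbeta.
split; [exact: combinatorics_configD|exact: stable_configD|].
move=> _ _ /sgnP[s' ->] /sgnP[t' ->] st [f [cf [g [cg fg gf]]]].
rewrite !bigcup_arrangementM => fU.
have fM P : (exists i : 'I_15, line s t i P) ->
    exists i : 'I_15, line s' t' i (f P).
  move=> [i iP]; have : (\bigcup_(i in [set: 'I_15]) line s' t' i) (f P).
    by rewrite -fU; exists P => //; exists i.
  by move=> [j _ jP]; exists j.
have gM P : (exists i : 'I_15, line s' t' i P) ->
    exists i : 'I_15, line s t i (g P).
  move=> [i iP]; have : (\bigcup_(i in [set: 'I_15]) line s' t' i) P by exists i.
  by rewrite -fU => -[Q [j _ jQ] <-]; rewrite fg; exists j.
have h1 := no_homeomorphism cf cg fg gf fM gM.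
have h2 := no_homeomorphism cg cf gf fg gM fM.
(* The product of two signs records whether the booleans agree, so [h1] and [h2] together say that
   both arrangements have the same product. *)
have sgn_eqb (b c : bool) : (sgn b)%:~R * (sgn c)%:~R = (sgn (b == c))%:~R :> R.
  by rewrite -intrM; case: b c => -[].
by move/eqP: st; rewrite !sgn_eqb; apply; congr (sgn _)%:~R; apply/eqP/eqP.
Qed.
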